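(* Let $(\mathcal{A},\tau,\tau',t)$ be a tracial real infinitesimal probability space and let $\mathcal{A}_1,\dots,\mathcal{A}_s\subseteq\mathcal{A}$ be unital subalgebras invariant under $a\mapsto a^t$. Then the following are equivalent: (i) $\mathcal{A}_1,\dots,\mathcal{A}_s$ are real infinitesimally free; (ii) mixed free cumulants and mixed real infinitesimal cumulants vanish, i.e. for every $n\ge2$ and all $a_1,\dots,a_n$ with $a_i\in\mathcal{A}_{j_i}$ such that the indices $j_1,\dots,j_n$ are not all equal, $\kappa_n(a_1,\dots,a_n)=0$ and $\kappa_n'(a_1,\dots,a_n)=0$.
   Context: A tracial real infinitesimal probability space: unital complex algebra $\mathcal{A}$ with involution $a\mapsto a^t$ (linear, $(ab)^t=b^ta^t$, $(a^t)^t=a$), linear $\tau$ with $\tau(1)=1$ and $\tau(a^t)=\tau(a)$, linear $\tau'$ with $\tau'(1)=0$, both $\tau,\tau'$ tracial. $\kappa_n$ are the free cumulants of $\tau$. Real infinitesimal freeness: whenever $a_i\in\mathcal{A}_{j_i}$, $\tau(a_i)=0$, $j_1\ne j_2,\dots,j_{n-1}\ne j_n$: (1) $\tau(a_1\cdots a_n)=0$; (2) for $n=2$, $\tau'(a_1a_2)=0$; (3) for $n=2k-1\ge3$, $\tau'(a_1\cdots a_n)=\tau(a_1a_n)\tau'(a_2\cdots a_{n-1})+\tau(a_1a_k^ta_n)\tau(a_2a_{k+1}^t)\cdots\tau(a_{k-1}a_{n-1}^t)$; (4) for $n=2k\ge4$, $\tau'(a_1\cdots a_n)=\tau(a_1a_n)\tau'(a_2\cdots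 a_{n-1})+\tau(a_1a_{k+1}^t)\cdots\tau(a_ka_n^t)$. Real infinitesimal cumulants $\kappa_n'$: $\kappa_1'(a)=\tau'(a)$, and for $n\ge2$, recursively, $\tau'(a_1\cdots a_n)=\sum_{\pi\in NC(n)}\partial\kappa_\pi(a_1,\dots,a_n)+\sum_{\sigma\in S_{NC}^\delta(n,-n)}\kappa_{\sigma/2}(a_1,\dots,a_n)$. Here $NC(n)$ is the set of non-crossing partitions of $\{1,\dots,n\}$, $\partial\kappa_\pi=\sum_{V\in\pi}\kappa'_{|V|}(\cdot\mid V)\prod_{W\ne V}\kappa_{|W|}(\cdot\mid W)$ (arguments restricted to the block, in increasing order). On $[\pm n]$, $\delta(k)=-k$, $\gamma_n=(1,\dots,n)$; $S_{NC}^\delta(n,-n)$ is the set of permutations $\sigma$ of $[\pm n]$ such that $\langle\sigma,\gamma_n\delta\gamma_n^{-1}\delta\rangle$ is transitive, $\#(\sigma)+\#(\sigma^{-1}\gamma_n\delta\gamma_n^{-1}\delta)=2n$ ($\#$ = number of cycles) and $\sigma\delta$ is a fixed-point-free involution; its cycles come in pairs $\{c,\delta c^{-1}\delta\}$, and $\kappa_{\sigma/2}(a_1,\dots,a_n)=\prod_{\{c,c'\}}\kappa_{k+l}(a_{i_1},\dots,a_{i_k},a_{j_l}^t,\dots,a_{j_1}^t)$ where one cycle of each pair is written $c=(i_1,\dots,i_k,-j_l,\dots,-j_1)$ with positive $i$'s and $j$'s each in cyclic order. *)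

(* Defs.v *)
From HB Require Import structures.
From mathcomp Require Import all_boot all_order all_algebra all_fingroup.
From mathcomp Require Import complex Rstruct.
Set Implicit Arguments.
Unset Strict Implicit.
Unset Printing Implicit Defensive.
Import Order.TTheory GRing.Theory Num.Theory.
Local Open Scope ring_scope.

Notation CC := (Rdefinitions.R[i]).

Section Defs.
Variable A : algType CC.

Definition lin_functional (f : A -> CC) :=
  forall (c : CC) (x y : A), f (c *: x + y) = c * f x + f y.

Definition tracial (f : A -> CC) := forall x y : A, f (x * y) = f (y * x).

Definition transpose_map (t : A -> A) :=
  [/\ forall (c : CC) (x y : A), t (c *: x + y) = c *: t x + t y,
      forall x y : A, t (x * y) = t y * t x
    & forall x : A, t (t x) = x].

Definition tracial_real_inf_space (tau tau' : A -> CC) (t : A -> A) :=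
  [/\ transpose_map t,
      lin_functional tau /\ lin_functional tau',
      tau 1 = 1 /\ tau' 1 = 0,
      forall a, tau (t a) = tau a
    & tracial tau /\ tracial tau'].

Definition t_invariant_unital_subalg (t : A -> A) (S : A -> Prop) :=
  [/\ S 1,
      forall (c : CC) (x y : A), S x -> S y -> S (c *: x + y),
      forall x y : A, S x -> S y -> S (x * y)
    & forall x, S x -> S (t x)].

Definition real_inf_free (tau tau' : A -> CC) (t : A -> A) (s : nat)
    (Asub : 'I_s -> A -> Prop) :=
  forall (n : nat) (a : nat -> A) (j : nat -> 'I_s),
    (0 < n)%N ->
    (forall i, (0 < i <= n)%N -> Asub (j i) (a i)) ->
    (forall i, (0 < i <= n)%N -> tau (a i) = 0) ->
    (forall i, (0 < i < n)%N -> j i != j i.+1) ->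
    [/\ (* (1) *) tau (\prod_(1 <= i < n.+1) a i) = 0,
        (* (2) *) n = 2%N -> tau' (a 1%N * a 2%N) = 0,
        (* (3) *) forall k, (2 <= k)%N -> n = (2 * k - 1)%N ->
           tau' (\prod_(1 <= i < n.+1) a i) =
             tau (a 1%N * a n) * tau' (\prod_(2 <= i < n) a i)
             + tau (a 1%N * t (a k) * a n)
               * \prod_(2 <= i < k) tau (a i * t (a (i + k - 1)%N))
      & (* (4) *) forall k, (2 <= k)%N -> n = (2 * k)%N ->
           tau' (\prod_(1 <= i < n.+1) a i) =
             tau (a 1%N * a n) * tau' (\prod_(2 <= i < n) a i)
             + \prod_(1 <= i < k.+1) tau (a i * t (a (i + k)%N))].

Definition noncrossing (n : nat) (P : {set {set 'I_n}}) :=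
  [forall V in P, forall W in P, (V != W) ==>
     ~~ [exists a : 'I_n, exists b : 'I_n, exists c : 'I_n, exists d : 'I_n,
          [&& (a < b)%N, (b < c)%N, (c < d)%N,
              a \in V, c \in V, b \in W & d \in W]]].

Definition NC (n : nat) : {set {set {set 'I_n}}} :=
  [set P | partition P [set: 'I_n] && noncrossing P].

Definition restr (s : seq A) (V : {set 'I_(size s)}) : seq A :=
  [seq nth 0 s (nat_of_ord i) | i <- enum V].
Arguments restr : clear implicits.

(* ---------- free cumulants (moment-cumulant recursion) ----------
   kappa_fuel k s is computed with recursion depth k; the genuine cumulant
   is kappa s := kappa_fuel (size s) s (blocks of a non-trivial partition
   are strictly smaller). *)
Fixpoint kappa_fuel (tau : A -> CC) (k : nat) (s : seq A) : CC :=
  match k with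
  | 0%N => 0
  | k'.+1 =>
      tau (\prod_(x <- s) x)
      - \sum_(P in NC (size s) | P != [set [set: 'I_(size s)]])
          \prod_(V in P) kappa_fuel tau k' (restr s V)
  end.

Definition kappa (tau : A -> CC) (s : seq A) : CC := kappa_fuel tau (size s) s.

(* ---------- permutations of [±n] ----------
   [±n] is encoded as 'I_n * bool : (i, false) is the positive point i+1,
   (i, true) is the negative point -(i+1). *)
Definition pmT (n : nat) := ('I_n * bool)%type.

Definition delta_fun n (x : pmT n) : pmT n := (x.1, ~~ x.2).
Lemma delta_fun_inj n : injective (@delta_fun n).
Proof. by move=> [i b] [j c] [-> /negb_inj ->]. Qed.
Definition delta n : {perm pmT n} := perm (@delta_fun_inj n).

Definition gamma_fun n (x : pmT n) : pmT n :=
  if x.2 then x else (ordS x.1, false).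
Lemma gamma_fun_inj n : injective (@gamma_fun n).
Proof.
move=> [i b] [j c]; rewrite /gamma_fun /=.
case: b; case: c => // /(f_equal fst) /= /ordS_inj -> //.
Qed.
Definition gamma n : {perm pmT n} := perm (@gamma_fun_inj n).

(* gamma_n delta gamma_n^{-1} delta, composition read right to left;
   in MathComp (s * t)%g x = t (s x). *)
Definition annulus n : {perm pmT n} :=
  (delta n * (gamma n)^-1 * delta n * gamma n)%g.

Definition SNCd (n : nat) : {set {perm pmT n}} :=
  [set sigma : {perm pmT n} |
    [&& [transitive <<[set sigma; annulus n]>>, on [set: pmT n] | 'P],
        #|porbits sigma| + #|porbits (annulus n * sigma^-1)%g| == (2 * n)%N
      & [forall x, ((delta n * sigma)%g x != x)
                   && ((delta n * sigma)%g ((delta n * sigma)%g x) == x)]]].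

(* kappa_{sigma/2}: product over the pairs {c, delta c^{-1} delta} of cycles
   of sigma.  The representative c of a pair is the one containing the
   smallest positive point of c ∪ delta c^{-1} delta (note (j,false) lies in
   delta c^{-1} delta iff (j,true) lies in c).  c is written
   (i_1,...,i_k,-j_l,...,-j_1) starting from i_1, i.e. from the positive point
   whose sigma-predecessor is negative (or, for a cycle with only positive
   points, from its smallest point); the point i gives a_i and -j gives a_j^t. *)
Definition pair_rep n (C : {set pmT n}) :=
  [exists i : 'I_n, ((i, false) \in C) &&
     [forall j : 'I_n, ((j, true) \in C) ==> (i < j)%N]].

Definition cycle_start n (sigma : {perm pmT n}) (C : {set pmT n}) : option (pmT n) :=
  match [pick x in C | ~~ x.2 && ((sigma^-1)%g x).2] with
  | Some x => Some x
  | None => [pick x in C | ~~ x.2 &&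
               [forall y in C, ~~ y.2 ==> (nat_of_ord x.1 <= y.1)%N]]
  end.

Definition kappa_half (tau : A -> CC) (t : A -> A) (s : seq A)
    (sigma : {perm pmT (size s)}) : CC :=
  \prod_(C in porbits sigma | pair_rep C)
    oapp (fun x0 =>
           kappa tau [seq (if x.2 then t (nth 0 s (nat_of_ord x.1)) else nth 0 s (nat_of_ord x.1))
                     | x : pmT (size s) <- traject sigma x0 #|C|]) 0 (cycle_start sigma C).
Arguments kappa_half : clear implicits.

(* ---------- real infinitesimal cumulants ----------
   kappa'_1 = tau', and for n >= 2
   tau'(a_1...a_n) = sum_{pi in NC(n)} dkappa_pi + sum_{sigma in SNCd} kappa_{sigma/2},
   solved for the pi = 1_n term kappa'_n. *)
Fixpoint kappa'_fuel (tau tau' : A -> CC) (t : A -> A) (k : nat) (s : seq A) : CC :=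
  match k with
  | 0%N => 0
  | k'.+1 =>
      if size s == 1%N then tau' (\prod_(x <- s) x) else
      tau' (\prod_(x <- s) x)
      - \sum_(sigma in SNCd (size s)) kappa_half tau t s sigma
      - \sum_(P in NC (size s) | P != [set [set: 'I_(size s)]])
          \sum_(V in P) (kappa'_fuel tau tau' t k' (restr s V)
                         * \prod_(W in P | W != V) kappa tau (restr s W))
  end.

Definition kappa' (tau tau' : A -> CC) (t : A -> A) (s : seq A) : CC :=
  kappa'_fuel tau tau' t (size s) s.

End Defs.

(* Main.v *)
Require Import Defs.
From HB Require Import structures.
From mathcomp Require Import all_boot all_order all_algebra all_fingroup.
From mathcomp Require Import zify ring.
From mathcomp Require Import complex Rstruct.
Import GRing.Theory.
Local Open Scope ring_scope.

(* A permutation sigma of [±n] with sigma delta a fixed-point-free involution is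
   a pairing of the 2n points 1, -1, 2, -2, ..., n, -n of a circle. Gluing along
   its chords, with a twist when needed, gives a closed surface: the sphere for
   noncrossing partitions and, by the Euler characteristic condition, the
   projective plane for S_NC^delta(n,-n). Following the block of the first letter
   yields recursions on words for the moments tau and tau'; in the one for tau'
   the new term comes from the block going through the crosscap, after which the
   letters that it jumped over are reversed and transposed.
   By these recursions cumulants are multilinear, invariant under rotation, and
   zero when one of several entries is 1. Mixed cumulants vanish by induction on
   the length. Entries may be centred. If neighbours always have different
   colours, the recursion for tau' collapses to the formulas (2)-(4) that define
   real infinitesimal freeness. Otherwise rotate the word so that two neighbours
   of equal colour differ in colour from the first letter; by induction they do
   not enter its block, so that the recursion is the same as for the shorter word
   in which they are multiplied, and the cumulant is zero. *)

(** The recursions single out the first letter, so rotation invariance cannot be read off them,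
    while sums over NC(n) and S_NC^delta(n,-n) have no visible recursion. The bridge is a double
    count. A configuration consists of cycles of exactly one permutation sigma with sigma delta a
    fixed-point-free involution. Conversely, the planar (projective) configurations consisting of
    cycles of a given such sigma number 1 if the defect is 0 (is 1), and otherwise 0. The defect
    depends on numbers of cycles only, which ignore rotations and reflections of the circle. So one
    and the same sum has both the recursion and the symmetries. Noncrossing partitions are matched
    with planar configurations by a similar count. Permutations need distinct points: a word in A,
    whose entries may repeat, is treated as the image of the word of letters of [±n]. The sums of
    the terms dkappa_pi are planar sums over dual numbers, which is why the weights live in an
    arbitrary commutative ring. Invariance under transposition is at hand for kappa, but not for
    kappa', since tau' and t are not related; the symmetry arguments are arranged accordingly. *)

Set Implicit Arguments.
Unset Strict Implicit.
Unset Printing Implicit Defensive.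

(** * Noncrossing and projective configurations *)

Section Scan.
Variable X : Type.
Implicit Types (s g w : seq X) (L : seq (seq (seq X))).

Definition allcat L1 L2 := [seq p1 ++ p2 | p1 <- L1, p2 <- L2].

Lemma count_allcat q L1 L2 :
  count (all q) (allcat L1 L2) = (count (all q) L1 * count (all q) L2)%N.
Proof.
elim: L1 => //= p L1 IH; rewrite /allcat /= count_cat mulnDl -IH; congr addn.
elim: L2 {IH} => [|p' L2 IH] /=; first by rewrite muln0.
by rewrite mulnDr -IH all_cat mulnb.
Qed.

Lemma count_cons_map q s L :
  count (all q) [seq s :: p | p <- L] = (q s * count (all q) L)%N.
Proof. by elim: L => [|p L IH] /=; rewrite ?muln0 // IH mulnDr mulnb. Qed.

(* Configurations on the word [s ++ g ++ w] as lists of blocks: [s] is the part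
   already read of the block of the first letter, [g] are the letters skipped
   since the last letter of [s], and [w] remains to be read. When a letter joins
   [s], the gap [g] is closed and filled by [G]. *)
Fixpoint planar_scan (G : seq X -> seq (seq (seq X))) s g w :=
  if w is x :: w' then
    planar_scan G s (rcons g x) w'
    ++ allcat (G g) (planar_scan G (rcons s x) [::] w')
  else [seq s :: p | p <- G g].

Fixpoint planar_fuel k w : seq (seq (seq X)) :=
  if k is k'.+1 then
    if w is x :: w' then planar_scan (planar_fuel k') [:: x] [::] w' else [:: [::]]
  else [::].

Definition planar w := planar_fuel (size w).+1 w.

Lemma eq_planar_scan G G' s g w :
    (forall g', (size g' <= size g + size w)%N -> G g' = G' g') ->
  planar_scan G s g w = planar_scan G' s g w.
Proof.
elim: w s g => [|x w IH] s g eqG /=.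
  by rewrite eqG // leq_addr.
rewrite (eqG g) ?leq_addr // IH => [|g' le_g']; last first.
  by apply: eqG; rewrite (leq_trans le_g') // size_rcons addSnnS.
congr (_ ++ allcat _ _); apply: IH => g' le_g'; apply: eqG.
by rewrite (leq_trans le_g') //= add0n addnS leqW ?leq_addl.
Qed.

Lemma eq_planar_fuel k k' w : (size w < k)%N -> (size w < k')%N ->
  planar_fuel k w = planar_fuel k' w.
Proof.
elim: k k' w => // k IH [|k'] [|x w] //= lt_k lt_k'.
apply: eq_planar_scan => g' /=; rewrite add0n => le_g'.
by apply: IH; apply: leq_ltn_trans le_g' _.
Qed.

Lemma planar_cons x w : planar (x :: w) = planar_scan planar [:: x] [::] w.
Proof.
rewrite {1}/planar /=; apply: eq_planar_scan => g' /= le_g'.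
by apply: (@eq_planar_fuel (size w).+1 (size g').+1); rewrite ?ltnS.
Qed.

Variable dl : X -> X.

(* [dl x] is the letter [x] with the opposite orientation. Compared with
   [planar_scan], the crosscap lies either further on, or in the gap just closed,
   or the block reaches [x] through it: then [x] is reversed, and so is the gap,
   which becomes connected to the rest of the word. *)
Fixpoint projective_scan (H : seq X -> seq (seq (seq X))) s g w :=
  if w is x :: w' then
    projective_scan H s (rcons g x) w'
    ++ (allcat (planar g) (projective_scan H (rcons s x) [::] w')
    ++ (allcat (H g) (planar_scan planar (rcons s x) [::] w')
    ++ planar_scan planar (rcons s (dl x)) [::] (rev (map dl g) ++ w')))
  else [seq s :: p | p <- H g].

Fixpoint projective_fuel k w : seq (seq (seq X)) :=
  if k is k'.+1 then
    if w is x :: w' then projective_scan (projective_fuel k') [:: x] [::] w' else [::]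
  else [::].

Definition projective w := projective_fuel (size w).+1 w.

Lemma eq_projective_scan H H' s g w :
    (forall g', (size g' <= size g + size w)%N -> H g' = H' g') ->
  projective_scan H s g w = projective_scan H' s g w.
Proof.
elim: w s g => [|x w IH] s g eqH /=.
  by rewrite eqH // leq_addr.
rewrite (eqH g) ?leq_addr // IH => [|g' le_g']; last first.
  by apply: eqH; rewrite (leq_trans le_g') // size_rcons addSnnS.
congr (_ ++ (allcat _ _ ++ _)); apply: IH => g' le_g'; apply: eqH.
by rewrite (leq_trans le_g') //= add0n addnS leqW ?leq_addl.
Qed.

Lemma eq_projective_fuel k k' w : (size w < k)%N -> (size w < k')%N ->
  projective_fuel k w = projective_fuel k' w.
Proof.
elim: k k' w => // k IH [|k'] [|x w] //= lt_k lt_k'.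
apply: eq_projective_scan => g' /=; rewrite add0n => le_g'.
by apply: IH; apply: leq_ltn_trans le_g' _.
Qed.

Lemma projective_cons x w :
  projective (x :: w) = projective_scan projective [:: x] [::] w.
Proof.
rewrite {1}/projective /=; apply: eq_projective_scan => g' /= le_g'.
by apply: (@eq_projective_fuel (size w).+1 (size g').+1); rewrite ?ltnS.
Qed.

End Scan.

Section Weights.
Variables (R : comNzRingType) (X : Type) (dl : X -> X).
Implicit Types (f h : seq X -> R) (s g w : seq X).

Definition wsum f (L : seq (seq (seq X))) : R := \sum_(p <- L) \prod_(c <- p) f c.

Lemma wsum_cat f L1 L2 : wsum f (L1 ++ L2) = wsum f L1 + wsum f L2.
Proof. by rewrite /wsum big_cat. Qed.

Lemma wsum_cons_map f s L : wsum f [seq s :: p | p <- L] = f s * wsum f L.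
Proof.
rewrite /wsum big_map mulr_sumr; apply: eq_bigr => p _.
by rewrite big_cons.
Qed.

Lemma wsum_allcat f L1 L2 : wsum f (allcat L1 L2) = wsum f L1 * wsum f L2.
Proof.
rewrite /wsum /allcat big_allpairs_dep mulr_suml; apply: eq_bigr => p _.
rewrite mulr_sumr; apply: eq_bigr => p' _.
by rewrite big_cat.
Qed.

(** The weighted sum over [planar_scan] without a list of configurations: a gap enters only through
    its total weight [h g]. With moments as [h] this becomes the moment-cumulant recursion. *)
Fixpoint pscan f h s g w : R :=
  if w is x :: w' then
    pscan f h s (rcons g x) w' + h g * pscan f h (rcons s x) [::] w'
  else f s * h g.

Lemma wsum_planar_scan f G s g w :
  wsum f (planar_scan G s g w) = pscan f (fun g => wsum f (G g)) s g w.
Proof.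
elim: w s g => [|x w IH] s g /=; first exact: wsum_cons_map.
by rewrite wsum_cat wsum_allcat !IH.
Qed.

(** The counterpart for [projective_scan]; [h] and [h'] are the total planar and projective weights
    of a gap. *)
Fixpoint mscan f h h' s g w : R :=
  if w is x :: w' then
    mscan f h h' s (rcons g x) w'
    + (h g * mscan f h h' (rcons s x) [::] w'
    + (h' g * pscan f h (rcons s x) [::] w'
    + pscan f h (rcons s (dl x)) [::] (rev (map dl g) ++ w')))
  else f s * h' g.

Lemma wsum_projective_scan f H s g w :
  wsum f (projective_scan dl H s g w) =
  mscan f (fun g => wsum f (planar g)) (fun g => wsum f (H g)) s g w.
Proof.
elim: w s g => [|x w IH] s g /=; first exact: wsum_cons_map.
by rewrite !wsum_cat !wsum_allcat !wsum_planar_scan !IH.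
Qed.

Lemma eq_pscan f f' h h' s g w : f =1 f' -> h =1 h' ->
  pscan f h s g w = pscan f' h' s g w.
Proof.
by move=> ef eh; elim: w s g => [|x w IH] s g /=; rewrite ?ef ?eh // !IH.
Qed.

End Weights.

Local Close Scope ring_scope.

(** * Pairings of points on circles *)

Section Defect.
Variables (X : eqType) (pi : X -> X).
Hypothesis piK : involutive pi.

Definition stable (l : seq X) := forall x, x \in l -> pi x \in l.

(* Removing the chord of [x] and [pi x] from a family of circles splits a circle,
   or reverses an arc if the chord is twisted (its ends have equal parity), or
   merges two circles. The defect is 2 minus the Euler characteristic of the glued
   surface: 0 for the sphere and 1 for the projective plane. *)
Inductive defect : seq (seq X) -> nat -> Prop :=
| defect_nil : defect [::] 0
| defect_empty zs d : defect zs d -> defect ([::] :: zs) d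
| defect_split x z1 z2 zs d : ~~ odd (size z1) ->
    defect (rot 1 z1 :: z2 :: zs) d -> defect ((x :: z1 ++ pi x :: z2) :: zs) d
| defect_flip x z1 z2 zs d : odd (size z1) ->
    defect ((rev z1 ++ z2) :: zs) d -> defect ((x :: z1 ++ pi x :: z2) :: zs) d.+1
| defect_merge x z u v zs1 zs2 d :
    defect ((rev z ++ (if odd (size u) then rev (v ++ u) else v ++ u)) :: zs1 ++ zs2) d ->
    defect ((x :: z) :: zs1 ++ (u ++ pi x :: v) :: zs2) d.+2.

Lemma stable_perm l l' : perm_eq l l' -> stable l -> stable l'.
Proof.
by move=> /perm_mem eql stl x; rewrite -!eql => /stl.
Qed.

Lemma stable_add x l l' : perm_eq l (x :: pi x :: l') -> stable l' -> stable l.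
Proof.
move=> /perm_mem eql stl y; rewrite !eql !inE.
case/or3P=> [/eqP->|/eqP->|/stl->]; rewrite ?piK ?eqxx ?orbT //.
Qed.

Lemma stable_rem x l l' : perm_eq l (x :: pi x :: l') -> uniq l -> stable l -> stable l'.
Proof.
move=> eql; rewrite (perm_uniq eql) => /= /and3P[].
rewrite inE negb_or => /andP[_ xl'] pxl' _ stl y yl'.
have: pi y \in l by apply: stl; rewrite (perm_mem eql) !inE yl' !orbT.
rewrite (perm_mem eql) !inE => /or3P[/eqP e|/eqP e|//].
- by rewrite -e piK yl' in pxl'.
- by rewrite -[x]piK -e piK yl' in xl'.
Qed.

Lemma perm_split (x y : X) z1 z2 r :
  perm_eq ((x :: z1 ++ y :: z2) ++ r) (x :: y :: rot 1 z1 ++ z2 ++ r).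
Proof.
have P : perm_eq (rot 1 z1) z1 by rewrite perm_rot.
move: (rot 1 z1) P => t /seq.permP P; apply/seq.permP => a.
by rewrite /= !(count_cat, P) /= ?(count_cat, P) /=; lia.
Qed.

Lemma perm_flip (x y : X) z1 z2 r :
  perm_eq ((x :: z1 ++ y :: z2) ++ r) (x :: y :: (rev z1 ++ z2) ++ r).
Proof. by apply/seq.permP => a; rewrite /= !count_cat /= ?count_cat count_rev; lia. Qed.

Lemma perm_merge (x y : X) z u v b r1 r2 :
  perm_eq ((x :: z) ++ r1 ++ (u ++ y :: v) ++ r2)
    (x :: y :: (rev z ++ (if b then rev (v ++ u) else v ++ u)) ++ r1 ++ r2).
Proof.
by apply/seq.permP => a; case: b; rewrite /= !count_cat /= ?count_rev ?count_cat ?count_rev;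
  lia.
Qed.

Lemma defect_stable zs d : defect zs d -> stable (flatten zs).
Proof.
elim=> {zs d} // [x z1 z2 zs d _ _|x z1 z2 zs d _ _|x z u v zs1 zs2 d _] IH.
- exact: (stable_add (perm_split _ _ _ _ _) IH).
- exact: (stable_add (perm_flip _ _ _ _ _) IH).
- apply: (stable_add _ IH); rewrite /= !flatten_cat /=.
  exact: perm_merge.
Qed.

Lemma cat_uniq_split (T : eqType) (x : T) (a b c e : seq T) :
  uniq (a ++ x :: b) -> a ++ x :: b = c ++ x :: e -> a = c /\ b = e.
Proof.
move=> un E; have idx (l r : seq T) : uniq (l ++ x :: r) -> index x (l ++ x :: r) = size l.
  rewrite cat_uniq /= negb_or -!andbA => /and3P[_ xl _].
  by rewrite index_cat (negPf xl) /= eqxx addn0.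
have sz : size a = size c by rewrite -(idx _ _ un) E idx // -E.
by move/eqP: E; rewrite eqseq_cat // => /andP[/eqP-> /eqP[->]].
Qed.

(** As the points are distinct, the partner of the leading point occurs in one place only. Hence the
    last rule applied and the two arcs are forced, and a merge is impossible because the partner is
    on the same circle. *)
Lemma defect_inv x z1 z2 zs d :
    uniq (flatten ((x :: z1 ++ pi x :: z2) :: zs)) ->
    defect ((x :: z1 ++ pi x :: z2) :: zs) d ->
  if odd (size z1) then exists2 d', d = d'.+1 & defect ((rev z1 ++ z2) :: zs) d'
  else defect (rot 1 z1 :: z2 :: zs) d.
Proof.
move E: ((x :: z1 ++ pi x :: z2) :: zs) => zs0 un D.
case: D E un => // {zs0 d}.
- move=> x' z1' z2' zs' d' ev D [ex E ezs]; subst x' zs' => /=.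
  rewrite cat_uniq => /andP[_ /andP[un _]]; rewrite -E in un.
  by have [-> ->] := cat_uniq_split un E; rewrite (negPf ev).
- move=> x' z1' z2' zs' d' od D [ex E ezs]; subst x' zs' => /=.
  rewrite cat_uniq => /andP[_ /andP[un _]]; rewrite -E in un.
  by have [-> ->] := cat_uniq_split un E; rewrite od; exists d'.
- move=> x' z u v zs1 zs2 d' D [<- <- _] /= /andP[_].
  rewrite cat_uniq => /and3P[_ /hasPn/(_ (pi x))].
  by rewrite flatten_cat /= !mem_cat !inE eqxx !orbT => /(_ isT).
Qed.

Lemma perm_uniq2 (T : eqType) (x y : T) l l' :
  perm_eq l (x :: y :: l') -> uniq l -> uniq l'.
Proof. by move=> /perm_uniq-> /= /and3P[]. Qed.

Lemma uniq_flattenl (T : eqType) (A B : seq (seq T)) :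
  uniq (flatten (A ++ B)) -> uniq (flatten A).
Proof. by rewrite flatten_cat cat_uniq => /andP[]. Qed.

Lemma flatten_mid (T : Type) (a c : seq T) zs1 zs2 :
  flatten (a :: zs1 ++ c :: zs2) = a ++ flatten zs1 ++ c ++ flatten zs2.
Proof. by rewrite /= flatten_cat. Qed.

Lemma flatten_mid2 (T : Type) (a : seq T) zs1 zs2 :
  flatten (a :: zs1 ++ zs2) = a ++ flatten zs1 ++ flatten zs2.
Proof. by rewrite /= flatten_cat. Qed.

(** If no chord joins [A] to [B], the rules act on the two families separately and defects add up.
    Otherwise the first such chord to be removed is a merge, which costs 2. *)
Lemma defect_cat A B d : uniq (flatten (A ++ B)) -> defect (A ++ B) d ->
  (exists dA dB, [/\ defect A dA, defect B dB & d = dA + dB]) \/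
  (1 < d /\ ~ stable (flatten A)).
Proof.
move E: (A ++ B) => zs un D; elim: D A E un => {zs d}.
- by case=> //= -> _; left; exists 0, 0; split=> //; exact: defect_nil.
- move=> zs d D IH [|a A] /= E un.
    by left; exists 0, d; rewrite E; split=> //; [exact: defect_nil|exact: defect_empty].
  case: E => -> /IH[//|[dA [dB [DA DB ->]]]|]; last by right.
  by left; exists dA, dB; split=> //; exact: defect_empty.
- move=> x z1 z2 zs d ev D IH [|a A] /= E un.
    by left; exists 0, d; rewrite E; split=> //; [exact: defect_nil|exact: defect_split].
  have un' := perm_uniq2 (perm_split x (pi x) z1 z2 (flatten zs)) un.
  case: E => Ea EA; have := IH (rot 1 z1 :: z2 :: A).
  rewrite 2!cat_cons EA => /(_ erefl un'); case=> [[dA [dB [DA DB ->]]]|[d1 nst]].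
    by left; exists dA, dB; split=> //; rewrite Ea; exact: defect_split.
  right; split=> // stA; apply: nst; rewrite Ea in stA.
  apply: (stable_rem (perm_split x (pi x) z1 z2 (flatten A))) stA.
  by have := @uniq_flattenl _ ((x :: z1 ++ pi x :: z2) :: A) B; rewrite cat_cons EA; apply.
- move=> x z1 z2 zs d od D IH [|a A] /= E un.
    by left; exists 0, d.+1; rewrite E; split=> //; [exact: defect_nil|exact: defect_flip].
  have un' := perm_uniq2 (perm_flip x (pi x) z1 z2 (flatten zs)) un.
  case: E => Ea EA; have := IH ((rev z1 ++ z2) :: A).
  rewrite cat_cons EA => /(_ erefl un'); case=> [[dA [dB [DA DB ->]]]|[d1 nst]].
    by left; exists dA.+1, dB; split=> //; rewrite Ea; exact: defect_flip.
  right; split=> [|stA]; first by rewrite ltnW.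
  apply: nst; rewrite Ea in stA.
  apply: (stable_rem (perm_flip x (pi x) z1 z2 (flatten A))) stA.
  by have := @uniq_flattenl _ ((x :: z1 ++ pi x :: z2) :: A) B; rewrite cat_cons EA; apply.
- move=> x z u v zs1 zs2 d D IH [|a A] /= E un.
    by left; exists 0, d.+2; rewrite E; split=> //; [exact: defect_nil|exact: defect_merge].
  case: E => Ea EA.
  (* A merge already makes the defect at least 2, so only a closed [A] is left; then the second
     circle of the merge lies in [A] too. *)
  have [stA|] := boolP (all (fun y => pi y \in flatten (a :: A)) (flatten (a :: A))); last first.
    by move=> /allPn[y yA nst]; right; split=> // stA; rewrite stA in nst.
  have [sz|sz] := ltnP (size zs1) (size A); last first.
    have: pi x \in flatten (a :: A) by apply: (allP stA); rewrite Ea /= inE eqxx.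
    have un1 : uniq (flatten (a :: A) ++ flatten B).
      by rewrite -flatten_cat cat_cons EA Ea.
    move: un1; rewrite cat_uniq => /and3P[_ /hasPn/(_ (pi x)) nA _] /(contraL nA).
    suff -> : pi x \in flatten B by [].
    have -> : B = drop (size A) zs1 ++ (u ++ pi x :: v) :: zs2.
      have := congr1 (drop (size A)) EA; rewrite drop_size_cat // => ->.
      by rewrite drop_cat; case: ltngtP sz => // e _; rewrite e subnn drop0 drop_size.
    by rewrite flatten_cat /= !mem_cat !inE eqxx !orbT.
  have [A2 EA2 E2] : exists2 A2, A = zs1 ++ (u ++ pi x :: v) :: A2 & zs2 = A2 ++ B.
    have E1 := congr1 (take (size zs1)) EA; rewrite take_cat sz take_size_cat // in E1.
    have := EA; rewrite -{1}(cat_take_drop (size zs1) A) E1 -catA => /eqP.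
    rewrite eqseq_cat // eqxx /=.
    case Ed: (drop (size zs1) A) => [|b A2] /=; last first.
      move=> /eqP[Eb E2]; exists A2 => //.
      by rewrite -{1}(cat_take_drop (size zs1) A) E1 Ed Eb.
    by have := congr1 size Ed; rewrite size_drop /=; lia.
  have P := perm_merge x (pi x) z u v (odd (size u)) (flatten zs1).
  have un1 : uniq (flatten ((x :: z) :: zs1 ++ (u ++ pi x :: v) :: zs2)) := un.
  have := un1; rewrite flatten_mid => /(perm_uniq2 (P _)) un'.
  have := IH ((rev z ++ (if odd (size u) then rev (v ++ u) else v ++ u)) :: zs1 ++ A2).
  rewrite cat_cons -catA -E2 => /(_ erefl); rewrite flatten_mid2.
  move=> /(_ un'); case=> [[dA [dB [DA DB ->]]]|[d1 nst]].
    by left; exists dA.+2, dB; split=> //; rewrite Ea EA2; exact: defect_merge.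
  right; split=> // sA; apply: nst; rewrite Ea EA2 flatten_cat in sA.
  rewrite flatten_mid2; apply: (stable_rem (P _)) sA; rewrite -flatten_mid.
  have := @uniq_flattenl _ ((x :: z) :: zs1 ++ (u ++ pi x :: v) :: A2) B.
  by rewrite cat_cons -catA cat_cons -E2; apply.
Qed.

End Defect.

Lemma eq_defect (X : eqType) (pi pi' : X -> X) zs d :
  pi =1 pi' -> defect pi zs d -> defect pi' zs d.
Proof.
move=> e; elim=> {zs d} [||x z1 z2 zs d ev _ D|x z1 z2 zs d od _ D|x z u v zs1 zs2 d _ D].
- exact: defect_nil.
- by move=> zs d _; exact: defect_empty.
- by rewrite e; exact: defect_split.
- by rewrite e; exact: defect_flip.
- by rewrite e; exact: defect_merge.
Qed.

(** * Configurations made of cycles of a given permutation *)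

Section Counting.
Variables (X : eqType) (dl : X -> X).
Hypothesis dlK : involutive dl.
Implicit Types (s g w : seq X) (p : seq (seq X)).

(** The circle of a word. A letter [x] gives two neighbouring points: its block enters at [x] and
    leaves at [dl x], from where a chord leads to the next letter of the block. *)
Fixpoint pts w := if w is x :: w' then x :: dl x :: pts w' else [::].

Lemma pts_cat w1 w2 : pts (w1 ++ w2) = pts w1 ++ pts w2.
Proof. by elim: w1 => //= x w1 ->. Qed.

Lemma pts_rcons w x : pts (rcons w x) = pts w ++ [:: x; dl x].
Proof. by rewrite -cats1 pts_cat. Qed.

Lemma pts_mirror w : pts (rev (map dl w)) = rev (pts w).
Proof. by elim: w => //= x w IH; rewrite !rev_cons pts_rcons IH dlK -!cats1 -catA. Qed.

Lemma size_pts w : size (pts w) = (size w).*2.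
Proof. by elim: w => //= x w ->. Qed.

Lemma mem_pts w x : (x \in pts w) = (x \in w) || (dl x \in w).
Proof.
elim: w => //= y w IH; rewrite !inE IH (can2_eq dlK dlK).
by rewrite -!orbA; do !bool_congr; rewrite orbCA.
Qed.

Lemma perm_pts w w' : perm_eq w w' -> perm_eq (pts w) (pts w').
Proof.
have E a v : count a (pts v) = count a v + count (a \o dl) v.
  by elim: v => //= x v ->; lia.
by move=> /seq.permP P; apply/seq.permP => a; rewrite !E !P.
Qed.

Lemma perm_pts_twist u w1 y w2 :
  perm_eq (pts (u ++ w1 ++ dl y :: w2)) (pts (rcons u y ++ rev (map dl w1) ++ w2)).
Proof.
rewrite !pts_cat pts_rcons pts_mirror /= dlK; move: (pts u) (pts w1) (pts w2) => a b c.
by apply/seq.permP => q; rewrite !(count_cat, count_rev) /=; lia.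
Qed.

Lemma planar_scan_perm (G : seq X -> _) s g w p :
    (forall g' p', p' \in G g' -> perm_eq (flatten p') g') ->
  p \in planar_scan G s g w -> perm_eq (flatten p) (s ++ g ++ w).
Proof.
move=> PG; elim: w s g p => [|x w IH] s g p /=.
  by move=> /mapP[p' /PG P ->] /=; rewrite cats0 perm_cat2l.
rewrite mem_cat => /orP[/IH P|/allpairsP[[p1 p2] /= [/PG P1 /IH P2 ->]]].
  by rewrite (permPl P) cat_rcons.
rewrite flatten_cat (permPl (perm_cat P1 P2)) cat_rcons /=.
by apply/seq.permP => a; rewrite !count_cat /= ?count_cat /=; lia.
Qed.

Lemma planar_perm w p : p \in planar w -> perm_eq (flatten p) w.
Proof.
rewrite /planar; move: (size w).+1 => k; elim: k w p => // k IH [|x w] p /=.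
  by rewrite inE => /eqP->.
by move=> /(planar_scan_perm IH).
Qed.

Lemma projective_scan_perm (H : seq X -> _) s g w p :
    (forall g' p', p' \in H g' -> perm_eq (pts (flatten p')) (pts g')) ->
  p \in projective_scan dl H s g w ->
  perm_eq (pts (flatten p)) (pts (s ++ g ++ w)).
Proof.
move=> PH; elim: w s g p => [|x w IH] s g p /=.
  by move=> /mapP[p' /PH P ->] /=; rewrite cats0 !pts_cat perm_cat2l.
have mid s1 s2 : perm_eq s1 (pts g ++ pts (s ++ x :: w)) -> s2 = s1 ->
    perm_eq s2 (pts (s ++ g ++ x :: w)).
  move=> P ->; rewrite (permPl P); rewrite !pts_cat.
  by rewrite perm_catCA.
rewrite !mem_cat => /or4P[/IH P|||].
- by rewrite (permPl P) cat_rcons.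
- move=> /allpairsP[[p1 p2] /= [/planar_perm/perm_pts P1 /IH P2 ->]].
  rewrite flatten_cat pts_cat; apply: mid (perm_cat P1 _) (erefl _).
  by rewrite (permPl P2) cat_rcons.
- move=> /allpairsP[[p1 p2] /= [/PH P1 P2 ->]].
  rewrite flatten_cat pts_cat; apply: mid (perm_cat P1 _) (erefl _).
  apply: perm_pts; have := planar_scan_perm planar_perm P2.
  by rewrite cat_rcons.
- move=> /(planar_scan_perm planar_perm)/perm_pts P; rewrite (permPl P).
  rewrite cat_rcons /= !(pts_cat, pts_mirror) /= dlK pts_cat pts_mirror.
  by apply/seq.permP => a; rewrite !(count_cat, count_rev) /= !(count_cat, count_rev); lia.
Qed.

Lemma projective_perm w p :
  p \in projective dl w -> perm_eq (pts (flatten p)) (pts w).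
Proof.
rewrite /projective; move: (size w).+1 => k; elim: k w p => // k IH [|x w] p //=.
by move=> /(projective_scan_perm IH).
Qed.

Lemma planar_scan_prefix G s g w p :
  p \in planar_scan G s g w -> has (prefix s) p.
Proof.
elim: w s g p => [|x w IH] s g p /=.
  by move=> /mapP[p' _ ->] /=; rewrite prefix_refl.
rewrite mem_cat => /orP[/IH //|/allpairsP[[p1 p2] /= [_ /IH P ->]]].
rewrite has_cat; apply/orP; right; case/hasP: P => c cp P; apply/hasP; exists c => //.
by apply: prefix_trans P; exact: prefix_rcons.
Qed.

Lemma projective_scan_prefix H s g w p :
  p \in projective_scan dl H s g w -> has (prefix s) p.
Proof.
elim: w s g p => [|x w IH] s g p /=.
  by move=> /mapP[p' _ ->] /=; rewrite prefix_refl.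
have sub y l : has (prefix (rcons s y)) l -> has (prefix s) l.
  by apply: sub_has => c; apply: prefix_trans; exact: prefix_rcons.
rewrite !mem_cat => /or4P[/IH //|||].
- by move=> /allpairsP[[p1 p2] /= [_ /IH/sub P ->]]; rewrite has_cat P orbT.
- move=> /allpairsP[[p1 p2] /= [_ /planar_scan_prefix/sub P ->]].
  by rewrite has_cat P orbT.
- by move=> /planar_scan_prefix/sub.
Qed.

Variable sg : X -> X.
Let pi x := sg (dl x).
Hypothesis piK : involutive pi.

Let cnt := count (all (fcycle sg)).
Let cT w := cnt (planar w).
Let cM w := cnt (projective dl w).
Let cTs s g w := cnt (planar_scan (@planar X) s g w).
Let cMs s g w := cnt (projective_scan dl (projective dl) s g w).

Lemma fcycle_prefix h s x c :
  prefix (rcons (h :: s) x) c -> fcycle sg c -> x = sg (last h s).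
Proof.
move=> /prefixP[c' ->]; rewrite cat_rcons /= rcons_cat /= cat_path /=.
by move=> /and3P[_ /eqP].
Qed.

(** In a cycle of [sg] the successor of [last h s] is its image, so a partial block continued in any
    other way is never completed to a cycle. *)
Lemma count_prefix0 h s x L :
    x != sg (last h s) ->
    (forall p, p \in L -> has (prefix (rcons (h :: s) x)) p) ->
  cnt L = 0.
Proof.
move=> nx pre; apply/eqP; rewrite /cnt -leqn0 leqNgt -has_count; apply/hasPn => p.
move=> /pre/hasP[c cp P]; apply/negP => /allP/(_ c cp)/(fcycle_prefix P) e.
by rewrite e eqxx in nx.
Qed.

Lemma cTs0 h s x w : x != sg (last h s) -> cTs (rcons (h :: s) x) [::] w = 0.
Proof. by move=> nx; apply: (count_prefix0 nx) => p; exact: planar_scan_prefix. Qed.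

Lemma cMs0 h s x w : x != sg (last h s) -> cMs (rcons (h :: s) x) [::] w = 0.
Proof. by move=> nx; apply: (count_prefix0 nx) => p; exact: projective_scan_prefix. Qed.

(** Here and in the next lemmas the scan collapses: the only letter that can continue the block is
    [sg (last h s)], and all other choices count zero. *)
Lemma cTs_none h s g w : sg (last h s) \notin w ->
  cTs (h :: s) g w = (fcycle sg (h :: s) * cT (g ++ w))%N.
Proof.
elim: w g => [|x w IH] g; first by rewrite cats0 /cTs /= /cnt count_cons_map.
rewrite inE negb_or => /andP[nx nw]; rewrite -cat_rcons -IH // /cTs /=.
rewrite /cnt count_cat count_allcat -/cnt -[cnt (planar_scan _ (_ :: rcons _ _) _ _)]/(cTs (rcons (h :: s) x) [::] w).
by rewrite cTs0 1?eq_sym // muln0 addn0.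
Qed.

Lemma cTs_join h s g w1 w2 : let y := sg (last h s) in
    y \notin w1 -> y \notin w2 ->
  cTs (h :: s) g (w1 ++ y :: w2) =
    (fcycle sg (h :: s) * cT (g ++ w1 ++ y :: w2) +
     cT (g ++ w1) * cTs (rcons (h :: s) y) [::] w2)%N.
Proof.
move=> y; elim: w1 g => [|x w1 IH] g.
  move=> _ yw2; rewrite /cTs /= /cnt count_cat count_allcat -/cnt.
  rewrite -[cnt (planar_scan _ (h :: s) _ _)]/(cTs (h :: s) (rcons g y) w2).
  by rewrite cTs_none // cat_rcons cats0.
rewrite inE negb_or => /andP[nx nw] yw2; have := IH (rcons g x) nw yw2.
rewrite !cat_rcons => <-; rewrite /cTs /=.
rewrite /cnt count_cat count_allcat -/cnt -[cnt (planar_scan _ (_ :: rcons s x) _ _)]/(cTs (rcons (h :: s) x) [::] _).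
by rewrite cTs0 1?eq_sym // muln0 addn0.
Qed.

Lemma cMsE h s g x w : cMs (h :: s) g (x :: w) =
  (cMs (h :: s) (rcons g x) w + (cT g * cMs (rcons (h :: s) x) [::] w +
   (cM g * cTs (rcons (h :: s) x) [::] w +
    cTs (rcons (h :: s) (dl x)) [::] (rev (map dl g) ++ w))))%N.
Proof. by rewrite /cMs /= /cnt !count_cat !count_allcat. Qed.

Lemma cMs_none h s g w : let y := sg (last h s) in
    y \notin w -> dl y \notin w ->
  cMs (h :: s) g w = (fcycle sg (h :: s) * cM (g ++ w))%N.
Proof.
move=> y; elim: w g => [|x w IH] g; first by rewrite cats0 /cMs /= /cnt count_cons_map.
rewrite !inE !negb_or => /andP[nx nw] /andP[ndx ndw].
rewrite -cat_rcons -IH // cMsE cTs0 1?eq_sym // cMs0 1?eq_sym // cTs0 ?muln0 ?addn0 //.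
by rewrite (can2_eq dlK dlK) eq_sym.
Qed.

Lemma cMs_join h s g w1 w2 : let y := sg (last h s) in
    y \notin w1 -> dl y \notin w1 -> y \notin w2 -> dl y \notin w2 -> y != dl y ->
  cMs (h :: s) g (w1 ++ y :: w2) =
    (fcycle sg (h :: s) * cM (g ++ w1 ++ y :: w2) +
     (cT (g ++ w1) * cMs (rcons (h :: s) y) [::] w2 +
      cM (g ++ w1) * cTs (rcons (h :: s) y) [::] w2))%N.
Proof.
move=> y; elim: w1 g => [|x w1 IH] g.
  move=> _ _ yw2 dyw2 ydy; rewrite cMsE cMs_none // cat_rcons cats0.
  by rewrite (cTs0 (x := dl y)) ?addn0 // eq_sym.
rewrite !inE !negb_or => /andP[nx nw] /andP[ndx ndw] yw2 dyw2 ydy.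
have := IH (rcons g x) nw ndw yw2 dyw2 ydy; rewrite !cat_rcons => <-.
rewrite cat_cons cMsE cTs0 1?eq_sym // cMs0 1?eq_sym // cTs0 ?muln0 ?addn0 //.
by rewrite (can2_eq dlK dlK) eq_sym.
Qed.

(** The successor of the last letter occurs with the opposite orientation, so the block has to reach
    it through the crosscap; the gap then returns reversed and the rest is planar. *)
Lemma cMs_twist h s g w1 w2 : let y := sg (last h s) in
    y \notin w1 -> dl y \notin w1 -> y \notin w2 -> dl y \notin w2 -> y != dl y ->
  cMs (h :: s) g (w1 ++ dl y :: w2) =
    (fcycle sg (h :: s) * cM (g ++ w1 ++ dl y :: w2) +
     cTs (rcons (h :: s) y) [::] (rev (map dl (g ++ w1)) ++ w2))%N.
Proof.
move=> y; elim: w1 g => [|x w1 IH] g.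
  move=> _ _ yw2 dyw2 ydy; rewrite cMsE cMs_none // cat_rcons cats0.
  rewrite (cTs0 (x := dl y)) 1?eq_sym // (cMs0 (x := dl y)) 1?eq_sym //.
  by rewrite dlK !muln0 !add0n.
rewrite !inE !negb_or => /andP[nx nw] /andP[ndx ndw] yw2 dyw2 ydy.
have := IH (rcons g x) nw ndw yw2 dyw2 ydy; rewrite !cat_rcons => <-.
rewrite cat_cons cMsE cTs0 1?eq_sym // cMs0 1?eq_sym // cTs0 ?muln0 ?addn0 //.
by rewrite (can2_eq dlK dlK) eq_sym.
Qed.

(** A block that is a cycle of [sg] contains with each letter its successor and its predecessor, so
    no chord leaves the points of the configuration. It follows that a gap left by some chord
    carries no configuration. *)
Lemma fcycle_stable w p :
    perm_eq (pts (flatten p)) (pts w) -> all (fcycle sg) p -> stable pi (pts w).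
Proof.
move=> P cp; apply: (stable_perm P) => x; rewrite !mem_pts.
have nxt y : y \in flatten p -> sg y \in flatten p.
  move=> /flattenP[c cp' yc]; apply/flattenP; exists c => //.
  by rewrite (eqP (next_cycle (allP cp _ cp') yc)) mem_next.
have prv y : y \in flatten p -> exists2 z, z \in flatten p & sg z = y.
  move=> /flattenP[c cp' yc]; exists (prev c y).
    by apply/flattenP; exists c => //; rewrite mem_prev.
  by apply/eqP; exact: (prev_cycle (allP cp _ cp') yc).
case/orP => [/prv[y yp yx]|/nxt]; last by move=> ->.
apply/orP; right; rewrite (_ : dl (pi x) = y) //.
by rewrite -yx -{1}[y]dlK -/(pi (dl y)) piK dlK.
Qed.

Lemma cT_unstable w : ~ stable pi (pts w) -> cT w = 0.
Proof.
move=> nst; apply/eqP; rewrite /cT /cnt -leqn0 leqNgt -has_count; apply/hasPn => p.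
move=> /planar_perm/perm_pts P; apply/negP => cp; apply: nst.
exact: fcycle_stable P cp.
Qed.

Lemma cM_unstable w : ~ stable pi (pts w) -> cM w = 0.
Proof.
move=> nst; apply/eqP; rewrite /cM /cnt -leqn0 leqNgt -has_count; apply/hasPn => p.
move=> /projective_perm P; apply/negP => cp; apply: nst.
exact: fcycle_stable P cp.
Qed.

(** What remains of the circle after the chords inside the partial block [h :: s] are removed: the
    open end of its last letter, the unread letters, and the open beginning [h]. *)
Definition circle h s w := dl (last h s) :: pts w ++ [:: h].

Lemma circle1 x w : circle x [::] w = rot 1 (pts (x :: w)).
Proof. by rewrite /= rot1_cons -cats1. Qed.

Lemma uniq_circle h s w : uniq (pts (h :: s ++ w)) -> uniq (circle h s w).
Proof.
case: (lastP s) => [|s' l].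
  by rewrite circle1 rot_uniq.
rewrite /circle last_rcons.
have -> : dl l :: pts w ++ [:: h] = rot 1 (h :: dl l :: pts w).
  by rewrite rot1_cons -cats1.
rewrite rot_uniq.
apply: subseq_uniq; rewrite cat_rcons.
apply: (@cat_subseq _ [:: h] _ [:: h] (dl h :: pts (s' ++ l :: w))) => //.
apply: subseq_trans (subseq_cons _ _); rewrite pts_cat.
by apply: subseq_trans (suffix_subseq _ _); exact: (subseq_cons (dl l :: pts w) l).
Qed.

Hypothesis piN : forall x, pi x != x.

Lemma defect_nil0 d : defect pi [:: [::]] d -> d = 0.
Proof.
move E: [:: [::]] => zs D; case: D E => //.
  move=> zs' d' D [ezs]; subst zs'; move E: [::] D => zs' D.
  by case: D E.
Qed.

Lemma uniq_pts_mid w1 y w2 : uniq (pts (w1 ++ y :: w2)) ->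
  [/\ y \notin w1, dl y \notin w1, y \notin w2, dl y \notin w2 & y != dl y].
Proof.
rewrite pts_cat /= cat_uniq /= inE !mem_pts => /and5P[_ /norP[/norP[-> ->] _]].
by move=> /norP[-> /norP[-> ->]].
Qed.

Lemma defect_inv1 x y z1 z2 c d : pi x = y -> c = x :: z1 ++ y :: z2 -> uniq c ->
    defect pi [:: c] d ->
  if odd (size z1) then exists2 d', d = d'.+1 & defect pi [:: rev z1 ++ z2] d'
  else defect pi [:: rot 1 z1; z2] d.
Proof. by move=> <- -> un; apply: defect_inv; rewrite /= cats0. Qed.

Lemma count_circle h s w d :
    path (frel sg) h s -> uniq (pts (h :: s ++ w)) -> defect pi [:: circle h s w] d ->
  cTs (h :: s) [::] w = (d == 0) /\ cMs (h :: s) [::] w = (d == 1).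
Proof.
have [m le_m] := ubnP (size w); elim: m => // m IH in h s w d le_m *.
move=> hs un D; have unc := uniq_circle un.
have IH0 w' d' : size w' <= size w -> uniq (pts w') -> defect pi [:: rot 1 (pts w')] d' ->
    cT w' = (d' == 0) /\ cM w' = (d' == 1).
  case: w' => [|x w'] le_w' unw' D'; first by rewrite (defect_nil0 D').
  rewrite /cT /cM planar_cons projective_cons; apply: IH => //.
    by apply: leq_trans le_w' _; rewrite -ltnS.
set y := sg (last h s).
have piy : pi (dl (last h s)) = y by rewrite /pi dlK.
have fc : fcycle sg (h :: s) = (y == h) by rewrite /= rcons_path hs.
have yC : y \in circle h s w.
  rewrite -piy; have := defect_stable piK D; rewrite /= cats0; apply.
  by rewrite inE eqxx.
have unw : uniq (pts w).
  by move: unc; rewrite /circle /= cat_uniq => /and3P[].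
have hw : h \notin pts w.
  by move: unc; rewrite /circle /= cat_uniq /= orbF => /and4P[].
have := yC; rewrite inE => /orP[/eqP yl|].
  by have := piN (dl (last h s)); rewrite piy yl eqxx.
rewrite mem_cat inE => /orP[|/eqP yh]; last first.
  have /andP[ynw dynw] : (y \notin w) && (dl y \notin w) by rewrite yh -negb_or -mem_pts.
  rewrite cTs_none // (cMs_none _ ynw dynw) fc yh eqxx !mul1n; apply: IH0 => //.
  have := defect_inv1 (z1 := pts w) (z2 := [::]) piy _ unc D.
  rewrite size_pts odd_double yh => /(_ erefl) {}D.
  have [|[d1 [d2 [D1 /defect_nil0-> ->]]]|[_ []]] := @defect_cat _ pi piK [:: _] [:: [::]] d _ D.
  - by rewrite /= !cats0 rot_uniq.
  - by rewrite addn0.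
  - by have := defect_stable piK D.
rewrite mem_pts => /orP[] yw.
- move: unw D IH0 unc le_m hw un; case/splitPr: yw => w1 w2 unw D IH0 unc le_m hw un.
  have [y1 dy1 y2 dy2 ydy] := uniq_pts_mid unw.
  have yh : (y == h) = false.
    by apply: contraNF hw => /eqP <-; rewrite mem_pts mem_cat inE eqxx orbT.
  rewrite (cTs_join _ y1 y2) (cMs_join _ y1 dy1 y2 dy2 ydy) fc yh !mul0n !add0n.
  have un2 : uniq (pts (h :: rcons s y ++ w2)).
    move: un; rewrite cat_rcons -!cat_cons !pts_cat; apply: subseq_uniq.
    by apply: cat_subseq => //; exact: suffix_subseq.
  have hs2 : path (frel sg) h (rcons s y) by rewrite rcons_path hs /=.
  have CE : circle h s (w1 ++ y :: w2) = dl (last h s) :: pts w1 ++ y :: circle h (rcons s y) w2.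
    by rewrite /circle pts_cat /= -catA last_rcons.
  have := defect_inv1 piy CE unc D; rewrite size_pts odd_double => {}D.
  have {}unc : uniq (rot 1 (pts w1) ++ circle h (rcons s y) w2 ++ [::]).
    by apply: (perm_uniq2 (perm_split (dl (last h s)) y _ _ _)); rewrite -CE cats0.
  (* The defects of the gap and of the rest add up: 0 is only 0 + 0, and 1 means that the crosscap
     lies in exactly one of the two. If a chord leaves the gap, the defect exceeds 1 and the gap has
     no configuration. *)
  have [//|[d1 [d2 [D1 D2 ->]]]|[gt1 nst]] := @defect_cat _ pi piK [:: _] [:: _] d _ D.
  + have [||-> ->] := IH0 w1 d1 _ _ D1.
    * by rewrite size_cat leq_addr.
    * by move: unw; rewrite pts_cat cat_uniq => /andP[].
    have [|-> ->] := IH h (rcons s y) w2 d2 _ hs2 un2 D2.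
      by rewrite -ltnS; apply: leq_ltn_trans le_m; rewrite size_cat /= addnS ltnS leq_addl.
    by case: d1 d2 {D1 D2} => [|[|d1]] [|[|d2]].
  + have {}nst : ~ stable pi (pts w1).
      move=> st; apply: nst; rewrite /= cats0; apply: stable_perm st.
      by rewrite perm_sym perm_rot.
    by rewrite cT_unstable // cM_unstable //; case: d gt1 {D} => [|[|d]].
- move: unw D IH0 unc le_m hw un.
  have [z zy] : exists z, z = dl y by exists (dl y).
  rewrite -zy in yw; case/splitPr: yw => w1 w2; rewrite zy => unw D IH0 unc le_m hw un.
  have := uniq_pts_mid unw; rewrite dlK => -[dy1 y1 dy2 y2]; rewrite eq_sym => ydy.
  have yh : (y == h) = false.
    by apply: contraNF hw => /eqP <-; rewrite mem_pts !mem_cat !inE eqxx !orbT.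
  rewrite cTs_none; last by rewrite mem_cat inE negb_or y1 negb_or ydy.
  rewrite (cMs_twist _ y1 dy1 y2 dy2 ydy) fc yh !mul0n !add0n.
  have un2 : uniq (pts (h :: rcons s y ++ rev (map dl w1) ++ w2)).
    exact: etrans (esym (perm_uniq (perm_pts_twist (h :: s) w1 y w2))) un.
  have hs2 : path (frel sg) h (rcons s y) by rewrite rcons_path hs /=.
  (* The letter [dl y] gives the points [dl y], [y] in this order; the chord ends at the second one,
     so the arc before it has odd length and the rule is a flip. *)
  have CE : circle h s (w1 ++ dl y :: w2) =
      dl (last h s) :: (pts w1 ++ [:: dl y]) ++ y :: pts w2 ++ [:: h].
    by rewrite /circle pts_cat /= dlK -!catA.
  have := defect_inv1 piy CE unc D.
  rewrite size_cat size_pts addn1 /= odd_double => -[d' -> {}D].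
  have [||-> _] := IH h (rcons s y) (rev (map dl w1) ++ w2) d' _ hs2 un2.
  + by rewrite -ltnS; apply: leq_ltn_trans le_m; rewrite !size_cat size_rev size_map /= addnS.
  + move: D; rewrite rev_cat /= /circle last_rcons pts_cat pts_mirror.
    by rewrite -catA.
  by rewrite eqSS.
Qed.

End Counting.

(** * The defect computed from numbers of cycles *)

Section Pairs.
Variable X : eqType.
Implicit Types (e : X -> X) (z : seq X).

Fixpoint paired e z :=
  match z with
  | [::] => true
  | [:: _] => false
  | [:: x, y & z'] => (e x == y) && paired e z'
  end.

Lemma pair_ind (P : seq X -> Prop) :
  P [::] -> (forall x, P [:: x]) -> (forall x y z, P z -> P [:: x, y & z]) -> forall z, P z.
Proof.
move=> P0 P1 P2 z; have [n] := ubnP (size z); elim: n z => // n IH [|x [|y z]] //= lt_z.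
by apply: P2; apply: IH; rewrite -ltnS ltnW.
Qed.

Lemma paired_even e z : paired e z -> ~~ odd (size z).
Proof. by elim/pair_ind: z => //= x y z IH /andP[_ /IH]; rewrite negbK. Qed.

Lemma paired_cat e z1 z2 : ~~ odd (size z1) ->
  paired e (z1 ++ z2) = paired e z1 && paired e z2.
Proof.
by elim/pair_ind: z1 => //= x y z IH; rewrite negbK => /IH ->; rewrite andbA.
Qed.

Lemma paired_rev e z : involutive e -> paired e z -> paired e (rev z).
Proof.
move=> eK; elim/pair_ind: z => //= x y z IH /andP[/eqP exy pz].
rewrite !rev_cons -!cats1 -catA paired_cat ?size_rev ?(paired_even pz) // IH //=.
by rewrite -exy eK eqxx.
Qed.

Lemma eq_paired e e' z : {in z, e =1 e'} -> paired e z -> paired e' z.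
Proof.
elim/pair_ind: z => //= x y z IH ee /andP[/eqP <- pz].
rewrite ee ?inE ?eqxx // IH // => u uz; apply: ee.
by rewrite !inE uz !orbT.
Qed.

Lemma paired_closed e z x : involutive e -> paired e z -> x \in z -> e x \in z.
Proof.
move=> eK; elim/pair_ind: z => //= a b z IH /andP[/eqP <- /IH {}IH].
rewrite !inE => /or3P[/eqP->|/eqP->|/IH->]; rewrite ?eK ?eqxx ?orbT //.
Qed.

Lemma even_seqP z : ~~ odd (size z) ->
  z = [::] \/ exists a z' b, z = a :: rcons z' b /\ ~~ odd (size z').
Proof.
case: z => [|a z] /=; first by left.
case/lastP: z => [|z b] //; rewrite size_rcons /= negbK => ev.
by right; exists a, z, b.
Qed.

Lemma odd_seqP z : odd (size z) ->
  exists a z', [/\ z = a :: z', ~~ odd (size z') &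
    exists z'' b, z = rcons z'' b /\ ~~ odd (size z'')].
Proof.
case: z => [|a z] //= ev; exists a, z; split=> //.
exists (belast a z), (last a z); rewrite -lastI size_belast; split=> //.
Qed.

End Pairs.

Section Surgery.
Variables (X : finType) (pi : {perm X}).
Hypothesis piK : involutive pi.
Hypothesis piN : forall x, pi x != x.

Definition fpf_inv (e : {perm X}) := involutive e /\ forall x, e x != x.

(* Deletes the chord of [x] and [pi x] from the circles of [e]: their partners
   become partners of each other. *)
Definition cut (e : {perm X}) x : {perm X} :=
  (tperm (e x) (pi x) * e * tperm (e x) (pi x))%g.

Lemma cutE e x z : fpf_inv e ->
  cut e x z = if z == x then pi x else if z == pi x then x else
              if z == e x then e (pi x) else if z == e (pi x) then e x else e z.
Proof.
move=> [eK eN]; rewrite /cut !permM.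
have [->|zx] := eqVneq z x.
  by rewrite (tpermD (eN x) (piN x)) tpermL.
have [->|zy] := eqVneq z (pi x).
  by rewrite tpermR eK (tpermD (eN x) (piN x)).
have [->|zex] := eqVneq z (e x).
  rewrite tpermL tpermD //; first by rewrite (inj_eq perm_inj) eq_sym piN.
  by rewrite eq_sym eN.
rewrite (tpermD (z := z)) 1?eq_sym //.
have [->|zey] := eqVneq z (e (pi x)); first by rewrite eK tpermR.
rewrite tpermD // 1?eq_sym ?(inj_eq perm_inj) //.
by apply: contraNneq zey => <-; rewrite eK.
Qed.

Lemma cut_fpf e x : fpf_inv e -> fpf_inv (cut e x).
Proof.
move=> [eK eN]; split=> z.
  rewrite /cut !permM; rewrite !tpermK.
  by rewrite eK tpermK.
apply/eqP => /(congr1 (tperm (e x) (pi x))); rewrite /cut !permM tpermK => /eqP.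
by rewrite (negPf (eN _)).
Qed.

(** Cutting multiplies [e * pi] twice by a transposition whose two points lie in a common cycle. If
    the points differ, each multiplication splits a cycle; afterwards [x] and [pi x] are fixed
    points. *)
Lemma card_porbits_cut e x : fpf_inv e ->
  #|porbits (cut e x * pi)%g| = #|porbits (e * pi)%g| + (e x != pi x).*2.
Proof.
move=> [eK eN]; set y := pi x; set a := e x.
have E1 : (e * tperm a y * pi)%g = (tperm x (e y) * (e * pi))%g.
  by apply/permP => z; rewrite !permM (inj_tperm _ _ _ (@perm_inj _ e)) eK.
have c1 := porbits_mul_tperm (e * pi)%g x (e y).
have c2 := porbits_mul_tperm (e * tperm a y * pi)%g a y.
rewrite /= -E1 in c1.
have m1 : x \in porbit (e * pi)%g (e y).
  by have := mem_porbit (e * pi)%g 1 (e y); rewrite permM eK piK.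
have m2 : a \in porbit (e * tperm a y * pi)%g y.
  rewrite porbit_sym; have := mem_porbit (e * tperm a y * pi)%g 1 a.
  by rewrite expg1 !permM eK (tpermD (eN x) (piN x)).
rewrite m1 addn0 in c1; rewrite /= m2 addn0 in c2.
have -> : (cut e x * pi = tperm a y * (e * tperm a y * pi))%g.
  by rewrite /cut !mulgA.
have E2 : (x != e y) = (a != y) by rewrite /a (can2_eq eK eK).
rewrite E2 in c1.
by rewrite c2 c1 -addnA addnn.
Qed.

Lemma cut_pair e x a c r : fpf_inv e -> uniq [:: x, a, pi x, c & r] ->
    e x = a -> e (pi x) = c ->
  [/\ cut e x a = c, cut e x c = a & {in r, e =1 cut e x}].
Proof.
move=> ei un ea ec; subst a c; move: un; rewrite /= !inE !negb_or -!andbA.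
case/and5P=> n1 n2 n3 n4 /and5P[n5 n6 n7 n8 /and3P[n9 n10 _]].
rewrite !cutE // eqxx [e x == x]eq_sym (negPf n1) (negPf n5) eqxx.
rewrite [e (pi x) == x]eq_sym (negPf n3) [e (pi x) == pi x]eq_sym (negPf n8).
rewrite [e (pi x) == e x]eq_sym (negPf n6) ?eqxx; split=> // z zr.
rewrite cutE // !ifN //.
- by apply: contraNneq n10 => <-.
- by apply: contraNneq n7 => <-.
- by apply: contraNneq n9 => <-.
- by apply: contraNneq n4 => <-.
Qed.

Lemma cut_id e x : fpf_inv e -> e x = pi x -> cut e x =1 e.
Proof.
move=> ei exy z; have eyx : e (pi x) = x by rewrite -exy ei.1.
rewrite cutE // eyx exy; have [->//|_] := eqVneq z x.
by have [->|_] := eqVneq z (pi x).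
Qed.

(* Along [z] the points are joined alternately by [be] and by [al]. *)
Definition circ (al be : X -> X) z := paired be z && paired al (rot 1 z).

Lemma circ_closed (al be : X -> X) z x : involutive al -> involutive be ->
  circ al be z -> x \in z -> al x \in z /\ be x \in z.
Proof.
move=> alK beK /andP[pb pa] xz; split; last exact: paired_closed pb xz.
by rewrite -(mem_rot 1); apply: paired_closed pa _; rewrite ?mem_rot.
Qed.

Lemma eq_circ (al be al' be' : X -> X) z : {in z, al =1 al'} -> {in z, be =1 be'} ->
  circ al be z -> circ al' be' z.
Proof.
move=> ea eb /andP[pb pa]; apply/andP; split; first exact: eq_paired pb.
by apply: eq_paired pa => x; rewrite mem_rot => /ea.
Qed.

Lemma paired_rot2 (e : X -> X) z : paired e z -> paired e (rot 1 (rot 1 z)).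
Proof.
case: z => [|a [|b z]] // pz; rewrite !(rot1_cons, rcons_cons) -!cats1 -catA.
have ev : ~~ odd (size z) by have := paired_even pz; rewrite /= negbK.
by rewrite paired_cat //=; move: pz => /= /andP[-> ->].
Qed.

(** On the arc [z1], which starts at an odd position, [al] and [be] alternate in the opposite phase;
    this is the reason for [rot 1] here and in [defect_split]. [cut] joins the neighbours of the
    removed points, which closes both arcs. *)
Lemma circ_split (al be : {perm X}) x z1 z2 : fpf_inv al -> fpf_inv be ->
    uniq (x :: z1 ++ pi x :: z2) -> ~~ odd (size z1) ->
    circ al be (x :: z1 ++ pi x :: z2) ->
  circ (cut al x) (cut be x) (rot 1 z1) /\ circ (cut al x) (cut be x) z2.
Proof.
set y := pi x => ai bi un ev /andP[]; rewrite rot1_cons -cats1 -catA => pb pa.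
have ev2 : ~~ odd (size z2).
  by have := paired_even pb; rewrite /= size_cat oddD (negPf ev) /= negbK.
have [B1 B2] : paired (cut be x) (rot 1 z1) /\ paired (cut be x) z2.
  have [z10|[a [z1' [b [Ez1 ev1]]]]] := even_seqP ev.
    move: pb; rewrite z10 /= => /andP[/eqP exy pz2]; split=> //.
    by apply: eq_paired pz2 => z _; rewrite cut_id.
  move: pb; rewrite Ez1 /= => /andP[/eqP exa].
  rewrite cat_rcons paired_cat //= => /and3P[pz1 /eqP eby pz2].
  have P : perm_eq (x :: z1 ++ pi x :: z2) [:: x, a, pi x, b & z1' ++ z2].
    rewrite Ez1; apply/seq.permP => q; rewrite -cats1 /= !count_cat /= ?count_cat /=; clear; lia.
  have un' := un; rewrite (perm_uniq P) in un'.
  have eyb : be (pi x) = b by rewrite -/y -eby (proj1 bi).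
  have [eab eba er] := cut_pair bi un' exa eyb; split; last first.
    by apply: eq_paired pz2 => z zz; apply: er; rewrite mem_cat zz orbT.
  rewrite rot1_cons -!cats1 -catA paired_cat //= eba eqxx /= andbT.
  by apply: eq_paired pz1 => z zz; apply: er; rewrite mem_cat zz.
have [A1 A2] : paired (cut al x) z1 /\ paired (cut al x) (rot 1 z2).
  move: pa; rewrite paired_cat // => /andP[pz1].
  have [z20|[c [z2' [d [Ez2 ev2']]]]] := even_seqP ev2.
    rewrite z20 /= andbT => /eqP eyx.
    have exy : al x = pi x by rewrite -[pi x]ai.1 -/y eyx.
    by split=> //; apply: eq_paired pz1 => z _; rewrite cut_id.
  rewrite Ez2 /= cat_rcons => /andP[/eqP eyc]; rewrite paired_cat //= andbT.
  move=> /andP[pz2 /eqP edx].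
  have P : perm_eq (x :: z1 ++ pi x :: z2) [:: x, d, pi x, c & z1 ++ z2'].
    rewrite Ez2; apply/seq.permP => q; rewrite -cats1 /= !count_cat /= ?count_cat /=; clear; lia.
  have un' := un; rewrite (perm_uniq P) in un'.
  have exd : al x = d by rewrite -edx ai.1.
  have [edc ecd er] := cut_pair ai un' exd eyc; split.
    by apply: eq_paired pz1 => z zz; apply: er; rewrite mem_cat zz.
  rewrite rot1_cons -!cats1 -catA paired_cat //= edc eqxx /= andbT.
  by apply: eq_paired pz2 => z zz; apply: er; rewrite mem_cat zz orbT.
by split; apply/andP; split=> //; exact: paired_rot2.
Qed.

(** The two alternatives for [al] are the two uses: [z1] and [z2] are the arcs of one circle with a
    twisted chord, or come from two circles that are merged. Reversing [z1] brings the former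
    neighbours of [x] and [pi x] together in the right phase. *)
Lemma circ_join (al be : {perm X}) x z1 z2 : fpf_inv al -> fpf_inv be ->
    uniq (x :: z1 ++ pi x :: z2) -> odd (size z1) -> odd (size z2) ->
    paired be (x :: z1) -> paired be (pi x :: z2) ->
    paired al (rcons z1 (pi x)) && paired al (rcons z2 x)
    || paired al (rcons z1 x) && paired al (rcons z2 (pi x)) ->
  circ (cut al x) (cut be x) (rev z1 ++ z2).
Proof.
move=> ai bi un od1 od2.
have [a [z1' [E1 ev1 [z1'' [b [E1' ev1']]]]]] := odd_seqP od1.
have [c [z2' [E2 ev2 [z2'' [d [E2' ev2']]]]]] := odd_seqP od2.
rewrite {1}E1 {1}E2 /= => /andP[/eqP exa pz1] /andP[/eqP eyc pz2].
rewrite {1 2}E1' {1 2}E2' -!cats1 -!catA /= !paired_cat //= !andbT -!andbA => pal.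
apply/andP; split.
  have P : perm_eq (x :: z1 ++ pi x :: z2) [:: x, a, pi x, c & z1' ++ z2'].
    rewrite E1 E2; apply/seq.permP => q; rewrite /= !count_cat /= ?count_cat /=; clear; lia.
  have un' := un; rewrite (perm_uniq P) in un'.
  have [eac eca er] := cut_pair bi un' exa eyc.
  rewrite E1 E2 rev_cons -cats1 -catA paired_cat ?size_rev //= eac eqxx /=.
  apply/andP; split; last by apply: eq_paired pz2 => z zz; apply: er; rewrite mem_cat zz orbT.
  apply: paired_rev; first by case: (cut_fpf x bi).
  by apply: eq_paired pz1 => z zz; apply: er; rewrite mem_cat zz.
rewrite E1' E2' rev_rcons cat_cons rot1_cons -!cats1 -!catA.
rewrite /= paired_cat ?size_rev // paired_cat //= andbT.
suff [edb er] : cut al x d = b /\ {in z1'' ++ z2'', al =1 cut al x}.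
  rewrite edb eqxx andbT.
  have [p1 p2] : paired al z1'' /\ paired al z2'' by case/orP: pal => /and4P[].
  apply/andP; split; last by apply: eq_paired p2 => z zz; apply: er; rewrite mem_cat zz orbT.
  apply: paired_rev; first by case: (cut_fpf x ai).
  by apply: eq_paired p1 => z zz; apply: er; rewrite mem_cat zz.
case/orP: pal => /and4P[_ /eqP eb _ /eqP ed].
- have P : perm_eq (x :: z1 ++ pi x :: z2) [:: x, d, pi x, b & z1'' ++ z2''].
    rewrite E1' E2'; apply/seq.permP => q.
    rewrite -!cats1 /= !count_cat /= ?count_cat /=; clear; lia.
  have un' := un; rewrite (perm_uniq P) in un'.
  have exd : al x = d by rewrite -ed ai.1.
  have eyb : al (pi x) = b by rewrite -eb ai.1.
  by have [? ? ?] := cut_pair ai un' exd eyb.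
- have P : perm_eq (x :: z1 ++ pi x :: z2) [:: x, b, pi x, d & z1'' ++ z2''].
    rewrite E1' E2'; apply/seq.permP => q.
    rewrite -!cats1 /= !count_cat /= ?count_cat /=; clear; lia.
  have un' := un; rewrite (perm_uniq P) in un'.
  have exb : al x = b by rewrite -eb ai.1.
  have eyd : al (pi x) = d by rewrite -ed ai.1.
  by have [? ? ?] := cut_pair ai un' exb eyd.
Qed.

(** A stage in the removal of chords. On the circles left, [al] and [be] match neighbours; on
    removed points both agree with [pi], so that these are fixed by [al * pi] and [be * pi]. *)
Definition state (al be : {perm X}) (zs : seq (seq X)) :=
  [/\ fpf_inv al /\ fpf_inv be, uniq (flatten zs), stable pi (flatten zs),
      forall z, z \in zs -> circ al be z
    & forall x, x \notin flatten zs -> al x = pi x /\ be x = pi x].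

Lemma cut_finished e x z : fpf_inv e -> (z != x -> z != pi x -> e z = pi z) ->
  cut e x z = pi z.
Proof.
move=> ei ez; rewrite cutE //; have [->//|zx] := eqVneq z x.
have [->|zy] := eqVneq z (pi x); first by rewrite piK.
have {}ez := ez zx zy; have [e1|_] := eqVneq z (e x).
  by move: zy; rewrite -[z]piK -ez e1 ei.1 eqxx.
have [e1|//] := eqVneq z (e (pi x)).
by move: zx; rewrite -[z]piK -ez e1 ei.1 piK eqxx.
Qed.

Lemma cut_away e x (c : seq X) : fpf_inv e -> x \notin c -> pi x \notin c ->
  (forall z, z \in c -> e z \in c) -> {in c, e =1 cut e x}.
Proof.
move=> ei xc yc cl z zc; rewrite cutE // !ifN //.
- by apply: contraNneq yc => e1; rewrite -[pi x]ei.1 -e1; exact: cl.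
- by apply: contraNneq xc => e1; rewrite -[x]ei.1 -e1; exact: cl.
- by apply: contraNneq yc => <-.
- by apply: contraNneq xc => <-.
Qed.

Lemma circ_away (al be : {perm X}) x c : fpf_inv al -> fpf_inv be ->
  x \notin c -> pi x \notin c -> circ al be c -> circ (cut al x) (cut be x) c.
Proof.
move=> ai bi xc yc C; apply: (eq_circ _ _ C); apply: cut_away => // z zc.
  by case: (circ_closed ai.1 bi.1 C zc).
by case: (circ_closed ai.1 bi.1 C zc).
Qed.

Lemma state_step al be x zs zs' : state al be zs ->
    perm_eq (flatten zs) (x :: pi x :: flatten zs') ->
    (forall z, z \in zs' -> z \notin zs -> circ (cut al x) (cut be x) z) ->
  state (cut al x) (cut be x) zs'.
Proof.
move=> [[ai bi] un st C out] P C'; split.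
- by split; exact: cut_fpf.
- exact: perm_uniq2 P un.
- exact: stable_rem piK _ _ _ P un st.
- move=> c cz; have [czs|/C'] := boolP (c \in zs); last exact.
  move: un; rewrite (perm_uniq P) /= inE negb_or => /and3P[/andP[_ nx] ny _].
  apply: circ_away (C _ czs) => //.
    by apply: contra nx => xc; apply/flattenP; exists c.
  by apply: contra ny => xc; apply/flattenP; exists c.
- move=> z zn; have nz : z != x -> z != pi x -> z \notin flatten zs.
    by move=> zx zy; rewrite (perm_mem P) !inE !negb_or zx zy.
  by split; apply: cut_finished => // zx zy; case: (out z (nz zx zy)).
Qed.

(** An arc is empty when [x] and its partner are neighbours on that side. Then the corresponding
    product gains no cycle, and the split leaves no circle there, so the two effects cancel in the
    Euler count. *)
Lemma circ_neighbours (al be : {perm X}) x z1 z2 : fpf_inv al ->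
    uniq (x :: z1 ++ pi x :: z2) -> circ al be (x :: z1 ++ pi x :: z2) ->
  (be x != pi x) = (z1 != [::]) /\ (al x != pi x) = (z2 != [::]).
Proof.
move=> ai un /andP[pb pa]; split.
  move: pb un; case: z1 {pa} => [|a z1] /= /andP[/eqP-> _]; first by rewrite eqxx.
  rewrite mem_cat inE !negb_or -!andbA => /and4P[_ _ _].
  by case/and3P.
move: pa; rewrite rot1_cons => /(paired_rev ai.1); rewrite rev_rcons rev_cat rev_cons.
case/lastP: z2 un {pb} => [|z2 d] un; first by rewrite /= => /andP[/eqP-> _]; rewrite eqxx.
rewrite rev_rcons /= => /andP[/eqP-> _].
move: un => /= /andP[_]; rewrite cat_uniq => /and3P[_ _] /= /andP[+ _].
by rewrite mem_rcons inE negb_or eq_sym => /andP[-> _]; case: (z2).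
Qed.

Lemma paired_swap (e : X -> X) z1 z2 : ~~ odd (size z1) ->
  paired e (z1 ++ z2) -> paired e (z2 ++ z1).
Proof.
move=> ev pz; have := paired_even pz; rewrite size_cat oddD (negPf ev) /= => ev2.
by move: pz; rewrite !paired_cat // andbC.
Qed.

(** The second circle of a merge, read from the partner [y] in the direction in which [be] comes
    first. The parity in [defect_merge] selects this direction. *)
Lemma circ_open (al be : X -> X) u y v : involutive al -> involutive be ->
    circ al be (u ++ y :: v) ->
  let q := if odd (size u) then rev (v ++ u) else v ++ u in
  [/\ odd (size q), paired be (y :: q) & paired al (rcons q y)].
Proof.
move=> alK beK /andP[pb pa] q; rewrite /q {q}.
have ev : odd (size (v ++ u)).
  by have := paired_even pb; rewrite !size_cat /= addnS /= negbK addnC.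
have [od|nod] := boolP (odd (size u)).
  split; first by rewrite size_rev.
    rewrite -rev_rcons; apply: paired_rev => //; rewrite rcons_cat.
    by apply: paired_swap; rewrite ?size_rcons /= ?od // cat_rcons.
  rewrite -rev_cons; apply: paired_rev => //.
  case: u od pa {pb ev} => // a u /= ev; rewrite rot1_cons rcons_cat => /(paired_swap ev).
  by rewrite rcons_cons -cats1 /= -catA.
split=> //.
  by rewrite -cat_cons; apply: paired_swap.
case: u nod pa {pb} ev => [|a u] /=; first by rewrite rot1_cons cats0.
rewrite negbK => od; rewrite rot1_cons rcons_cat rcons_cons -cat_rcons => pa _.
rewrite rcons_cat -cat_rcons; apply: paired_swap => //.
by rewrite size_rcons /= od.
Qed.

(** Euler's formula, checked on the removal of one chord, which takes away two points. In a split
    the cycles gained account for the nonempty arcs. A flip gains four cycles and no circle; a merge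
    gains four cycles and loses a circle; hence their costs 1 and 2. At the end [al] and [be] equal
    [pi], and each product is the identity, with [#|X|] cycles. *)
Lemma defect_exists zs al be : state al be zs ->
  exists2 d, defect pi zs d &
    #|porbits (al * pi)%g| + #|porbits (be * pi)%g| + d.*2 + size (flatten zs) =
    #|X|.*2 + (count (fun z => z != [::]) zs).*2.
Proof.
have [n] := ubnP (size zs + size (flatten zs)); elim: n zs al be => // n IH.
case=> [|[|x z] zs] al be lt_n S.
- exists 0; first exact: defect_nil.
  have [_ _ _ _ out] := S.
  have e1 (e : {perm X}) : (forall x, e x = pi x) -> (e * pi)%g = 1%g.
    by move=> E; apply/permP => x; rewrite permM E piK perm1.
  rewrite !e1; try by move=> x; case: (out x isT).
  have -> : #|porbits (1%g : {perm X})| = #|X|.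
    rewrite /porbits card_imset ?cardsT // => u v /eqP.
    by rewrite eq_porbit_mem => /porbitP[i ->]; rewrite expg1n perm1.
  by rewrite /= !addn0 addnn.
- have [|d D E] := IH zs al be lt_n.
    by have [ab un st C out] := S; split=> // c cz; apply: C; rewrite inE cz orbT.
  by exists d => //; exact: defect_empty.
have [[ai bi] un st C out] := S; set y := pi x.
have lt_n' zs' : perm_eq (flatten ((x :: z) :: zs)) (x :: y :: flatten zs') ->
    size zs' <= (size zs).+2 -> size zs' + size (flatten zs') < n.
  move=> /perm_size P le_zs'; move: lt_n; rewrite P /= => lt_n; clear -lt_n le_zs'; lia.
have yzs : y \in flatten ((x :: z) :: zs) by apply: st; rewrite inE eqxx.
have yx := piN x.
have Cx : circ al be (x :: z) by apply: C; rewrite inE eqxx.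
have ax := card_porbits_cut x ai; have bx := card_porbits_cut x bi.
have unx : uniq (x :: z) by move: un; rewrite [flatten _]/= -cat_cons cat_uniq => /andP[].
have [yz|yz] := boolP (y \in z).
  case/splitPr: yz S un C yzs Cx lt_n lt_n' unx {out st} => z1 z2 S un C yzs Cx lt_n lt_n' unx.
  have [N1 N2] := circ_neighbours ai unx Cx.
  have [od|ev] := boolP (odd (size z1)).
    have P : perm_eq (flatten ((x :: z1 ++ y :: z2) :: zs))
      (x :: y :: flatten ((rev z1 ++ z2) :: zs)) := perm_flip x y z1 z2 (flatten zs).
    have [pb pa] := andP Cx.
    have od2 : odd (size z2).
      by have := paired_even pb; rewrite /= size_cat /= addnS oddS oddD od; case: odd.
    have C1 : circ (cut al x) (cut be x) (rev z1 ++ z2).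
      move: pb; rewrite -cat_cons paired_cat ?negbK //= => /andP[pb1 pb2].
      apply: circ_join => //; apply/orP; left.
      move: pa; rewrite rot1_cons rcons_cat rcons_cons -cat_rcons paired_cat //.
      by rewrite size_rcons /= negbK.
    have S' : state (cut al x) (cut be x) ((rev z1 ++ z2) :: zs).
      apply: state_step S P _ => c; rewrite !inE => /orP[/eqP->//|->].
      by rewrite orbT.
    have [|d D E] := IH _ _ _ _ S'; first by apply: lt_n' => //; rewrite ltnW.
    exists d.+1; first exact: defect_flip.
    have := perm_size P; move: E; rewrite ax bx N1 N2.
    have -> : z1 != [::] by case: (z1) od.
    have -> : z2 != [::] by case: (z2) od2.
    have nE : rev z1 ++ z2 != [::] by case: (rev z1) => //; case: (z2) od2.
    rewrite /= nE /=; clear; lia.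
  have P : perm_eq (flatten ((x :: z1 ++ y :: z2) :: zs))
      (x :: y :: flatten [:: rot 1 z1, z2 & zs]) := perm_split x y z1 z2 (flatten zs).
  have [C1 C2] := circ_split ai bi unx ev Cx.
  have S' : state (cut al x) (cut be x) [:: rot 1 z1, z2 & zs].
    apply: state_step S P _ => c; rewrite !inE => /or3P[/eqP->//|/eqP->//|->].
    by rewrite orbT.
  have [|d D E] := IH _ _ _ _ S'; first exact: lt_n'.
  exists d; first exact: defect_split.
  have := perm_size P; move: E; rewrite ax bx N1 N2.
  have nE : (rot 1 z1 != [::]) = (z1 != [::]) by rewrite -!size_eq0 size_rot.
  move: (flatten [:: rot 1 z1, z2 & zs]) => f.
  rewrite [count _ (rot 1 z1 :: _)]/= nE /=; clear; lia.
have yxz : y \notin x :: z by rewrite inE negb_or yz yx.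
have {}yzs : y \in flatten zs.
  by move: yzs; rewrite /= inE mem_cat (negPf yz) (negPf yx).
have [c czs yc] := flattenP yzs.
case/splitPr: czs S un C lt_n lt_n' {yzs st out} => zs1 zs2 S un C lt_n lt_n'.
case/splitPr: yc S un C lt_n lt_n' => u v S un C lt_n lt_n'.
have P : perm_eq (flatten ((x :: z) :: zs1 ++ (u ++ y :: v) :: zs2))
    (x :: y :: flatten ((rev z ++ (if odd (size u) then rev (v ++ u) else v ++ u)) :: zs1 ++ zs2)).
  by rewrite flatten_mid flatten_mid2; exact: perm_merge.
have Cy : circ al be (u ++ y :: v) by apply: C; rewrite inE mem_cat inE eqxx !orbT.
set q := (if _ then _ else _) in P.
have [oq pbq paq] : [/\ odd (size q), paired be (y :: q) & paired al (rcons q y)].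
  exact: circ_open ai.1 bi.1 Cy.
have [pb pa] := andP Cx.
have oz : odd (size z) by have := paired_even pb; rewrite /= negbK.
have unj : uniq (x :: z ++ y :: q).
  have {}un : uniq ((x :: y :: (rev z ++ q)) ++ (flatten zs1 ++ flatten zs2)).
    by have := un; rewrite (perm_uniq P) flatten_mid2.
  move: un; rewrite cat_uniq => /andP[un _].
  rewrite (perm_uniq (_ : perm_eq _ (x :: y :: rev z ++ q))) //.
  apply/seq.permP => f; rewrite /= !count_cat count_rev /=; clear; lia.
have C1 : circ (cut al x) (cut be x) (rev z ++ q).
  apply: circ_join => //.
  by apply/orP; right; rewrite paq andbT -rot1_cons.
have S' : state (cut al x) (cut be x) ((rev z ++ q) :: zs1 ++ zs2).
  apply: state_step S P _ => c'; rewrite !(inE, mem_cat).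
  by move=> /or3P[/eqP->//|->|->]; rewrite !orbT.
have [|d D E] := IH _ _ _ _ S'.
  by apply: lt_n' => //; rewrite /= !size_cat /= addnS; clear; lia.
exists d.+2; first exact: defect_merge.
have := perm_size P; move: E; rewrite ax bx.
have -> : al x != y.
  apply: contraNneq yxz => <-; by case: (circ_closed ai.1 bi.1 Cx (mem_head _ _)).
have -> : be x != y.
  apply: contraNneq yxz => <-; by case: (circ_closed ai.1 bi.1 Cx (mem_head _ _)).
have nE : rev z ++ q != [::] by case: (rev z) => //; case: (q) oq.
have nE' : u ++ y :: v != [::] by case: (u).
move: nE; set f := rev z ++ q => nE.
rewrite /= !count_cat /= nE nE' /=; clear; lia.
Qed.

End Surgery.

(** * The permutation that realises a configuration *)

Section Realisation.
Variables (X : finType) (dl : {perm X}).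
Hypothesis dlK : involutive dl.
Hypothesis dlN : forall x, dl x != x.
Implicit Types (sg : {perm X}) (p : seq (seq X)) (c u w : seq X).

Definition symmetric sg :=
  [forall x, ((dl * sg)%g x != x) && ((dl * sg)%g ((dl * sg)%g x) == x)].

Lemma symmetricP sg : reflect (fpf_inv (dl * sg)%g) (symmetric sg).
Proof.
apply: (iffP forallP) => [H|[H1 H2] x]; last by rewrite H2 H1 eqxx.
by split=> x; have /andP[] := H x => // _ /eqP.
Qed.

Lemma symmetric_dl sg x : symmetric sg -> sg (dl (sg x)) = dl x.
Proof.
by move=> /symmetricP[piK _]; have := piK (dl x); rewrite !permM dlK.
Qed.

Definition mirror c := rev (map dl c).

Lemma mem_mirror c x : (x \in mirror c) = (dl x \in c).
Proof.
by rewrite mem_rev -{1}[x]dlK mem_map //; exact: perm_inj.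
Qed.

Lemma fcycle_mirror sg c : symmetric sg -> fcycle sg c -> fcycle sg (mirror c).
Proof.
move=> sy cc; rewrite rev_cycle cycle_map; apply: sub_cycle cc => x y /= /eqP <-.
by rewrite symmetric_dl.
Qed.

Definition covers p := perm_eq (pts dl (flatten p)) (enum X).

Lemma covers_uniq p : covers p -> uniq (pts dl (flatten p)).
Proof. by move=> /perm_uniq ->; exact: enum_uniq. Qed.

Lemma uniq_pts w : uniq (pts dl w) -> uniq w /\ {in w, forall x, dl x \notin w}.
Proof.
elim: w => //= x w IH /and3P[]; rewrite inE negb_or !(mem_pts dlK) !negb_or dlK.
move=> /andP[_ /andP[xw dxw]] /andP[_ _] /IH[unw dw]; split; first by rewrite xw.
move=> y; rewrite inE => /orP[/eqP->|yw]; rewrite inE negb_or ?dlN ?dxw //=.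
rewrite dw // andbT; apply: contraNneq dxw => <-.
by rewrite dlK.
Qed.

Lemma covers_mem p x : covers p -> (x \in flatten p) = (dl x \notin flatten p).
Proof.
move=> cp; have [_ dp] := uniq_pts (covers_uniq cp).
have: x \in pts dl (flatten p) by rewrite (perm_mem cp) mem_enum.
rewrite (mem_pts dlK); have [/dp->//|nx /= ->] := boolP (x \in flatten p).
by [].
Qed.

Definition cycle_at p x := nth [::] p (find (fun c => x \in c) p).

Lemma cycle_atE p c x : uniq (flatten p) -> c \in p -> x \in c -> cycle_at p x = c.
Proof.
rewrite /cycle_at; elim: p => //= c' p IH; rewrite cat_uniq inE => /and3P[_ nh unp].
case/orP=> [/eqP->|cp] xc; first by rewrite xc.
case: ifP => xc' /=; last exact: IH.
by case/hasP: nh; exists x => //; apply/flattenP; exists c.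
Qed.

Lemma uniq_flatten_in p c : uniq (flatten p) -> c \in p -> uniq c.
Proof.
elim: p => //= c' p IH; rewrite cat_uniq inE => /and3P[uc _ up] /orP[/eqP->//|].
exact: IH.
Qed.

(** Take [next] along the blocks, and [prev] conjugated by [dl] on the mirror images. Of [x] and
    [dl x] exactly one occurs in the blocks, so this is a well-defined permutation, and it is
    symmetric by construction. *)
Lemma realise p : covers p ->
  exists2 sg : {perm X}, symmetric sg & all (fcycle sg) p.
Proof.
move=> cp; have [up dp] := uniq_pts (covers_uniq cp).
have md x : x \in flatten p -> dl x \in flatten p = false.
  by move=> xp; apply/negP => /dp; rewrite dlK xp.
have md' x : x \in flatten p = false -> dl x \in flatten p.
  by rewrite (covers_mem x cp) => /negbFE.
pose nx x := next (cycle_at p x) x; pose pv x := prev (cycle_at p x) x.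
have nxE c x : c \in p -> x \in c -> nx x = next c x by move=> *; rewrite /nx (cycle_atE up (c := c)).
have pvE c x : c \in p -> x \in c -> pv x = prev c x by move=> *; rewrite /pv (cycle_atE up (c := c)).
have nxP x : x \in flatten p -> nx x \in flatten p /\ pv (nx x) = x.
  move=> /flattenP[c cip xc]; rewrite (nxE c) // (pvE c) ?mem_next //.
  rewrite prev_next ?(uniq_flatten_in up) //; split=> //.
  by apply/flattenP; exists c; rewrite ?mem_next.
have pvP x : x \in flatten p -> pv x \in flatten p /\ nx (pv x) = x.
  move=> /flattenP[c cip xc]; rewrite (pvE c) // (nxE c) ?mem_prev //.
  rewrite next_prev ?(uniq_flatten_in up) //; split=> //.
  by apply/flattenP; exists c; rewrite ?mem_prev.
pose f x := if x \in flatten p then nx x else dl (pv (dl x)).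
pose g x := if x \in flatten p then pv x else dl (nx (dl x)).
have fK : cancel f g.
  move=> x; rewrite /f /g; have [xp|/negbTE xp] := boolP (x \in flatten p).
    by have [-> ->] := nxP x xp.
  by have [p1 p2] := pvP _ (md' _ xp); rewrite md // dlK p2 dlK.
exists (perm (can_inj fK)).
  apply/symmetricP; split=> x; rewrite !permM !permE /f;
    have [xp|/negbTE xp] := boolP (dl x \in flatten p).
  - by have [p1 p2] := nxP _ xp; rewrite md // dlK p2 dlK.
  - have := md' _ xp; rewrite dlK => xp'; have [p1 p2] := pvP _ xp'.
    by rewrite dlK p1.
  - have [p1 _] := nxP _ xp; apply: contraTneq p1 => ->.
    by rewrite -[x]dlK md.
  - have := md' _ xp; rewrite dlK => xp'; have [p1 p2] := pvP _ xp'.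
    by apply: contraTneq xp' => <-; rewrite md.
apply/allP => c cip; apply: (@cycle_from_next _ _ _ (uniq_flatten_in up cip)) => x xc /=.
rewrite permE /f; have -> : x \in flatten p by apply/flattenP; exists c.
by rewrite (nxE c).
Qed.

Lemma realise_inj p sg1 sg2 : covers p -> symmetric sg1 -> symmetric sg2 ->
  all (fcycle sg1) p -> all (fcycle sg2) p -> sg1 = sg2.
Proof.
move=> cp s1 s2 c1 c2; apply/permP => x.
have E y : y \in flatten p -> sg1 y = sg2 y.
  move=> /flattenP[c cip yc].
  by rewrite (eqP (next_cycle (allP c1 _ cip) yc)) (eqP (next_cycle (allP c2 _ cip) yc)).
have [xp|xp] := boolP (x \in flatten p); first exact: E.
have {}xp : dl x \in flatten p by move: xp; rewrite (covers_mem x cp) negbK.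
have [c cip xc] := flattenP xp.
have prv sg : all (fcycle sg) p -> symmetric sg -> sg x = dl (prev c (dl x)).
  move=> csg ssg; have /eqP e1 := prev_cycle (allP csg _ cip) xc.
  by rewrite -(symmetric_dl _ ssg) e1 dlK.
by rewrite (prv sg1) // (prv sg2).
Qed.

(** For the circle of a word that uses all points, with [be] matching the neighbours of consecutive
    letters, this is [#|X| + 2 - 2 d], where [d] is the defect. *)
Definition euler sg (be : {perm X}) := #|porbits sg| + #|porbits (be * (dl * sg))%g|.

(** On the right-hand sides the word is present only through [be], which rotated and mirrored words
    share. All symmetries of cumulants come from here. *)
Lemma count_by_euler u sg be : perm_eq (pts dl u) (enum X) -> u != [::] ->
    symmetric sg -> fpf_inv be -> paired be (rot 1 (pts dl u)) ->
  count (all (fcycle sg)) (planar u) = (euler sg be == #|X|.+2) /\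
  count (all (fcycle sg)) (projective dl u) = (euler sg be == #|X|).
Proof.
move=> fu un0 /symmetricP[piK piN] bi pb.
have uu : uniq (pts dl u) by rewrite (perm_uniq fu) enum_uniq.
have pdl : paired dl (pts dl u).
  by elim: (u) => //= x w ->; rewrite eqxx.
have st : state (dl * sg)%g dl be [:: rot 1 (pts dl u)].
  split; rewrite /= ?cats0; first by split=> //; split.
  - by rewrite rot_uniq.
  - by move=> x _; rewrite mem_rot (perm_mem fu) mem_enum.
  - by move=> z; rewrite inE => /eqP->; rewrite /circ pb paired_rot2.
  - by move=> x; rewrite mem_rot (perm_mem fu) mem_enum.
have [d D E] := defect_exists piK piN st.
have dsg : (dl * (dl * sg))%g = sg.
  by apply/permP => x; rewrite !permM dlK.
have szu : size (pts dl u) = #|X| by rewrite (perm_size fu) -cardE.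
move: E; rewrite dsg /= cats0 size_rot szu.
have -> : rot 1 (pts dl u) != [::] by case: (u) un0 => // x w _; rewrite -size_eq0 size_rot.
rewrite -/(euler sg be) /= addn0 => E.
have Du : defect (fun x => sg (dl x)) [:: rot 1 (pts dl u)] d.
  have e1 : (dl * sg)%g =1 (fun x => sg (dl x)) by move=> x; rewrite permM.
  exact: eq_defect e1 D.
have [c1 c2] : count (all (fcycle sg)) (planar u) = (d == 0) /\
    count (all (fcycle sg)) (projective dl u) = (d == 1).
  case: u un0 uu Du {fu pb pdl st D szu} => // x w _ uu Du.
  rewrite planar_cons projective_cons.
  apply: (@count_circle _ dl dlK sg _ _ x [::] w d) => //.
  - by move=> z; have := piK z; rewrite !permM.
  - by move=> z; have := piN z; rewrite permM.
rewrite c1 c2; split; congr nat_of_bool; apply/eqP/eqP => H; move: E H; clear; lia.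
Qed.

End Realisation.

(** * Sums over permutations *)

Section HalfProduct.
Variables (n : nat) (R : comNzRingType) (f : seq (pmT n) -> R).
Local Notation X := (pmT n).
Local Notation dl := (delta n).
Local Open Scope ring_scope.

Lemma deltaE (x : X) : dl x = (x.1, ~~ x.2). Proof. by rewrite permE. Qed.

Lemma deltaK : involutive dl.
Proof. by case=> i b; rewrite !deltaE /= negbK. Qed.

Lemma deltaN x : dl x != x.
Proof. by case: x => i b; rewrite deltaE /= xpair_eqE eqxx; case: b. Qed.

(** [kappa_half] with an arbitrary weight [f] of cycles in place of the cumulant. *)
Definition half_prod (sg : {perm X}) : R :=
  \prod_(C in porbits sg | pair_rep C)
    oapp (fun x0 => f (traject sg x0 #|C|)) 0 (cycle_start sg C).

Hypothesis f_rot : forall i c, f (rot i c) = f c.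

Lemma porbit_cycle (sg : {perm X}) c x : fcycle sg c -> x \in c ->
  porbit sg x = [set y in c].
Proof.
move=> cc xc; apply/setP => y; rewrite inE.
have stab z : z \in c -> sg z \in c.
  by move=> zc; rewrite (eqP (next_cycle cc zc)) mem_next.
apply/porbitP/idP => [[i ->]|yc].
  by elim: i => [|i IH]; rewrite ?expg0 ?perm1 // expgSr permM stab.
have := fconnect_cycle cc xc y; rewrite yc => /iter_findex <-.
exists (findex sg x y); elim: (findex _ _ _) => [|i IH]; first by rewrite expg0 perm1.
by rewrite expgSr permM -IH.
Qed.

Lemma cycle_start_some (sg : {perm X}) (C : {set X}) : pair_rep C ->
  exists2 x, x \in C & cycle_start sg C = Some x.
Proof.
move=> /existsP[i /andP[iC _]]; rewrite /cycle_start.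
case: pickP => [x /andP[xC _]|_]; first by exists x.
case: pickP => [x /andP[xC _]|]; first by exists x.
have [m /= mC mmin] := @arg_minnP _ i [pred j | (j, false) \in C] (@nat_of_ord n) iC.
move=> /(_ (m, false)) /=; rewrite mC /= => /negP[]; apply/forallP => -[j b].
by apply/implyP => jC; apply/implyP; case: b jC => //= jC _; apply: mmin.
Qed.

Lemma half_factor (sg : {perm X}) c : fcycle sg c -> uniq c -> c != [::] ->
    pair_rep [set x in c] ->
  oapp (fun x0 => f (traject sg x0 #|[set x in c]|)) 0 (cycle_start sg [set x in c]) = f c.
Proof.
move=> cc uc c0 /(cycle_start_some sg)[x xc ->] /=; rewrite inE in xc.
have [i c' E] := rot_to xc; rewrite -(f_rot i c) E.
have -> : #|[set x in c]| = size (x :: c').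
  by rewrite -E size_rot cardsE; apply/card_uniqP.
have : fcycle sg (x :: c') by rewrite -E rot_cycle.
rewrite /= rcons_path => /andP[/fpathE p _].
by rewrite [in RHS]p.
Qed.

(** The least index in [c] occurs there with one sign only. The representative is whichever of [c]
    and its mirror image has it with positive sign. *)
Lemma pair_rep_mirror (c : seq X) : uniq (pts dl c) -> c != [::] ->
  pair_rep [set x in mirror dl c] = ~~ pair_rep [set x in c].
Proof.
move=> uc c0; have [_ dc] := uniq_pts deltaK deltaN uc.
have [x0 x0c] : exists x, x \in c by case: (c) c0 => // x s _; exists x; rewrite inE eqxx.
pose P := [pred j : 'I_n | ((j, false) \in c) || ((j, true) \in c)].
have P0 : P x0.1 by rewrite /= ; case: x0 x0c => j [] /= ->; rewrite ?orbT.
have [m /= mP mmin] := @arg_minnP _ x0.1 P (@nat_of_ord n) P0.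
have disj b : (m, b) \in c -> (m, ~~ b) \notin c.
  by move=> /dc; rewrite deltaE.
have memm b j : ((j, b) \in mirror dl c) = ((j, ~~ b) \in c).
  by rewrite (mem_mirror deltaK) deltaE.
rewrite /pair_rep; case/orP: mP => mc.
- have -> : [exists i, ((i, false) \in [set x in c]) &&
     [forall j : 'I_n, ((j, true) \in [set x in c]) ==> (i < j)%N]].
    apply/existsP; exists m; rewrite inE mc /=; apply/forallP => j; apply/implyP.
    rewrite inE => jc; rewrite ltn_neqAle mmin ?jc ?orbT // andbT.
    by apply: contraTneq jc => /val_inj <-; exact: disj mc.
  apply/existsP => -[i /andP[]]; rewrite inE memm /= => ic /forallP/(_ m).
  rewrite inE memm /= mc /= ltnNge mmin //.
  by rewrite ic orbT.
- have -> : [exists i, ((i, false) \in [set x in mirror dl c]) &&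
     [forall j : 'I_n, ((j, true) \in [set x in mirror dl c]) ==> (i < j)%N]].
    apply/existsP; exists m; rewrite inE memm mc /=; apply/forallP => j; apply/implyP.
    rewrite inE memm /= => jc; rewrite ltn_neqAle mmin ?jc ?orbT // andbT.
    by apply: contraTneq jc => /val_inj <-; exact: disj mc.
  apply/esym/existsP => -[i /andP[]]; rewrite inE /= => ic /forallP/(_ m).
  rewrite inE /= mc /= ltnNge mmin //.
  by rewrite ic.
Qed.

(** A configuration lists one cycle of each mirror pair, not always the representative. Mirror
    invariance of [f] is asked for just at the other blocks, so that weights involving kappa' can be
    used on words of positive letters. *)
Lemma half_prodE (sg : {perm X}) (p : seq (seq X)) :
    covers dl p -> [::] \notin p -> symmetric dl sg -> all (fcycle sg) p ->
    (forall c, c \in p -> ~~ pair_rep [set x in c] -> f (mirror dl c) = f c) ->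
  half_prod sg = \prod_(c <- p) f c.
Proof.
move=> cp p0 ssg csg fm; have uf := covers_uniq cp.
have [up dp] := uniq_pts deltaK deltaN uf.
have c0 c : c \in p -> c != [::] by apply: contraTneq => ->.
have uptc c : c \in p -> uniq (pts dl c).
  move=> cip; apply: subseq_uniq uf; elim: p cip {cp p0 csg fm up dp c0} => //= c' p IH.
  rewrite inE pts_cat => /orP[/eqP->|/IH H]; first exact: prefix_subseq.
  exact: subseq_trans H (suffix_subseq _ _).
pose h c := if pair_rep [set x in c] then [set x in c] else [set x in mirror dl c].
have hrep c : c \in p -> pair_rep (h c).
  by move=> cip; rewrite /h; case: ifP => // nr; rewrite pair_rep_mirror ?nr ?uptc ?c0.
have hF c : c \in p ->
    oapp (fun x0 => f (traject sg x0 #|h c|)) 0 (cycle_start sg (h c)) = f c.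
  move=> cip; have uc := uniq_flatten_in up cip; have := hrep c cip.
  rewrite /h; case: ifP => [_|nr] rep; first by rewrite half_factor ?(allP csg) ?c0.
  rewrite half_factor ?fm ?nr //.
  - exact: (fcycle_mirror deltaK ssg (allP csg _ cip)).
  - by rewrite rev_uniq map_inj_uniq //; exact: perm_inj.
  - by have := c0 c cip; rewrite -!size_eq0 size_rev size_map.
rewrite /half_prod.
transitivity (\prod_(C <- map h p)
    oapp (fun x0 => f (traject sg x0 #|C|)) 0 (cycle_start sg C)); last first.
  by rewrite big_map; apply: eq_big_seq => c cip; rewrite hF.
have in_h c x : x \in h c -> x \in c \/ dl x \in c.
  by rewrite /h; case: ifP; rewrite inE ?(mem_mirror deltaK); [left|right].
rewrite big_uniq; last first.
  rewrite map_inj_in_uniq.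
    elim: (p) up p0 {cp csg fm uf dp c0 uptc hrep hF} => //= c p' IH.
    rewrite cat_uniq inE negb_or => /and3P[_ nh up] /andP[nc p0].
    rewrite IH // andbT; apply: contra nh => cp'; apply/hasP.
    case: c nc cp' => // x c _ cp'; exists x; rewrite ?inE ?eqxx //.
    by apply/flattenP; exists (x :: c); rewrite ?inE ?eqxx.
  move=> c c' cip cip' E; have [x xh] : exists x, x \in h c.
    have := hrep c cip; move=> /existsP[i /andP[ih _]]; by exists (i, false).
  have xh' := xh; rewrite E in xh'.
  have inp a z : a \in p -> z \in a -> z \in flatten p by move=> ? ?; apply/flattenP; exists a.
  have [xc|xc] := in_h _ _ xh; have [xc'|xc'] := in_h _ _ xh'.
  - by rewrite -(cycle_atE up cip xc) -(cycle_atE up cip' xc').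
  - by have := dp _ (inp _ _ cip xc); rewrite (inp _ _ cip' xc').
  - by have := dp _ (inp _ _ cip' xc'); rewrite (inp _ _ cip xc).
  - by rewrite -(cycle_atE up cip xc) -(cycle_atE up cip' xc').
apply: eq_bigl => C; apply/andP/mapP => [[/imsetP[x _ ->] rep]|[c cip ->]].
  have [xp|xp] := boolP (x \in flatten p).
    have [c cip xc] := flattenP xp; exists c => //.
    have E := porbit_cycle (allP csg _ cip) xc; rewrite E in rep *.
    by rewrite /h rep.
  have {}xp : dl x \in flatten p by move: xp; rewrite (covers_mem deltaK deltaN x cp) negbK.
  have [c cip xc] := flattenP xp; exists c => //.
  have E : porbit sg x = [set y in mirror dl c].
    apply: porbit_cycle; last by rewrite (mem_mirror deltaK).
    exact: (fcycle_mirror deltaK ssg (allP csg _ cip)).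
  rewrite E in rep *.
  by move: rep; rewrite /h pair_rep_mirror ?uptc ?c0 //; case: ifP.
split; last exact: hrep.
have := hrep c cip => /existsP[i /andP[ih _]]; apply/imsetP; exists (i, false) => //.
move: ih; rewrite /h; case: ifP => _; rewrite inE => ih.
  by rewrite (porbit_cycle (allP csg _ cip) ih).
by rewrite (porbit_cycle (fcycle_mirror deltaK ssg (allP csg _ cip)) ih).
Qed.

End HalfProduct.

Local Open Scope ring_scope.

Lemma planar_scan_nonempty (X : eqType) (G : seq X -> seq (seq (seq X))) s g w p :
    (forall g' p', p' \in G g' -> [::] \notin p') -> s != [::] ->
  p \in planar_scan G s g w -> [::] \notin p.
Proof.
move=> G0; elim: w s g p => [|x w IH] s g p s0 /=.
  by move=> /mapP[p' /G0 P ->]; rewrite inE negb_or P eq_sym s0.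
rewrite mem_cat => /orP[/IH->//|/allpairsP[[p1 p2] /= [/G0 P1 P2 ->]]].
by rewrite mem_cat negb_or P1 (IH _ _ _ _ P2) //; case: (s).
Qed.

Lemma planar_nonempty (X : eqType) (w : seq X) p : p \in planar w -> [::] \notin p.
Proof.
rewrite /planar; move: (size w).+1 => k; elim: k w p => // k IH [|x w] p /=.
  by rewrite inE => /eqP->.
exact: planar_scan_nonempty.
Qed.

Lemma projective_nonempty (X : eqType) (dl : X -> X) (w : seq X) p :
  p \in projective dl w -> [::] \notin p.
Proof.
rewrite /projective; move: (size w).+1 => k; elim: k w p => // k IH [|x w] p //=.
suff H s g p' : s != [::] ->
    p' \in projective_scan dl (projective_fuel dl k) s g w -> [::] \notin p' by exact: H.
elim: w s g p' => [|y w IHw] s g p' s0 /=.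
  by move=> /mapP[p1 /IH P ->]; rewrite inE negb_or P eq_sym s0.
have s1 z : rcons s z != [::] by case: (s).
rewrite !mem_cat => /or4P[/IHw->//|||].
- move=> /allpairsP[[p1 p2] /= [/planar_nonempty P1 P2 ->]].
  by rewrite mem_cat negb_or P1 (IHw _ _ _ _ P2).
- move=> /allpairsP[[p1 p2] /= [/IH P1 /(planar_scan_nonempty (@planar_nonempty _) (s1 _)) P2 ->]].
  by rewrite mem_cat negb_or P1 P2.
- exact: (planar_scan_nonempty (@planar_nonempty _) (s1 _)).
Qed.

(** This is the place where a block passes through the crosscap. It provides the step from positive
    to negative points in the proof of transitivity for [SNCd_symmetric]. *)
Lemma projective_rcons_dl (X : eqType) (dl : X -> X) (Q : pred X) w p :
    all Q w -> p \in projective dl w ->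
  exists c s x y t, [/\ c \in p, c = s ++ [:: x, dl y & t], Q x & Q y].
Proof.
rewrite /projective; move: (size w).+1 => k; elim: k w p => // k IH [|x w] p //= /andP[Qx].
suff H s g p' : s != [::] -> all Q g -> all Q s -> all Q w ->
    p' \in projective_scan dl (projective_fuel dl k) s g w ->
    exists c s x y t, [/\ c \in p', c = s ++ [:: x, dl y & t], Q x & Q y].
  by move=> Qw; apply: H => //=; rewrite Qx.
elim: w s g p' => [|y w IHw] s g p' s0 Qg Qs /=.
  move=> _ /mapP[p1 /(IH _ _ Qg)[c [s' [a [b [t [cp E Qa Qb]]]]]] ->].
  by exists c, s', a, b, t; rewrite inE cp orbT.
have s1 z : rcons s z != [::] by case: (s).
move=> /andP[Qy Qw]; rewrite !mem_cat => /or4P[|||].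
- by apply: IHw => //; rewrite all_rcons Qy.
- move=> /allpairsP[[p1 p2] /= [_ /IHw H ->]].
  have [||//|//|c [s' [a [b [t [cp E Qa Qb]]]]]] := H; rewrite ?all_rcons ?Qy //.
  by exists c, s', a, b, t; rewrite mem_cat cp orbT.
- move=> /allpairsP[[p1 p2] /= [/(IH _ _ Qg)[c [s' [a [b [t [cp E Qa Qb]]]]]] _ ->]].
  by exists c, s', a, b, t; rewrite mem_cat cp.
- move=> /planar_scan_prefix/hasP[c cp /prefixP[t E]].
  case/lastP: s s0 Qs {IHw s1} E => // s z _; rewrite all_rcons => /andP[Qz _] E.
  by exists c, s, z, y, t; split=> //; rewrite E -!cats1 -!catA.
Qed.

Section Exchange.
Variables (n : nat) (R : comNzRingType) (f : seq (pmT n) -> R).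
Local Notation X := (pmT n).
Local Notation dl := (delta n).

Hypothesis f_rot : forall i c, f (rot i c) = f c.

(** Double count of the pairs of a symmetric permutation and a configuration in [L] consisting of
    its cycles: every configuration belongs to exactly one permutation, and a permutation has one
    configuration or none. *)
Lemma wsum_exchange (L : seq (seq (seq X))) (P : pred {perm X}) :
    (forall p, p \in L -> covers dl p /\ [::] \notin p) ->
    (forall p c, p \in L -> c \in p -> ~~ pair_rep [set x in c] ->
       f (mirror dl c) = f c) ->
    (forall sg, symmetric dl sg -> count (all (fcycle sg)) L = P sg) ->
  wsum f L = \sum_(sg | symmetric dl sg && P sg) half_prod f sg.
Proof.
move=> Lp Lm LP.
transitivity (\sum_(sg | symmetric dl sg)
    \sum_(p <- L | all (fcycle sg) p) half_prod f sg); last first.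
  rewrite big_mkcondr /=; apply: eq_bigr => sg sy.
  rewrite big_const_seq LP //; case: (P sg) => //=.
  by rewrite addr0.
rewrite (exchange_big_dep xpredT) //= /wsum; apply: eq_big_seq => p pL.
have [cp p0] := Lp p pL.
have [sg sy csg] := realise (@deltaK n) (@deltaN n) cp.
rewrite (big_pred1 sg); last first.
  move=> sg'; apply/andP/eqP => [[sy' csg']|->//].
  exact: (realise_inj (@deltaK n) (@deltaN n) cp sy' sy csg' csg).
by rewrite (half_prodE f_rot cp p0 sy csg (Lm p ^~ pL)).
Qed.

Variables (u : seq X) (be : {perm X}).
Hypothesis fu : perm_eq (pts dl u) (enum {: X}).
Hypothesis u0 : u != [::].
Hypothesis bi : fpf_inv be.
Hypothesis pb : paired be (rot 1 (pts dl u)).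

Lemma planar_covers p : p \in planar u -> covers dl p /\ [::] \notin p.
Proof.
move=> pu; split; last exact: planar_nonempty pu.
by rewrite /covers (permPl (perm_pts dl (planar_perm pu))).
Qed.

Lemma projective_covers p : p \in projective dl u -> covers dl p /\ [::] \notin p.
Proof.
move=> pu; split; last exact: projective_nonempty pu.
by rewrite /covers (permPl (projective_perm (@deltaK n) pu)).
Qed.

Lemma wsum_planar :
    (forall p c, p \in planar u -> c \in p -> ~~ pair_rep [set x in c] ->
       f (mirror dl c) = f c) ->
  wsum f (planar u) =
  \sum_(sg | symmetric dl sg && (euler dl sg be == #|{: X}|.+2)) half_prod f sg.
Proof.
move=> fm; apply: (wsum_exchange _ fm) => [p|sg sy]; first exact: planar_covers.
by have [] := count_by_euler (@deltaK n) (@deltaN n) fu u0 sy bi pb.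
Qed.

Lemma wsum_projective :
    (forall c, f (mirror dl c) = f c) ->
  wsum f (projective dl u) =
  \sum_(sg | symmetric dl sg && (euler dl sg be == #|{: X}|)) half_prod f sg.
Proof.
move=> fm; apply: wsum_exchange => [p||sg sy] //; first exact: projective_covers.
by have [] := count_by_euler (@deltaK n) (@deltaN n) fu u0 sy bi pb.
Qed.

End Exchange.

(** * The word of all letters and the set S_NC^delta(n,-n) *)

Section Standard.
Variable n : nat.
Local Notation X := (pmT n).
Local Notation dl := (delta n).

Definition letters : seq X := [seq (i, false) | i <- enum 'I_n].

(* gamma delta gamma^{-1} in the right-to-left notation of [annulus] *)
Definition gaps : {perm X} := ((gamma n)^-1 * delta n * gamma n)%g.

Lemma gammaE (x : X) : gamma n x = if x.2 then x else (ordS x.1, false).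
Proof. by rewrite permE. Qed.

Lemma gaps_fpf : fpf_inv gaps.
Proof.
split=> x; rewrite !permM; first by rewrite permK (@deltaK n) permKV.
by rewrite -(inj_eq (@perm_inj _ (gamma n)^-1%g)) permK deltaN.
Qed.

Lemma gaps_delta (i : 'I_n) : gaps (i, true) = (ordS i, false).
Proof.
rewrite !permM; have -> : (gamma n)^-1%g (i, true) = (i, true).
  by apply: (@perm_inj _ (gamma n)); rewrite permKV gammaE.
by rewrite deltaE gammaE.
Qed.

Lemma letters_full : perm_eq (pts dl letters) (enum {: X}).
Proof.
apply: uniq_perm; rewrite ?enum_uniq //.
  rewrite /letters; elim: (enum 'I_n) (enum_uniq 'I_n) => //= i s IH /andP[ns /IH ->].
  rewrite deltaE /= !inE !(mem_pts (@deltaK n)) !deltaE /= andbT negb_or xpair_eqE andbF /=.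
  have nf b : (i, b) \in [seq (i0, false) | i0 <- s] = false.
    by apply/negbTE/mapP => -[j js [ji]]; rewrite ji js in ns.
  by rewrite !nf.
move=> [i b]; rewrite mem_enum (mem_pts (@deltaK n)) deltaE /=.
have memf j : (j, false) \in letters by apply: map_f; rewrite mem_enum.
by case: b; rewrite /= memf ?orbT.
Qed.

Lemma letters_nil : (0 < n)%N -> letters != [::].
Proof.
by move=> n0; rewrite -size_eq0 size_map size_enum_ord -lt0n.
Qed.

(** The points -i and i+1, cyclically, are neighbours on the circle where one letter ends and the
    next begins; [gaps] exchanges them. *)
Lemma letters_gaps : paired gaps (rot 1 (pts dl letters)).
Proof.
have E s (a b : 'I_n) : path (fun i j => ordS i == j) a (rcons s b) ->
   paired gaps ((a, true) :: rcons (pts dl [seq (i, false) | i <- s]) (b, false)).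
  elim: s a => [|c s IH] a.
    by move=> /= /andP[/eqP <- _]; rewrite gaps_delta eqxx.
  rewrite rcons_cons /= => /andP[/eqP ac /IH H].
  by rewrite gaps_delta ac eqxx deltaE.
case Eo: (enum 'I_n) => [|i s]; first by rewrite /letters Eo.
have -> : rot 1 (pts dl letters) = (i, true) :: rcons (pts dl [seq (j, false) | j <- s]) (i, false).
  by rewrite /letters Eo [pts _ _]/= rot1_cons deltaE.
apply: E.
have sz : size (i :: s) = n by rewrite -Eo size_enum_ord.
have vE k : (k < n)%N -> nat_of_ord (nth i (i :: s) k) = k by move=> kn; rewrite -Eo nth_enum_ord.
have szs : (size s).+1 = n := sz.
have i0 : i = 0%N :> nat by apply: (vE 0%N); rewrite -szs.
apply/(pathP i) => k; rewrite size_rcons => kn.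
have kn' : (k < n)%N by rewrite -szs.
apply/eqP/val_inj; rewrite -rcons_cons !nth_rcons /= kn.
have -> : nat_of_ord (nth i (i :: s) k) = k by exact: vE.
have [ks|ks|ks] := ltngtP k (size s).
- have ksn : (k.+1 < n)%N by rewrite -szs.
  by rewrite modn_small //; have /= -> := vE k.+1 ksn.
- by move: kn; rewrite ltnS leqNgt ks.
- by rewrite ks szs modnn i0.
Qed.

Lemma annulusE : annulus n = (dl * gaps)%g.
Proof. by rewrite /annulus /gaps !mulgA. Qed.

Lemma card_porbits_conj (T : finType) (s t : {perm T}) :
  #|porbits (t^-1 * s * t)%g| = #|porbits s|.
Proof.
have E x : porbit (t^-1 * s * t)%g (t x) = t @: porbit s x.
  have pw i : ((t^-1 * s * t) ^+ i)%g (t x) = t ((s ^+ i)%g x).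
    elim: i => [|i IH]; first by rewrite !expg0 !perm1.
    by rewrite !expgSr !permM IH permK.
  apply/setP => y; apply/porbitP/imsetP => [[i ->]|[z /porbitP[i ->] ->]].
    by exists ((s ^+ i)%g x); rewrite ?mem_porbit ?pw.
  by exists i; rewrite pw.
have -> : porbits (t^-1 * s * t)%g = (fun C : {set T} => t @: C) @: porbits s.
  apply/setP => C; apply/imsetP/imsetP => [[x _ ->]|[_ /imsetP[x _ ->] ->]].
    exists (porbit s (t^-1%g x)); first exact: imset_f.
    by rewrite -E permKV.
  by exists (t x); rewrite // E.
by rewrite card_imset //; apply: imset_inj; exact: perm_inj.
Qed.

(** As [dl * sg] is its own inverse, [gaps * (dl * sg)] and [annulus n * sg^-1] are conjugate by
    [dl]. *)
Lemma euler_annulus (sg : {perm X}) : symmetric dl sg ->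
  euler dl sg gaps = (#|porbits sg| + #|porbits (annulus n * sg^-1)%g|)%N.
Proof.
move=> /symmetricP[piK _]; rewrite /euler annulusE; congr addn.
have involV (T : finType) (s : {perm T}) : involutive s -> s^-1%g = s.
  by move=> sK; apply/permP => x; apply: (@perm_inj _ s); rewrite permKV sK.
rewrite -(card_porbits_conj (gaps * (dl * sg)) dl); congr #|pred_of_set (porbits _)|.
have E := involV _ (dl * sg)%g piK; rewrite invMg in E.
by rewrite (involV _ dl (@deltaK n)) -!mulgA (mulgA dl sg) -E mulgKV.
Qed.

Lemma ordS_all (P : pred 'I_n) j : P j -> (forall i, P i -> P (ordS i)) -> forall i, P i.
Proof.
move=> Pj PS i; have Pk k : P (iter k (@ordS n) j) by elim: k => //= k; exact: PS.
have vk k : nat_of_ord (iter k (@ordS n) j) = ((j + k) %% n)%N.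
  elim: k => [|k IH]; first by rewrite addn0 modn_small.
  by rewrite /= IH addnS -addn1 modnDml addn1.
have -> : i = iter (n - j + i) (@ordS n) j; last exact: Pk.
apply: val_inj; rewrite /= vk addnA subnKC ?(ltnW (ltn_ord j)) //.
by rewrite modnDl modn_small.
Qed.

Lemma annulus_pos i : annulus n (i, false) = (ordS i, false).
Proof. by rewrite annulusE permM deltaE gaps_delta. Qed.

Lemma annulusV_neg i : (annulus n)^-1%g (i, true) = (ordS i, true).
Proof.
apply: (@perm_inj _ (annulus n)); rewrite permKV annulusE permM deltaE /=.
by apply: (can_inj (proj1 gaps_fpf)); rewrite (proj1 gaps_fpf) gaps_delta.
Qed.

(** Transitivity has to be derived from the cycle count. The count yields a projective
    configuration, whose passage through the crosscap sends a positive point to a negative one; the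
    annular permutation connects the points of each sign. *)
Lemma SNCd_symmetric (sg : {perm X}) : (0 < n)%N ->
  (sg \in SNCd n) = symmetric dl sg && (euler dl sg gaps == #|{: X}|).
Proof.
move=> n0; rewrite inE -/(symmetric dl sg).
have [sy|nsy] := boolP (symmetric dl sg); last by rewrite !andbF.
have cX : #|{: X}| = (2 * n)%N by rewrite card_prod card_ord card_bool mulnC.
rewrite andbT /= -[X in _ && (X == _)](euler_annulus sy) cX.
have [eu|] := eqVneq (euler dl sg gaps) (2 * n)%N; last by rewrite andbF.
rewrite andbT; apply/imsetP.
have [_ c1] := count_by_euler (@deltaK n) (@deltaN n) letters_full (letters_nil n0) sy gaps_fpf letters_gaps.
rewrite eu cX eqxx in c1.
have /hasP[p pl csg] : has (all (fcycle sg)) (projective dl letters) by rewrite has_count c1.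
have [|c [s [x [y [t [cp Ec Qx Qy]]]]]] := @projective_rcons_dl _ dl (fun x => ~~ x.2) letters p _ pl.
  by apply/allP => x /mapP[i _ ->].
have sxy : sg x = dl y.
  have := allP csg _ cp; rewrite Ec -(rot_cycle (size s)) rot_size_cat /= => /andP[/eqP].
  by [].
pose a0 : X := (Ordinal n0, false); exists a0 => //.
pose G := (<<[set sg; annulus n]>>)%G; rewrite -[(<<_>>)%g]/(gval G).
have G1 : sg \in G by apply: mem_gen; rewrite !inE eqxx.
have G2 : annulus n \in G by apply: mem_gen; rewrite !inE eqxx orbT.
have cl (g : {perm X}) z : g \in G -> z \in orbit 'P G a0 -> g z \in orbit 'P G a0.
  by move=> gG zO; have := mem_orbit 'P z gG; rewrite /= apermE => /orbit_trans; apply.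
have pos i : (i, false) \in orbit 'P G a0.
  apply: (@ordS_all (fun i => (i, false) \in orbit 'P G a0) (Ordinal n0)).
    exact: orbit_refl.
  by move=> j jO; rewrite -annulus_pos; exact: cl.
have neg i : (i, true) \in orbit 'P G a0.
  apply: (@ordS_all (fun i => (i, true) \in orbit 'P G a0) y.1).
    have <- : sg x = (y.1, true) by rewrite sxy deltaE (negPf Qy).
    by apply: cl => //; rewrite [x]surjective_pairing (negPf Qx).
  by move=> j jO; rewrite -annulusV_neg; apply: cl => //; rewrite groupV.
by apply/setP => -[i []]; rewrite ?pos ?neg inE.
Qed.

End Standard.

Lemma planar_scan_subseq (X : eqType) (G : seq X -> seq (seq (seq X))) s g w p c :
    (forall g' p' c', p' \in G g' -> c' \in p' -> subseq c' g') ->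
  p \in planar_scan G s g w -> c \in p -> subseq c (s ++ g ++ w).
Proof.
move=> SG; elim: w s g p => [|x w IH] s g p /=.
  move=> /mapP[p' pG ->]; rewrite inE cats0 => /orP[/eqP->|cp]; first exact: prefix_subseq.
  exact: subseq_trans (SG _ _ _ pG cp) (suffix_subseq _ _).
rewrite mem_cat => /orP[/IH H /H|/allpairsP[[p1 p2] /= [pG pS ->]]].
  by rewrite cat_rcons.
rewrite mem_cat => /orP[cp|/(IH _ _ _ pS)].
  apply: subseq_trans (SG _ _ _ pG cp) _.
  by apply: subseq_trans (suffix_subseq s _); exact: prefix_subseq.
rewrite cat_rcons => H; apply: subseq_trans H _.
by apply: cat_subseq => //; exact: suffix_subseq.
Qed.

Lemma planar_subseq (X : eqType) (w : seq X) p c :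
  p \in planar w -> c \in p -> subseq c w.
Proof.
rewrite /planar; move: (size w).+1 => k; elim: k w p c => // k IH [|x w] p c /=.
  by rewrite inE => /eqP->.
exact: planar_scan_subseq.
Qed.

(** * Sums over noncrossing partitions *)

Section Noncrossing.
Variable n : nat.
Local Notation X := 'I_n.
Variable P : {set {set X}}.
Hypothesis partP : partition P [set: X].
Implicit Types (s g w : seq X).

Let bl := pblock P.
Let ok (c : seq X) := [set x in c] \in P.
Let lt (x y : X) := (x < y)%N.

Let trivP : trivIset P. Proof. by case/and3P: partP. Qed.
Let inP x : bl x \in P.
Proof. by rewrite pblock_mem // (cover_partition partP). Qed.
Let mem_bl x : x \in bl x. Proof. by rewrite mem_pblock (cover_partition partP). Qed.
Let blE V x : V \in P -> x \in V -> bl x = V. Proof. exact: def_pblock. Qed.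
Let bl_mem x y : (x \in bl y) = (bl x == bl y).
Proof. by apply/idP/eqP => [/(blE (inP y))|<-]. Qed.

(** What noncrossing means for a part of the word. It has to be a union of blocks of [P], since
    otherwise no configuration on it consists of such blocks. *)
Definition good w :=
  [forall x in w, forall y, (bl x == bl y) ==> (y \in w)] &&
  [forall a in w, forall b in w, forall c in w, forall d in w,
    [&& (a < b)%N, (b < c)%N, (c < d)%N, bl a == bl c & bl b == bl d] ==> (bl a == bl b)].

Lemma goodP w : reflect
  ((forall x y, x \in w -> bl x = bl y -> y \in w) /\
   (forall a b c d, a \in w -> b \in w -> c \in w -> d \in w ->
     (a < b)%N -> (b < c)%N -> (c < d)%N -> bl a = bl c -> bl b = bl d -> bl a = bl b))
  (good w).
Proof.
apply: (iffP andP) => -[st nc]; split.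
- move=> x y xw /eqP bxy.
  by move: st => /forall_inP/(_ x xw)/forallP/(_ y)/implyP; apply.
- move=> a b c d aw bw cw dw ab bc cd /eqP bac /eqP bbd; apply/eqP.
  move: nc => /forall_inP/(_ a aw)/forall_inP/(_ b bw)/forall_inP/(_ c cw)/forall_inP/(_ d dw).
  by rewrite ab bc cd bac bbd.
- by apply/forall_inP => x xw; apply/forallP => y; apply/implyP => /eqP; exact: st.
- apply/forall_inP => a aw; apply/forall_inP => b bw.
  apply/forall_inP => c cw; apply/forall_inP => d dw.
  apply/implyP => /and5P[ab bc cd /eqP bac /eqP bbd]; apply/eqP.
  exact: nc bac bbd.
Qed.

Let cnt := count (all ok).
Let cT w := cnt (planar w).
Let cTs s g w := cnt (planar_scan (@planar X) s g w).

Let ok_bl c x y : ok c -> x \in c -> (bl x == bl y) = (y \in c).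
Proof.
move=> okc xc; have -> : bl x = [set x in c] by apply: blE => //; rewrite inE.
by apply/eqP/idP => [E|yc]; [have := mem_bl y; rewrite -E inE|symmetry; apply: blE; rewrite ?inE].
Qed.

Lemma ncT0 g h y : y \in g -> bl h = bl y -> h \notin g -> cT g = 0%N.
Proof.
move=> yg hy hg; apply/eqP; rewrite /cT /cnt -leqn0 leqNgt -has_count; apply/hasPn => p pg.
apply: contra hg => okp; move: yg; rewrite -!(perm_mem (planar_perm pg)).
move=> /flattenP[c cp yc]; apply/flattenP; exists c => //.
by rewrite -(ok_bl _ (allP okp _ cp) yc) hy.
Qed.

Lemma ncTs0 h s x w : bl x != bl h -> cTs (rcons (h :: s) x) [::] w = 0%N.
Proof.
move=> nx; apply/eqP; rewrite /cTs /cnt -leqn0 leqNgt -has_count; apply/hasPn => p.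
move=> /planar_scan_prefix/hasP[c cp /prefixP[c' E]]; apply/negP => /allP/(_ c cp) okc.
move: nx; rewrite eq_sym (ok_bl _ okc); rewrite E mem_cat.
  by rewrite mem_rcons !inE eqxx.
by rewrite mem_rcons !inE eqxx orbT.
Qed.

Lemma nc_none h s g w : {in w, forall x, bl x != bl h} ->
  cTs (h :: s) g w = (ok (h :: s) * cT (g ++ w))%N.
Proof.
elim: w g => [|x w IH] g nw; first by rewrite cats0 /cTs /= /cnt count_cons_map.
rewrite -cat_rcons -IH => [|z zw]; last by apply: nw; rewrite inE zw orbT.
rewrite /cTs /= /cnt count_cat count_allcat -/cnt.
rewrite -[cnt (planar_scan _ (_ :: rcons _ _) _ _)]/(cTs (rcons (h :: s) x) [::] w).
by rewrite ncTs0 ?muln0 ?addn0 //; apply: nw; rewrite inE eqxx.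
Qed.

Lemma nc_skip h s g w y : y \in g -> bl y = bl h -> h \notin g ++ w -> cTs (h :: s) g w = 0%N.
Proof.
move=> + byh; elim: w g => [|x w IH] g yg hg.
  rewrite /cTs /= /cnt count_cons_map -/cnt -/(cT g) (ncT0 yg (esym byh)) ?muln0 //.
  by rewrite cats0 in hg.
rewrite /cTs /= /cnt count_cat count_allcat -/cnt -/(cT g) (ncT0 yg (esym byh)).
  rewrite mul0n addn0; apply: IH; first by rewrite mem_rcons inE yg orbT.
  by rewrite cat_rcons.
by apply: contra hg; rewrite mem_cat => ->.
Qed.

Lemma nc_join h s g w1 y w2 : {in w1, forall x, bl x != bl h} -> bl y = bl h ->
    h \notin g ++ w1 ++ y :: w2 ->
  cTs (h :: s) g (w1 ++ y :: w2) = (cT (g ++ w1) * cTs (rcons (h :: s) y) [::] w2)%N.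
Proof.
move=> + byh; elim: w1 g => [|x w1 IH] g nw hg.
  rewrite /cTs /= /cnt count_cat count_allcat -/cnt cats0.
  rewrite -[cnt (planar_scan _ (h :: s) _ _)]/(cTs (h :: s) (rcons g y) w2).
  rewrite (@nc_skip h s (rcons g y) w2 y) ?mem_rcons ?inE ?eqxx //.
  by rewrite cat_rcons.
have := IH (rcons g x); rewrite !cat_rcons => <- //; last first.
  by move=> z zw; apply: nw; rewrite inE zw orbT.
rewrite /cTs /= /cnt count_cat count_allcat -/cnt.
rewrite -[cnt (planar_scan _ (_ :: rcons s x) _ _)]/(cTs (rcons (h :: s) x) [::] _).
by rewrite ncTs0 ?muln0 ?addn0 //; apply: nw; rewrite inE eqxx.
Qed.

(** The scan has no choice: the block of [h] must continue with the first later letter [y] from the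
    same block of [P], and the letters [w1] in between form a word of their own. That no block of
    [P] leaves [w1] follows from the absence of crossings with this block. *)
Lemma count_good h s w : pairwise lt (h :: s ++ w) -> {in s, forall x, bl x = bl h} ->
  cTs (h :: s) [::] w = good (h :: s ++ w).
Proof.
have [m le_m] := ubnP (size w); elim: m => // m IH in h s w le_m *.
move=> srt lab.
have lab' x : x \in h :: s -> bl x = bl h by rewrite inE => /orP[/eqP->|/lab].
have good0 w' : (size w' <= size w)%N -> pairwise lt w' -> cT w' = good w'.
  case: w' => [|x w'] le_w' srt'.
    by rewrite /cT /cnt /=; apply/esym/eqP; rewrite eqb1; apply/goodP.
  by rewrite /cT planar_cons; apply: IH => //; exact: leq_trans le_w' _.
rewrite -cat_cons in srt *; move: srt; rewrite pairwise_cat => /and3P[/allrelP sw ss srtw].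
have hsw (x y : X) : x \in h :: s -> y \in w -> (x < y)%N by move=> xs yw; exact: sw.
have [/hasP[y0 y0w /eqP by0]|nh] := boolP (has (fun x => bl x == bl h) w); last first.
  have nw : {in w, forall x, bl x != bl h}.
    by move=> x xw; apply: contra nh => e; apply/hasP; exists x.
  rewrite nc_none // good0 // mulnb; congr nat_of_bool.
  apply/andP/goodP => [[okh /goodP[st nc]]|[st nc]].
    split=> [x y|a b c d].
      rewrite !mem_cat => /orP[xh|xw] bxy; last by rewrite (st x y xw bxy) orbT.
      by rewrite -(ok_bl y okh xh) bxy eqxx.
    rewrite !mem_cat => /orP[ah|aw] /orP[bh|bw] /orP[ch|cw] /orP[dh|dw] ab bc cd bac bbd;
      rewrite ?(lab' _ ah) ?(lab' _ bh) //.
    - by have := hsw _ _ ch bw; rewrite ltnNge (ltnW bc).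
    - by have := hsw _ _ ch bw; rewrite ltnNge (ltnW bc).
    - by have := nw c cw; rewrite -bac (lab' _ ah) eqxx.
    - by have := nw c cw; rewrite -bac (lab' _ ah) eqxx.
    - by rewrite bac (lab' _ ch).
    - by rewrite bac (lab' _ ch).
    - by have := hsw _ _ dh cw; rewrite ltnNge (ltnW cd).
    - by have := nw d dw; rewrite -bbd (lab' _ bh) eqxx.
    - by have := nw a aw; rewrite bac (lab' _ ch) eqxx.
    - by have := nw a aw; rewrite bac (lab' _ ch) eqxx.
    - by have := nw b bw; rewrite bbd (lab' _ dh) eqxx.
    - exact: nc bac bbd.
  have st' y : bl h = bl y -> y \in h :: s.
    move=> e; have := st h y; rewrite !mem_cat mem_head => /(_ isT e) /orP[//|yw].
    by have := nw y yw; rewrite -e eqxx.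
  split.
    rewrite /ok (_ : [set x in h :: s] = bl h) //; apply/setP => y.
    by rewrite inE bl_mem; apply/idP/eqP => [/lab'|/esym/st'].
  apply/goodP; split=> [x y xw bxy|a b c d aw bw cw dw].
    have := st x y; rewrite !mem_cat xw orbT => /(_ isT bxy) /orP[/lab' e|//].
    by have := nw x xw; rewrite bxy e eqxx.
  have sub z : z \in w -> z \in (h :: s) ++ w by rewrite mem_cat => ->; rewrite orbT.
  exact: (nc a b c d (sub _ aw) (sub _ bw) (sub _ cw) (sub _ dw)).
have [w1 [y [w2 [Ew nw1 byh]]]] : exists w1 y w2,
    [/\ w = w1 ++ y :: w2, {in w1, forall x, bl x != bl h} & bl y = bl h].
  pose q x := bl x == bl h; have hq : has q w by apply/hasP; exists y0 => //; rewrite /q by0.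
  exists (take (find q w) w), (nth h w (find q w)), (drop (find q w).+1 w); split.
  - by rewrite -drop_nth -?has_find // cat_take_drop.
  - move=> x xw; have [i + <-] := elimT (nthP h) xw; rewrite size_take -has_find hq => iq.
    by rewrite nth_take //; have := before_find h iq; rewrite /q => ->.
  - exact/eqP/(nth_find h hq).
rewrite Ew in le_m good0 srtw hsw sw *.
have hw : h \notin w1 ++ y :: w2.
  by apply/negP => hw; have := hsw h h (mem_head _ _) hw; rewrite ltnn.
rewrite nc_join //.
have srtw' := srtw; rewrite pairwise_cat /= in srtw'.
case/and4P: srtw' => /allrelP w1w srt1 /allP yw2 srt2.
have lt_sw1 (x z : X) : x \in h :: s -> z \in w1 -> (x < z)%N.
  by move=> xs zw; apply: hsw => //; rewrite mem_cat zw.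
have lt_w1 (x z : X) : x \in w1 -> z \in y :: w2 -> (x < z)%N.
  by move=> xs zw; exact: w1w.
rewrite cat0s good0 //; last by rewrite size_cat leq_addr.
rewrite rcons_cons -/(cTs _ _ _) IH; last first.
- by move=> x; rewrite mem_rcons inE => /orP[/eqP->|/lab].
- rewrite cat_rcons -cat_cons pairwise_cat ss.
  rewrite pairwise_cat in srtw; case/and3P: srtw => _ _ -> /=; rewrite andbT.
  apply/allrelP => x z xs zw; apply: hsw => //.
  by rewrite mem_cat zw orbT.
- by move: le_m; rewrite size_cat /=; clear; lia.
rewrite cat_rcons -[h :: s ++ _]cat_cons mulnb; congr nat_of_bool.
set s' := h :: s in lab' hsw lt_sw1 *.
have in2 z : (z \in s' ++ w1 ++ y :: w2) = (z \in w1) || (z \in s' ++ y :: w2).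
  by rewrite !mem_cat orbCA.
(* [w1] is an interval of the word: no outside letter lies between two of its letters. So the four
   letters of a potential crossing are all inside or all outside. *)
have btw (a z c : X) : a \in w1 -> c \in w1 -> (a < z)%N -> (z < c)%N ->
    z \in s' ++ y :: w2 -> False.
  move=> aw cw az zc; rewrite mem_cat => /orP[zs|zw].
    by have := lt_sw1 _ _ zs aw; rewrite ltnNge (ltnW az).
  by have := lt_w1 _ _ cw zw; rewrite ltnNge (ltnW zc).
apply/andP/goodP => [[/goodP[st1 nc1] /goodP[st2 nc2]]|[st nc]].
  split=> [x z|a b c d].
    rewrite !in2 => /orP[xw|xw] bxz; first by rewrite (st1 _ _ xw bxz).
    by rewrite (st2 _ _ xw bxz) orbT.
  move=> aw bw cw dw ab bc cd bac bbd; move: aw bw cw dw; rewrite !in2.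
  move=> /orP[a1|a2] /orP[b1|b2] cw dw.
  - by apply: (nc1 a b c d) => //; [exact: st1 bac|exact: st1 bbd].
  - by case: (btw a b c) => //; exact: st1 bac.
  - by case: (btw b c d) => //; [exact: st1 bbd|exact: st2 bac].
  - by apply: (nc2 a b c d) => //; [exact: st2 bac|exact: st2 bbd].
have ly : last h s \in s' by exact: mem_last.
have lyE : bl (last h s) = bl h by exact: lab'.
have w1st x z : x \in w1 -> bl x = bl z -> z \in w1.
  move=> xw bxz; have := st x z; rewrite !in2 xw => /(_ isT bxz) /orP[//|].
  have nx := nw1 x xw; rewrite mem_cat inE => /or3P[/lab' e|/eqP e|zw2].
  - by rewrite bxz e eqxx in nx.
  - by rewrite bxz e byh eqxx in nx.
  - have {}zw2 : z \in w2 by exact: zw2.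
    (* A block containing [x] in [w1] and [z] in [w2] would cross the block of [h], because
       [last h s] < [x] < [y] < [z]. *)
    case/negP: nx; apply/eqP; rewrite -lyE; symmetry.
    apply: (nc (last h s) x y z) => //.
    + by rewrite mem_cat ly.
    + by rewrite in2 xw.
    + by rewrite in2 mem_cat mem_head !orbT.
    + have zw : z \in y :: w2 by rewrite inE zw2 orbT.
      by rewrite in2 mem_cat zw !orbT.
    + exact: lt_sw1.
    + by apply: lt_w1; rewrite ?mem_head.
    + exact: yw2.
    + by rewrite lyE byh.
split; apply/goodP; split.
- exact: w1st.
- have sub z : z \in w1 -> z \in s' ++ w1 ++ y :: w2 by rewrite in2 => ->.
  by move=> a b c d aw bw cw dw; exact: (nc a b c d (sub _ aw) (sub _ bw) (sub _ cw) (sub _ dw)).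
- move=> x z xw bxz; have := st x z; rewrite !in2 xw orbT => /(_ isT bxz) /orP[zw1|//].
  exfalso; have xw1 := w1st _ _ zw1 (esym bxz).
  move: xw; rewrite mem_cat => /orP[xs|xw2].
    by have := lt_sw1 _ _ xs xw1; rewrite ltnn.
  by have := lt_w1 _ _ xw1 xw2; rewrite ltnn.
- have sub z : z \in s' ++ y :: w2 -> z \in s' ++ w1 ++ y :: w2 by rewrite in2 => ->; rewrite orbT.
  by move=> a b c d aw bw cw dw; exact: (nc a b c d (sub _ aw) (sub _ bw) (sub _ cw) (sub _ dw)).
Qed.

Lemma good_noncrossing : good (enum X) = noncrossing P.
Proof.
apply/goodP/idP => [[_ nc]|nc].
  apply/forall_inP => V VP; apply/forall_inP => W WP; apply/implyP => VW.
  apply/negP => /existsP[a /existsP[b /existsP[c /existsP[d]]]].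
  move=> /and5P[ab bc cd aV] /and3P[cV bW dW]; case/negP: VW; apply/eqP.
  rewrite -(blE VP aV) -(blE WP bW); apply: (nc a b c d); rewrite ?mem_enum //.
    by rewrite (blE VP aV) (blE VP cV).
  by rewrite (blE WP bW) (blE WP dW).
split=> [x y _ _|a b c d _ _ _ _ ab bc cd bac bbd]; first by rewrite mem_enum.
apply/eqP; apply: contraTT nc => ne; apply/forall_inPn; exists (bl a); first exact: inP.
apply/forall_inPn; exists (bl b); first exact: inP.
rewrite negb_imply ne negbK /=.
apply/existsP; exists a; apply/existsP; exists b; apply/existsP; exists c.
by apply/existsP; exists d; rewrite ab bc cd !mem_bl bac bbd !mem_bl.
Qed.

Lemma pairwise_enum : pairwise lt (enum X).
Proof.
have tr : transitive lt by move=> y x z; exact: ltn_trans.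
rewrite -(sorted_pairwise tr).
by have := iota_ltn_sorted 0 n; rewrite -val_enum_ord sorted_map.
Qed.

Lemma count_noncrossing : count (all ok) (planar (enum X)) = noncrossing P.
Proof.
rewrite -good_noncrossing; have := pairwise_enum.
case: (enum X) => [|x w] srt.
  by apply/esym/eqP; rewrite eqb1; apply/goodP.
by rewrite planar_cons; apply: count_good.
Qed.

End Noncrossing.

Section SumNC.
Variables (n : nat) (R : comNzRingType) (f : seq 'I_n -> R).
Local Notation X := 'I_n.

Definition blocks (p : seq (seq X)) : {set {set X}} := [set:: [seq [set x in c] | c <- p]].

Section OneConfiguration.
Variable p : seq (seq X).
Hypothesis pP : p \in planar (enum X).

Let fp : perm_eq (flatten p) (enum X). Proof. exact: planar_perm. Qed.
Let up : uniq (flatten p). Proof. by rewrite (perm_uniq fp) enum_uniq. Qed.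
Let p0 : [::] \notin p. Proof. exact: planar_nonempty pP. Qed.

Let blocksP V : reflect (exists2 c, c \in p & V = [set x in c]) (V \in blocks p).
Proof.
by rewrite inE; apply: (iffP mapP) => -[c cp ->]; exists c.
Qed.

Lemma partition_blocks : partition (blocks p) [set: X].
Proof.
apply/and3P; split.
- rewrite eqEsubset subsetT; apply/subsetP => x _; apply/bigcupP.
  have: x \in flatten p by rewrite (perm_mem fp) mem_enum.
  move=> /flattenP[c cp xc]; exists [set y in c]; last by rewrite inE.
  by apply/blocksP; exists c.
- apply/trivIsetP => _ _ /blocksP[c cp ->] /blocksP[c' cp' ->].
  apply: contraR => /pred0Pn[x /andP[]] /=; rewrite !inE => xc xc'.
  by rewrite -(cycle_atE up cp xc) (cycle_atE up cp' xc').
- apply/blocksP => -[[|x c] cp /setP E]; first by case/negP: p0.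
  by have := E x; rewrite !inE eqxx.
Qed.

Lemma blocks_unique (P : {set {set X}}) : partition P [set: X] ->
  all (fun c => [set x in c] \in P) p -> P = blocks p.
Proof.
move=> partP /allP okp; apply/setP => V; apply/idP/blocksP => [VP|[c cp ->]]; last exact: okp.
have /set0Pn[x xV] : V != set0 by apply: contraTneq VP => ->; case/and3P: partP.
have: x \in flatten p by rewrite (perm_mem fp) mem_enum.
move=> /flattenP[c cp xc]; exists c => //.
have triv : trivIset P by case/and3P: partP.
rewrite -(def_pblock triv VP xV); apply: def_pblock triv _ _; first exact: okp.
by rewrite inE.
Qed.

(** A block of a planar configuration is a subsequence of the increasing word, hence determined by
    its set of letters. So [restr] lists arguments in the order in which the scan reads them. *)
Lemma enum_block c : c \in p -> enum [set x in c] = c.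
Proof.
move=> cp; have sc := planar_subseq pP cp.
have tr : transitive (fun x y : X => (x < y)%N) by move=> y x z; exact: ltn_trans.
apply: (irr_sorted_eq tr).
- by move=> x; exact: ltnn.
- rewrite /enum_mem; apply: (subseq_sorted tr (filter_subseq _ _)).
  by rewrite -enumT (sorted_pairwise tr) pairwise_enum.
- by apply: (subseq_sorted tr sc); rewrite (sorted_pairwise tr) pairwise_enum.
- by move=> x; rewrite mem_enum inE.
Qed.

Lemma prod_blocks : \prod_(V in blocks p) f (enum V) = \prod_(c <- p) f c.
Proof.
rewrite (eq_bigl (mem [seq [set x in c] | c <- p])); last by move=> V; rewrite inE.
rewrite -big_uniq /=.
  by rewrite big_map; apply: eq_big_seq => c /enum_block ->.
rewrite map_inj_in_uniq.
  have := p0; have := up; elim: (p) => //= c p' IH.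
  rewrite cat_uniq [_ \in c :: _]inE negb_or => /and3P[_ nh up'] /andP[nc p0'].
  rewrite IH // andbT; apply: contra nh => cp'; apply/hasP.
  case: c nc cp' => // x c _ cp'; exists x; rewrite ?inE ?eqxx //.
  by apply/flattenP; exists (x :: c); rewrite ?inE ?eqxx.
by move=> c c' /enum_block E /enum_block E' ec; rewrite -E ec E'.
Qed.

End OneConfiguration.

(** The double count of [wsum_exchange], with set partitions instead of permutations. *)
Lemma sum_NC :
  \sum_(P in NC n) \prod_(V in P) f (enum V) = wsum f (planar (enum X)).
Proof.
transitivity (\sum_(P : {set {set X}} | partition P [set: X])
  \sum_(p <- planar (enum X) | all (fun c => [set x in c] \in P) p)
    \prod_(V in P) f (enum V)).
  rewrite (eq_bigl (fun P => partition P [set: X] && noncrossing P)); last by move=> P; rewrite inE.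
  rewrite big_mkcondr /=; apply: eq_bigr => P partP.
  rewrite big_const_seq count_noncrossing //; case: noncrossing => //=.
  by rewrite addr0.
rewrite (exchange_big_dep xpredT) //= /wsum; apply: eq_big_seq => p pP.
rewrite (big_pred1 (blocks p)) ?prod_blocks // => P.
apply/andP/eqP => [[partP okp]|->]; first exact: blocks_unique.
split; first exact: partition_blocks.
by apply/allP => c cp; rewrite inE; apply: map_f.
Qed.

End SumNC.

(** * Substitution of letters, and separation of the one-block term *)

Lemma eq_pscan_lt (R : comNzRingType) (X : Type) (f f' h h' : seq X -> R) s g w :
    f =1 f' -> (forall g', (size g' <= size g + size w)%N -> h g' = h' g') ->
  pscan f h s g w = pscan f' h' s g w.
Proof.
move=> ef; elim: w s g => [|x w IH] s g eh /=; first by rewrite ef eh ?leq_addr.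
rewrite eh ?leq_addr // IH => [|g' le_g']; last first.
  by apply: eh; rewrite (leq_trans le_g') // size_rcons addSnnS.
by rewrite IH // => g' /= le_g'; apply: eh; move: le_g'; rewrite /=; lia.
Qed.

Section Naturality.
Variables (R : comNzRingType) (X Y : Type) (v : X -> Y) (dl : X -> X) (t : Y -> Y).
Hypothesis vdl : forall x, v (dl x) = t (v x).
Variable f : seq Y -> R.

Lemma pscan_map (h : seq Y -> R) s g w :
  pscan f h (map v s) (map v g) (map v w) = pscan (f \o map v) (h \o map v) s g w.
Proof.
elim: w s g => [|x w IH] s g //=.
by rewrite -IH map_rcons -(IH _ [::]) map_rcons.
Qed.

(** Configurations are natural in the letters; thus sums on words in an algebra, with possible
    repetitions, reduce to words of distinct points. *)
Lemma wsum_planar_map u : wsum f (planar (map v u)) = wsum (f \o map v) (planar u).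
Proof.
have [m] := ubnP (size u); elim: m u => // m IH [|x u] lt_m.
  by rewrite /wsum !big_seq1 !big_nil.
rewrite /= !planar_cons !wsum_planar_scan (pscan_map _ [:: x] [::]).
apply: eq_pscan_lt => // g le_g; rewrite /= IH //.
by move: lt_m le_g; rewrite /=; lia.
Qed.

Lemma mscan_map (h h' : seq Y -> R) s g w :
  mscan t f h h' (map v s) (map v g) (map v w) =
  mscan dl (f \o map v) (h \o map v) (h' \o map v) s g w.
Proof.
have E g' : map v (map dl g') = map t (map v g').
  by rewrite -!map_comp; apply: eq_map => x /=; rewrite vdl.
elim: w s g => [|x w IH] s g //=.
rewrite -IH map_rcons -(IH _ [::]) map_rcons -!pscan_map !map_rcons vdl.
by rewrite map_cat map_rev E.
Qed.

Lemma eq_mscan (h h1 h' h1' : seq X -> R) (f1 : seq X -> R) s g w : h =1 h1 ->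
  (forall g', (size g' <= size g + size w)%N -> h' g' = h1' g') ->
  mscan dl f1 h h' s g w = mscan dl f1 h1 h1' s g w.
Proof.
move=> eh; elim: w s g => [|x w IH] s g eh' /=; first by rewrite eh' ?leq_addr.
rewrite eh eh' ?leq_addr // IH => [|g' le_g']; last first.
  by apply: eh'; rewrite (leq_trans le_g') // size_rcons addSnnS.
rewrite IH => [|g' /= le_g']; last by apply: eh'; move: le_g'; rewrite /=; lia.
by congr (_ + (_ + (_ * _ + _))); apply: eq_pscan.
Qed.

Lemma wsum_projective_map u :
  wsum f (projective t (map v u)) = wsum (f \o map v) (projective dl u).
Proof.
have [m] := ubnP (size u); elim: m u => // m IH [|x u] lt_m.
  by rewrite /wsum !big_nil.
rewrite /= !projective_cons !wsum_projective_scan (mscan_map _ _ [:: x] [::]).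
apply: eq_mscan => [g|g le_g] /=; first exact: wsum_planar_map.
by apply: IH; move: lt_m le_g; rewrite /=; lia.
Qed.

End Naturality.

Section Top.
Variables (R : comNzRingType) (X : Type) (f f' : seq X -> R) (N : nat).
Hypothesis eqf : forall c, (size c < N)%N -> f c = f' c.

Lemma pscan_lt (h h' : seq X -> R) s g w :
    (forall g, (size g < N)%N -> h g = h' g) ->
    (0 < size s)%N -> (size s + size g + size w < N)%N ->
  pscan f h s g w = pscan f' h' s g w.
Proof.
move=> eqh; elim: w s g => [|x w IH] s g /= s0 lt_N.
  rewrite eqf; last by move: lt_N; lia.
  by rewrite eqh //; move: lt_N s0; lia.
rewrite IH ?size_rcons //; last by move: lt_N; lia.
rewrite (IH (rcons s x)) ?size_rcons //=; last by move: lt_N; lia.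
by rewrite eqh //; move: lt_N; lia.
Qed.

(** A block of full length arises only if no letter is ever skipped. So two weights that agree on
    shorter blocks give sums that differ in this single term. *)
Lemma pscan_top (h h' : seq X -> R) s g w :
    (forall g, (size g < N)%N -> h g = h' g) -> h [::] = 1 ->
    (0 < size s)%N -> (size s + size g + size w = N)%N ->
  pscan f h s g w = pscan f' h' s g w + (if nilp g then f (s ++ w) - f' (s ++ w) else 0).
Proof.
move=> eqh h1; elim: w s g => [|x w IH] s g /= s0 eN.
  case: g eN => [|y g] eN /=; first by rewrite -eqh ?h1 ?cats0 //; [ring | move: eN s0; lia].
  rewrite addr0 eqf; last by move: eN => /=; lia.
  by rewrite eqh //; move: eN s0 => /=; lia.
have hg : h g = h' g by apply: eqh; move: eN s0; lia.
rewrite IH ?size_rcons //; last by move: eN; lia.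
have -> : nilp (rcons g x) = false by case: (g).
rewrite addr0; case: g eN hg => [|y g] eN hg /=.
  rewrite -hg h1 IH ?size_rcons //=; last by move: eN => /=; lia.
  by rewrite cat_rcons; ring.
rewrite (pscan_lt (s := rcons s x) (h' := h')) ?size_rcons //; last by move: eN => /=; lia.
by rewrite hg; ring.
Qed.

End Top.

Lemma wsum_planar_top (R : comNzRingType) (X : eqType) (f f' : seq X -> R) w :
    w != [::] -> (forall c, (size c < size w)%N -> f c = f' c) ->
  wsum f (planar w) = wsum f' (planar w) + (f w - f' w).
Proof.
case: w => // x w _ eqf; rewrite planar_cons !wsum_planar_scan.
rewrite (@pscan_top _ _ f f' (size w).+1 _ _ (fun g => wsum f' (planar g))) //.
- move=> g lt_g; rewrite /wsum; apply: eq_big_seq => p pg.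
  apply: eq_big_seq => c cp; apply: eqf.
  exact: leq_ltn_trans (size_subseq (planar_subseq pg cp)) lt_g.
- by rewrite /wsum !big_seq1 !big_nil.
Qed.

(** * Moments and cumulants of words *)

Section MomentCumulant.
Variables (A : algType CC) (tau tau' : A -> CC) (t : A -> A).
Hypothesis space : tracial_real_inf_space tau tau' t.

Let tM x y : t (x * y) = t y * t x. Proof. by case: space => -[_ H _]. Qed.
Let tK : involutive t. Proof. by case: space => -[_ _ H]. Qed.
Let tau1 : tau 1 = 1. Proof. by case: space => _ _ [H _]. Qed.
Let taut a : tau (t a) = tau a. Proof. by case: space. Qed.
Let tauC x y : tau (x * y) = tau (y * x). Proof. by case: space => _ _ _ _ [H _]. Qed.

Implicit Types (s g w : seq A).

Definition mprod w : A := \prod_(x <- w) x.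

Lemma mprod_cat w1 w2 : mprod (w1 ++ w2) = mprod w1 * mprod w2.
Proof. exact: big_cat. Qed.

Lemma mprod_cons x w : mprod (x :: w) = x * mprod w.
Proof. exact: big_cons. Qed.

Lemma t1 : t 1 = 1.
Proof. by have := tM (t 1) 1; rewrite mulr1 tK mulr1 => <-. Qed.

Lemma mprod_mirror w : mprod (rev (map t w)) = t (mprod w).
Proof.
elim: w => [|x w IH]; first by rewrite /mprod !big_nil t1.
by rewrite rev_cons -cats1 mprod_cat IH !mprod_cons tM /mprod big_nil mulr1.
Qed.

Local Notation restr s V := (@restr A s V).

Lemma size_restr s (V : {set 'I_(size s)}) : size (restr s V) = #|V|.
Proof. by rewrite /Defs.restr size_map -cardE. Qed.

Lemma restrT s : restr s [set: 'I_(size s)] = s.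
Proof.
rewrite /Defs.restr enum_setT -enumT.
rewrite (map_comp (nth 0 s) (@nat_of_ord _)) val_enum_ord.
exact: mkseq_nth.
Qed.

(** Blocks of nontrivial partitions are shorter than the word; this makes the fuel in both cumulant
    definitions sufficient. *)
Lemma NC_block n (P : {set {set 'I_n}}) V : P \in NC n -> P != [set [set: 'I_n]] ->
  V \in P -> (0 < #|V| < n)%N.
Proof.
rewrite inE => /andP[/and3P[/eqP cv /trivIsetP tr P0] _] PT VP; apply/andP; split.
  by rewrite card_gt0; apply: contraNneq P0 => <-.
have le_V : (#|V| <= n)%N by have := max_card (mem V); rewrite card_ord.
rewrite ltn_neqAle le_V andbT.
apply: contra PT => /eqP cV; have VT : V = setT.
  by apply/eqP; rewrite eqEcard subsetT cardsT card_ord cV leqnn.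
apply/eqP/setP => W; rewrite inE; apply/idP/eqP => [WP|->]; last by rewrite -VT.
apply/eqP; rewrite -VT; apply: contraNT P0 => nWV.
have := tr W V WP VP nWV; rewrite VT -setI_eq0 setIT => /eqP W0.
by rewrite -W0.
Qed.

Lemma NC_top n : (0 < n)%N -> [set [set: 'I_n]] \in NC n.
Proof.
move=> n0; rewrite inE; apply/andP; split.
  rewrite /partition /cover big_set1 eqxx /= inE.
  apply/andP; split; last by rewrite eq_sym -card_gt0 cardsT card_ord.
  by apply/trivIsetP => V W; rewrite !inE => /eqP-> /eqP->; rewrite eqxx.
apply/forall_inP => V VP; apply/forall_inP => W WP.
by move: VP WP; rewrite !inE => /eqP-> /eqP->; rewrite eqxx.
Qed.

Lemma kappa_fuelE k s : s != [::] -> (size s <= k)%N -> kappa_fuel tau k s = kappa tau s.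
Proof.
have [m] := ubnP (size s); elim: m k s => // m IH [|k] [|x s] // lt_m _ le_k.
rewrite /kappa /=; congr (_ - _); apply: eq_bigr => P /andP[PN PT].
apply: eq_bigr => V VP; have /andP[V0 Vn] := NC_block PN PT VP.
have nz : restr (x :: s) V != [::] by rewrite -size_eq0 size_restr -lt0n.
have sV : (size (restr (x :: s) V) <= size s)%N by rewrite size_restr -ltnS.
have lV : (size (restr (x :: s) V) < m)%N by apply: leq_ltn_trans sV _; rewrite -ltnS.
by rewrite !IH //; apply: leq_trans sV _.
Qed.

Lemma sum_NC_restr (R : comNzRingType) (f : seq A -> R) s :
  \sum_(P in NC (size s)) \prod_(V in P) f (restr s V) = wsum f (planar s).
Proof.
have E := sum_NC (fun c : seq 'I_(size s) => f [seq nth 0 s (nat_of_ord i) | i <- c]).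
have e := wsum_planar_map (fun i : 'I_(size s) => nth 0 s (nat_of_ord i)) f (enum 'I_(size s)).
have m : [seq nth 0 s (nat_of_ord i) | i <- enum 'I_(size s)] = s.
  by have := restrT s; rewrite /Defs.restr enum_setT -enumT.
rewrite m in e; exact: etrans E (esym e).
Qed.

Lemma nilP_size s : s != [::] -> (0 < size s)%N.
Proof. by rewrite lt0n size_eq0. Qed.

Lemma wsum_nil (R : comNzRingType) (f : seq A -> R) : wsum f (planar [::]) = 1.
Proof. by rewrite /wsum big_seq1 big_nil. Qed.

Lemma moment_cumulant w : wsum (kappa tau) (planar w) = tau (mprod w).
Proof.
have [->|w0] := eqVneq w [::]; first by rewrite wsum_nil /mprod big_nil tau1.
have n0 := nilP_size w0.
rewrite -sum_NC_restr (bigD1 [set [set: 'I_(size w)]]) ?NC_top //= big_set1 restrT.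
have E : kappa tau w = tau (mprod w) -
    \sum_(P in NC (size w) | P != [set [set: 'I_(size w)]])
      \prod_(V in P) kappa tau (restr w V).
  rewrite {1}/kappa; case: w w0 n0 => // x w _ _ /=; congr (_ - _).
  apply: eq_bigr => P /andP[PN PT]; apply: eq_bigr => V VP.
  have /andP[V0 Vn] := NC_block PN PT VP; apply: kappa_fuelE.
    by rewrite -size_eq0 size_restr -lt0n.
  by rewrite size_restr -ltnS.
by rewrite E subrK.
Qed.

Definition letter_value w (x : pmT (size w)) : A :=
  if x.2 then t (nth 0 w x.1) else nth 0 w x.1.

Lemma letter_value_delta w x : letter_value (delta (size w) x) = t (letter_value x).
Proof. by rewrite deltaE /letter_value /=; case: x.2; rewrite ?tK. Qed.

Lemma letter_value_letters w : map (@letter_value w) (letters (size w)) = w.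
Proof.
rewrite /letters -map_comp; have := restrT w.
by rewrite /Defs.restr enum_setT -enumT.
Qed.

Lemma letter_value_mirror w c :
  map (@letter_value w) (mirror (delta (size w)) c) = rev (map t (map (@letter_value w) c)).
Proof.
rewrite /mirror map_rev -!map_comp; congr rev.
by apply: eq_map => x; exact: letter_value_delta.
Qed.

Section Placement.
Variables (n : nat).
Local Notation dl := (delta n).

Lemma rot_full u : perm_eq (pts dl u) (enum {: pmT n}) ->
  perm_eq (pts dl (rot 1 u)) (enum {: pmT n}).
Proof. by apply: perm_trans; apply: perm_pts; rewrite perm_rot. Qed.

Lemma mirror_full u : perm_eq (pts dl u) (enum {: pmT n}) ->
  perm_eq (pts dl (mirror dl u)) (enum {: pmT n}).
Proof. by apply: perm_trans; rewrite /mirror (pts_mirror (@deltaK n)) perm_rev. Qed.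

Lemma pts_rot1 u : pts dl (rot 1 u) = rot 1 (rot 1 (pts dl u)).
Proof.
case: u => // x u; have E a b (z : seq (pmT n)) : rot 1 (rot 1 [:: a, b & z]) = z ++ [:: a; b].
  by rewrite !(rot1_cons, rcons_cons) -!cats1 -catA.
by rewrite rot1_cons pts_rcons E.
Qed.

Lemma rot_paired (be : {perm pmT n}) u : paired be (rot 1 (pts dl u)) ->
  paired be (rot 1 (pts dl (rot 1 u))).
Proof. by rewrite pts_rot1; exact: paired_rot2. Qed.

Lemma mirror_paired (be : {perm pmT n}) u : fpf_inv be -> paired be (rot 1 (pts dl u)) ->
  paired be (rot 1 (pts dl (mirror dl u))).
Proof.
move=> bi; rewrite /mirror (pts_mirror (@deltaK n)); case: (pts dl u) => // a z.
case/lastP: z => [//|z b]; rewrite rot1_cons => pz.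
have -> : rot 1 (rev (a :: rcons z b)) = rev [:: b, a & z].
  by rewrite rev_cons rev_rcons rcons_cons rot1_cons !rev_cons.
apply: paired_rev; first by case: bi.
have ev : ~~ odd (size z) by have := paired_even pz; rewrite !size_rcons /= negbK.
by move: pz; rewrite -!cats1 -catA => /(paired_swap ev).
Qed.

End Placement.

(** Rotated and mirrored words have the same points and the same matching of neighbours, so
    [wsum_planar] turns all three sums into one sum over permutations. *)
Lemma wsum_dihedral (R : comNzRingType) n (f : seq (pmT n) -> R) :
    (forall i c, f (rot i c) = f c) -> (0 < n)%N ->
    (forall c, f (mirror (delta n) c) = f c) ->
  wsum f (planar (rot 1 (letters n))) = wsum f (planar (letters n)) /\
  wsum f (planar (mirror (delta n) (letters n))) = wsum f (planar (letters n)).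
Proof.
move=> fr n0 fm; have L0 := letters_nil n0.
have lf := letters_full n; have lg := letters_gaps n; have gi := gaps_fpf n.
have W := wsum_planar fr _ _ gi; split.
  rewrite (W _ lf L0 lg) // (W _ (rot_full lf) _ (rot_paired lg)) //.
  by rewrite -size_eq0 size_rot size_eq0.
rewrite (W _ lf L0 lg) // (W _ (mirror_full lf) _ (mirror_paired gi lg)) //.
by rewrite -size_eq0 size_rev size_map size_eq0.
Qed.

Lemma rot_invariant (T R : Type) (f : seq T -> R) N :
    (forall c, (size c < N)%N -> f (rot 1 c) = f c) ->
  forall i c, (size c < N)%N -> f (rot i c) = f c.
Proof.
move=> f1 i c lt_N; have [le_i|lt_i] := leqP i (size c); last first.
  by rewrite rot_oversize // ltnW.
elim: i le_i => [|i IH] le_i; first by rewrite rot0.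
by rewrite rotS // f1 ?size_rot // IH // ltnW.
Qed.

Lemma mprod_rot1 (f : A -> CC) w : tracial f -> f (mprod (rot 1 w)) = f (mprod w).
Proof.
case: w => // x w fC; rewrite rot1_cons -cats1 mprod_cat !mprod_cons fC.
by congr (f (_ * _)); rewrite /mprod big_nil mulr1.
Qed.

Definition mirror_t w := rev (map t w).

(** By induction shorter cumulants have both symmetries, hence so does the sum over configurations
    with several blocks. The moment has them since [tau] is a trace invariant under [t], and the
    cumulant is the difference. *)
Lemma kappa_symm w : kappa tau (rot 1 w) = kappa tau w /\ kappa tau (mirror_t w) = kappa tau w.
Proof.
have [N] := ubnP (size w); elim: N w => // N IH w lt_N.
have [->|w0] := eqVneq w [::]; first by [].
have n0 := nilP_size w0; set n := size w in n0.
(* Zero from length [n] on, so that the symmetries known by induction hold for [f] at every length,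
   as [wsum_dihedral] demands. *)
pose f c := if (size c < n)%N then kappa tau c else 0.
have IH1 c : (size c < n)%N -> kappa tau (rot 1 c) = kappa tau c /\
    kappa tau (mirror_t c) = kappa tau c.
  by move=> lt_c; apply: IH; apply: leq_trans lt_c _; rewrite -ltnS.
pose F := f \o map (@letter_value w).
have Frot i c : F (rot i c) = F c.
  rewrite /F /= /f map_rot !size_rot size_map; case: ifP => // lt_c.
  by rewrite (rot_invariant (N := n)) ?size_map // => c' /IH1[].
have Fmir c : F (mirror (delta n) c) = F c.
  rewrite /F /= /f letter_value_mirror size_rev !size_map; case: ifP => // lt_c.
  by have [|_] := IH1 (map (@letter_value w) c); rewrite ?size_map.
have [W1 W2] := wsum_dihedral Frot n0 Fmir.
have top w' : size w' = n -> kappa tau w' = tau (mprod w') - wsum f (planar w').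
  move=> sw'; have w'0 : w' != [::] by rewrite -size_eq0 sw' -lt0n.
  have := wsum_planar_top (f := kappa tau) (f' := f) w'0.
  rewrite moment_cumulant => -> => [|c]; last by rewrite sw' /f => ->.
  by rewrite {2}/f sw' ltnn subr0 addrC addKr.
have V1 : wsum f (planar (rot 1 w)) = wsum f (planar w).
  rewrite -{1 2}(letter_value_letters w) -map_rot.
  by rewrite (wsum_planar_map (@letter_value w)) (wsum_planar_map (@letter_value w)).
have V2 : wsum f (planar (mirror_t w)) = wsum f (planar w).
  rewrite /mirror_t -{1 2}(letter_value_letters w) -letter_value_mirror.
  by rewrite (wsum_planar_map (@letter_value w)) (wsum_planar_map (@letter_value w)).
split.
  by rewrite top ?size_rot // top // V1 (mprod_rot1 _ tauC).
by rewrite top ?size_rev ?size_map // top // V2 mprod_mirror taut.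
Qed.

Lemma kappa_rot i w : kappa tau (rot i w) = kappa tau w.
Proof.
by apply: (rot_invariant (N := (size w).+1)) => // c _; case: (kappa_symm c).
Qed.

Definition annular w := wsum (kappa tau) (projective t w).

Lemma annular_letters w : annular w =
  wsum (kappa tau \o map (@letter_value w)) (projective (delta (size w)) (letters (size w))).
Proof.
rewrite -(wsum_projective_map (t := t) (@letter_value_delta w)).
by rewrite letter_value_letters.
Qed.

Lemma kappa_letter_symm w : let F := kappa tau \o map (@letter_value w) in
  (forall i c, F (rot i c) = F c) /\ (forall c, F (mirror (delta (size w)) c) = F c).
Proof.
split=> [i c|c] /=; first by rewrite map_rot kappa_rot.
by rewrite letter_value_mirror; case: (kappa_symm (map (@letter_value w) c)).
Qed.

Lemma annularE w : w != [::] ->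
  \sum_(sigma in SNCd (size w)) kappa_half tau t (s := w) sigma = annular w.
Proof.
move=> w0; have n0 := nilP_size w0; have [Fr Fm] := kappa_letter_symm w.
rewrite annular_letters.
rewrite (wsum_projective Fr (letters_full _) (letters_nil n0) (gaps_fpf _) (letters_gaps _) Fm).
by apply: eq_bigl => sg; rewrite SNCd_symmetric.
Qed.

Lemma annular_rot w : annular (rot 1 w) = annular w.
Proof.
have [->|w0] := eqVneq w [::]; first by [].
have n0 := nilP_size w0; have [Fr Fm] := kappa_letter_symm w.
rewrite [RHS]annular_letters.
rewrite (wsum_projective Fr (letters_full _) (letters_nil n0) (gaps_fpf _) (letters_gaps _) Fm).
have r0 : rot 1 (letters (size w)) != [::].
  by rewrite -size_eq0 size_rot size_eq0 letters_nil.
rewrite -(wsum_projective Fr (rot_full (letters_full _)) r0 (gaps_fpf _) (rot_paired (letters_gaps _)) Fm).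
rewrite -(wsum_projective_map (t := t) (@letter_value_delta w)) map_rot.
by rewrite letter_value_letters.
Qed.

Lemma kappa'_fuelE k s : s != [::] -> (size s <= k)%N ->
  kappa'_fuel tau tau' t k s = kappa' tau tau' t s.
Proof.
have [m] := ubnP (size s); elim: m k s => // m IH [|k] [|x s] // lt_m _ le_k.
rewrite /kappa' /=; case: ifP => // _; congr (_ - _); apply: eq_bigr => P /andP[PN PT].
apply: eq_bigr => V VP; have /andP[V0 Vn] := NC_block PN PT VP.
have nz : restr (x :: s) V != [::] by rewrite -size_eq0 size_restr -lt0n.
have sV : (size (restr (x :: s) V) <= size s)%N by rewrite size_restr -ltnS.
have lV : (size (restr (x :: s) V) < m)%N by apply: leq_ltn_trans sV _; rewrite -ltnS.
by rewrite !IH //; apply: leq_trans sV _.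
Qed.

Lemma NC1 P : P \in NC 1 -> P = [set [set: 'I_1]].
Proof.
rewrite inE => /andP[/and3P[/eqP cv _ P0] _].
have one V : V \in P -> V = setT.
  move=> VP; have /set0Pn[x xV] : V != set0 by apply: contraNneq P0 => <-.
  by apply/setP => y; rewrite inE (_ : y = x) ?xV // (ord1 y) (ord1 x).
apply/setP => V; rewrite inE; apply/idP/eqP => [/one//|->].
have : ord0 \in cover P by rewrite cv inE.
by move=> /bigcupP[W WP _]; rewrite -(one W WP).
Qed.

(** At length 1 the definition has no correction terms. Both sums vanish there, the annular one
    because S_NC^delta(1,-1) is empty, so one formula covers all lengths. *)
Lemma kappa'E w : w != [::] -> kappa' tau tau' t w = tau' (mprod w) - annular w -
  \sum_(P in NC (size w) | P != [set [set: 'I_(size w)]])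
    \sum_(V in P) (kappa' tau tau' t (restr w V)
                    * \prod_(W in P | W != V) kappa tau (restr w W)).
Proof.
move=> w0; rewrite -annularE //; case: w w0 => // x w _.
rewrite [LHS]/kappa' [size _]/= [kappa'_fuel _ _ _ _ _]/=.
case: ifP => [/eqP|_].
  case: w => // _; set S1 := \sum_(sigma in _) _; set S2 := \sum_(P in _ | _) _.
  have -> : S2 = 0 by rewrite /S2 big1 // => P /andP[/NC1 ->]; rewrite eqxx.
  have -> : S1 = 0; last by rewrite !subr0.
  rewrite /S1 big1 // => sg; rewrite SNCd_symmetric // => /andP[sy eu].
  have [_] := count_by_euler (@deltaK 1) (@deltaN 1) (letters_full 1) (@letters_nil 1 isT) sy (gaps_fpf 1) (letters_gaps 1).
  rewrite eu; case E: (letters 1) => [|y [|z u]] //.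
  by have := congr1 size E; rewrite size_map size_enum_ord.
congr (_ - _); apply: eq_bigr => P /andP[PN PT]; apply: eq_bigr => V VP.
have /andP[V0 Vn] := NC_block PN PT VP; rewrite kappa'_fuelE //.
  by rewrite -size_eq0 size_restr -lt0n.
by rewrite size_restr -ltnS.
Qed.

End MomentCumulant.

(** * Dual numbers and the recursion for tau' *)

Section Infinitesimal.
Variable R : comNzRingType.
Implicit Types p q : {poly R}.

Lemma coefM0 p q : (p * q)`_0 = p`_0 * q`_0.
Proof. by rewrite coefM big_ord_recl big_ord0 addr0. Qed.

Lemma coefM1 p q : (p * q)`_1 = p`_0 * q`_1 + p`_1 * q`_0.
Proof. by rewrite coefM !big_ord_recl big_ord0 addr0. Qed.

(* [a + b * eps] with [eps ^ 2 = 0]; only the coefficients of degree 0 and 1 of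
   such polynomials are used. *)
Definition dual (a b : R) : {poly R} := a%:P + b *: 'X.

Lemma dual0 a b : (dual a b)`_0 = a.
Proof. by rewrite coefD coefZ coefC coefX /= mulr0 addr0. Qed.

Lemma dual1 a b : (dual a b)`_1 = b.
Proof. by rewrite coefD coefZ coefC coefX /= mulr1 add0r. Qed.

(** The coefficient of degree 1 is the Leibniz sum by which dkappa_pi is defined. *)
Lemma coef_prod_dual (I : eqType) (r : seq I) (a b : I -> R) : uniq r ->
  (\prod_(i <- r) dual (a i) (b i))`_0 = \prod_(i <- r) a i /\
  (\prod_(i <- r) dual (a i) (b i))`_1 = \sum_(i <- r) b i * \prod_(j <- r | j != i) a j.
Proof.
elim: r => [|x r IH] /=; first by rewrite !big_nil !coef1.
move=> /andP[xr /IH[E0 E1]]; rewrite !big_cons coefM0 coefM1 dual0 dual1 E0 E1.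
split=> //; rewrite eqxx /= addrC; congr (_ * _ + _).
  rewrite big_seq [RHS]big_seq_cond; apply: eq_bigl => i.
  by case: (boolP (i \in r)) => //= ir; apply/esym; apply: contraNneq xr => <-.
rewrite mulr_sumr; apply: eq_big_seq => i ir; rewrite big_cons ifT; first by ring.
by apply: contraNneq xr => ->.
Qed.

Lemma coef_prod_dual_set (I : finType) (P : {set I}) (a b : I -> R) :
  (\prod_(i in P) dual (a i) (b i))`_0 = \prod_(i in P) a i /\
  (\prod_(i in P) dual (a i) (b i))`_1 = \sum_(i in P) b i * \prod_(j in P | j != i) a j.
Proof.
have [E0 E1] := coef_prod_dual a b (enum_uniq P).
rewrite !big_enum in E0 E1; split=> //; rewrite E1.
by apply: eq_bigr => i _; rewrite big_enum_cond.
Qed.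

Lemma coef_wsum_dual0 (X : Type) (a b : seq X -> R) L :
  (wsum (fun c => dual (a c) (b c)) L)`_0 = wsum a L.
Proof.
rewrite /wsum coef_sum; apply: eq_bigr => p _.
elim: p => [|c p IH]; first by rewrite !big_nil coef1.
by rewrite !big_cons coefM0 IH dual0.
Qed.

End Infinitesimal.

Section Recursion.
Variables (R : comNzRingType) (X : Type) (t : X -> X).
Variables (f f' h h' : seq X -> R).

(* The first-order variation of [pscan] along [f'] and [h'], plus the terms through
   the crosscap. *)
Fixpoint phi s g w : R :=
  if w is x :: w' then
    phi s (rcons g x) w'
    + (h g * phi (rcons s x) [::] w'
    + (h' g * pscan f h (rcons s x) [::] w'
    + pscan f h (rcons s (t x)) [::] (rev (map t g) ++ w')))
  else f' s * h g + f s * h' g.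

(** The weight [h'] of a gap is the first-order part of its planar sum plus its projective sum. When
    both kinds of configurations on the whole word are added, these parts always occur together, so
    the result is a recursion in moments only. *)
Lemma phi_split (H : seq X -> {poly R}) (m : seq X -> R) s g w :
    (forall g, (H g)`_0 = h g) -> (forall g, (H g)`_1 + m g = h' g) ->
  (pscan (fun c => dual (f c) (f' c)) H s g w)`_1 + mscan t f h m s g w = phi s g w.
Proof.
move=> H0 H1.
have P0 s' g' w' : (pscan (fun c => dual (f c) (f' c)) H s' g' w')`_0 = pscan f h s' g' w'.
  elim: w' s' g' => [|x w' IH] s' g' /=; first by rewrite coefM0 dual0 H0.
  by rewrite coefD coefM0 !IH H0.
elim: w s g => [|x w IH] s g /=.
  by rewrite coefM1 dual0 dual1 H0 -H1; ring.
by rewrite coefD coefM1 H0 P0 -!IH -H1; ring.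
Qed.

End Recursion.

Section Cumulants.
Variables (A : algType CC) (tau tau' : A -> CC) (t : A -> A).
Hypothesis space : tracial_real_inf_space tau tau' t.

Let tau'C x y : tau' (x * y) = tau' (y * x). Proof. by case: space => _ _ _ _ [_ H]. Qed.
Let tau'1 : tau' 1 = 0. Proof. by case: space => _ _ [_ H]. Qed.

Local Notation kap := (kappa tau).
Local Notation kap' := (kappa' tau tau' t).

Lemma kappa_recursion a w : tau (mprod (a :: w)) = pscan kap (tau \o @mprod A) [:: a] [::] w.
Proof.
rewrite -(moment_cumulant space) planar_cons wsum_planar_scan.
by apply: eq_pscan => // g; exact: (moment_cumulant space).
Qed.

(** The noncrossing sum with weights kappa + eps kappa': its coefficient of eps is the sum of all
    dkappa_pi. *)
Lemma moment_cumulant' w :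
  (wsum (fun c => dual (kap c) (kap' c)) (planar w))`_1 + annular tau t w = tau' (mprod w).
Proof.
have [->|w0] := eqVneq w [::].
  by rewrite /annular /mprod /wsum big_seq1 !big_nil coef1 tau'1 addr0.
have n0 : (0 < size w)%N by rewrite lt0n size_eq0.
rewrite -sum_NC_restr coef_sum.
under eq_bigr => P _ do rewrite (coef_prod_dual_set P _ _).2.
rewrite (bigD1 [set [set: 'I_(size w)]]) ?NC_top //= big_set1.
rewrite [X in _ * X]big1 => [|V]; last by rewrite inE => /andP[/eqP-> /eqP].
by rewrite restrT mulr1 (kappa'E space w0); ring.
Qed.

Lemma kappa'_recursion a w : tau' (mprod (a :: w)) =
  phi t kap kap' (tau \o @mprod A) (tau' \o @mprod A) [:: a] [::] w.
Proof.
rewrite -moment_cumulant' planar_cons wsum_planar_scan /annular projective_cons.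
rewrite wsum_projective_scan.
rewrite -(@phi_split _ _ t kap kap' _ _
  (fun g => wsum (fun c => dual (kap c) (kap' c)) (planar g)) (annular tau t)).
- congr (_ + _); apply: eq_mscan => // g; exact: (moment_cumulant space).
- by move=> g; rewrite coef_wsum_dual0; exact: (moment_cumulant space).
- exact: moment_cumulant'.
Qed.

(** The argument of [kappa_symm] with dual numbers as weights, for rotations alone. *)
Lemma kappa'_rot1 w : kap' (rot 1 w) = kap' w.
Proof.
have [N] := ubnP (size w); elim: N w => // N IH w lt_N.
have [->|w0] := eqVneq w [::]; first by [].
have n0 : (0 < size w)%N by rewrite lt0n size_eq0.
set n := size w in n0.
have IH1 c : (size c < n)%N -> kap' (rot 1 c) = kap' c.
  by move=> lt_c; apply: IH; apply: leq_trans lt_c _; rewrite -ltnS.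
pose f c := dual (kap c) (if (size c < n)%N then kap' c else 0).
pose F := f \o map (@letter_value A t w).
have Frot i c : F (rot i c) = F c.
  rewrite /F /= /f map_rot (kappa_rot space) !size_rot size_map; congr dual.
  by case: ifP => // lt_c; rewrite (rot_invariant (N := n)) ?size_map.
(* [wsum_planar] asks for mirror invariance at blocks that do not represent their pair. In a planar
   configuration of positive letters every block is positive, hence a representative, so the
   condition is vacuous. *)
have pos u p c : all (fun x => ~~ x.2) u -> p \in planar u -> c \in p ->
    ~~ pair_rep [set x in c] -> F (mirror (delta n) c) = F c.
  move=> upos pu cp; case/negP.
  have cu x : x \in c -> ~~ x.2.
    by move=> xc; apply: (allP upos); apply: (mem_subseq (planar_subseq pu cp)).
  have [x xc] : exists x, x \in c.
    case: c cp {cu} => [|x c] cp; last by exists x; rewrite inE eqxx.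
    by have := planar_nonempty pu; rewrite cp.
  apply/existsP; exists x.1; rewrite inE; apply/andP; split.
    by case: x xc (cu x xc) => i [].
  by apply/forallP => j; apply/implyP; rewrite inE => /cu.
have lpos : all (fun x => ~~ x.2) (letters n) by apply/allP => x /mapP[i _ ->].
have rpos : all (fun x => ~~ x.2) (rot 1 (letters n)).
  by apply/allP => x; rewrite mem_rot => /(allP lpos).
have r0 : rot 1 (letters n) != [::].
  by rewrite -size_eq0 size_rot size_eq0 letters_nil.
have W1 := wsum_planar Frot (letters_full n) (letters_nil n0) (gaps_fpf n) (letters_gaps n) (fun p c => @pos _ p c lpos).
have W2 := wsum_planar Frot (rot_full (letters_full n)) r0 (gaps_fpf n) (rot_paired (letters_gaps n)) (fun p c => @pos _ p c rpos).
have top w' : size w' = n ->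
    kap' w' = tau' (mprod w') - annular tau t w' - (wsum f (planar w'))`_1.
  move=> sw'; have w'0 : w' != [::] by rewrite -size_eq0 sw' -lt0n.
  have := wsum_planar_top (f := fun c => dual (kap c) (kap' c)) (f' := f) w'0.
  rewrite -moment_cumulant' => -> => [|c]; last by rewrite sw' /f => ->.
  by rewrite coefD coefB /f !dual1 sw' ltnn; ring.
have V1 : wsum f (planar (rot 1 w)) = wsum f (planar w).
  rewrite -{1 2}(letter_value_letters t w) -map_rot.
  by rewrite !(wsum_planar_map (@letter_value A t w)) [LHS]W2 [RHS]W1.
by rewrite top ?size_rot // top // V1 (annular_rot space) (mprod_rot1 _ tau'C).
Qed.

Lemma kappa'_rot i w : kap' (rot i w) = kap' w.
Proof. by apply: (rot_invariant (N := (size w).+1)) => // c _; exact: kappa'_rot1. Qed.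

End Cumulants.

(** * Truncation, multilinearity, and letters that stay outside the first block *)

Definition trunc (R : nmodType) (T : Type) N (f : seq T -> R) c :=
  if (size c < N)%N then f c else 0.

Section PhiTop.
Variables (R : comNzRingType) (X : Type) (t : X -> X) (f f1 f2 h h' : seq X -> R) (N : nat).
Hypothesis eqf : forall c, (size c < N)%N -> f1 c = f2 c.

Lemma phi_lt s g w : (size s + size g + size w < N)%N ->
  phi t f f1 h h' s g w = phi t f f2 h h' s g w.
Proof.
elim: w s g => [|x w IH] s g /= lt_N.
  by rewrite eqf //; move: lt_N; lia.
rewrite IH ?size_rcons //; last by move: lt_N; lia.
by rewrite (IH (rcons s x)) ?size_rcons //=; move: lt_N; lia.
Qed.

Lemma phi_top s g w : h [::] = 1 -> (size s + size g + size w = N)%N ->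
  phi t f f1 h h' s g w =
  phi t f f2 h h' s g w + (if nilp g then f1 (s ++ w) - f2 (s ++ w) else 0).
Proof.
move=> h1; elim: w s g => [|x w IH] s g /= eN.
  case: g eN => [|y g] eN /=; first by rewrite h1 cats0; ring.
  by rewrite addr0 eqf //; move: eN => /=; lia.
rewrite IH ?size_rcons //; last by move: eN; lia.
have -> : nilp (rcons g x) = false by case: (g).
rewrite addr0; case: g eN => [|y g] eN /=.
  rewrite h1 IH ?size_rcons //=; last by move: eN => /=; lia.
  by rewrite cat_rcons; ring.
rewrite (phi_lt (s := rcons s x)) ?size_rcons //; last by move: eN => /=; lia.
by rewrite addr0.
Qed.

End PhiTop.

Lemma phi_map (R : comNzRingType) (X Y : Type) (v : X -> Y) (dl : X -> X) (t : Y -> Y)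
    (f f' h h' : seq Y -> R) s g w : (forall x, v (dl x) = t (v x)) ->
  phi t f f' h h' (map v s) (map v g) (map v w) =
  phi dl (f \o map v) (f' \o map v) (h \o map v) (h' \o map v) s g w.
Proof.
move=> vdl; have E g' : map v (map dl g') = map t (map v g').
  by rewrite -!map_comp; apply: eq_map => x /=; rewrite vdl.
elim: w s g => [|x w IH] s g //=.
rewrite -IH map_rcons -(IH _ [::]) map_rcons -!pscan_map !map_rcons vdl.
by rewrite map_cat map_rev E.
Qed.

Section Multilinear.
Variables (K : comNzRingType) (V : lmodType K) (t : V -> V).
Implicit Types (f h : seq V -> K).

Definition lin (F : V -> K) := forall c x y, F (c *: x + y) = c * F x + F y.
Definition multilin f := forall w1 w2, lin (fun z => f (w1 ++ z :: w2)).

Hypothesis tD : forall c x y, t (c *: x + y) = c *: t x + t y.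

Lemma linD F G : lin F -> lin G -> lin (fun z => F z + G z).
Proof. by move=> lF lG c x y; rewrite lF lG; ring. Qed.

Lemma linZ k F : lin F -> lin (fun z => k * F z).
Proof. by move=> lF c x y; rewrite lF; ring. Qed.

Lemma linZr k F : lin F -> lin (fun z => F z * k).
Proof. by move=> lF c x y; rewrite lF; ring. Qed.

Lemma linB F G : lin F -> lin G -> lin (fun z => F z - G z).
Proof. by move=> lF lG c x y; rewrite lF lG; ring. Qed.

Lemma eq_lin F G : F =1 G -> lin F -> lin G.
Proof. by move=> e lF c x y; rewrite -!e. Qed.

Lemma lin_t F : lin F -> lin (fun z => F (t z)).
Proof. by move=> lF c x y; rewrite tD lF. Qed.

Lemma multilin_trunc f N :
  (forall w1 w2, (size w1 + size w2 + 1 < N)%N -> lin (fun z => f (w1 ++ z :: w2))) ->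
  multilin (trunc N f).
Proof.
move=> mf w1 w2; rewrite /trunc; case: (ltnP (size w1 + size w2 + 1) N) => lt_N.
  apply: eq_lin (mf w1 w2 lt_N) => z.
  by rewrite size_cat /= addnS -addn1 lt_N.
move=> c x y; rewrite !size_cat /= !addnS -addn1 ltnNge lt_N /=.
by rewrite mulr0 addr0.
Qed.

Section Scan.
Variables (f f' h h' : seq V -> K).
Hypotheses (mf : multilin f) (mf' : multilin f') (mh : multilin h) (mh' : multilin h').

Lemma pscan_lin_s s1 s2 g w : lin (fun z => pscan f h (s1 ++ z :: s2) g w).
Proof.
elim: w s2 g => [|x w IH] s2 g /=; first exact: linZr (mf _ _).
apply: linD => //; apply: linZ; apply: eq_lin (IH (rcons s2 x) [::]) => z.
by rewrite rcons_cat.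
Qed.

Lemma pscan_lin_g s g1 g2 w : lin (fun z => pscan f h s (g1 ++ z :: g2) w).
Proof.
elim: w g2 => [|x w IH] g2 /=; first exact: linZ (mh _ _).
apply: linD; last exact: linZr (mh _ _).
by apply: eq_lin (IH (rcons g2 x)) => z; rewrite rcons_cat.
Qed.

Lemma pscan_lin_w s g w1 w2 : lin (fun z => pscan f h s g (w1 ++ z :: w2)).
Proof.
elim: w1 s g => [|x w1 IH] s g /=; last by apply: linD => //; exact: linZ.
apply: linD; first by apply: eq_lin (pscan_lin_g s g [::] w2) => z; rewrite cats1.
by apply: linZ; apply: eq_lin (pscan_lin_s s [::] [::] w2) => z; rewrite cats1.
Qed.

Lemma phi_lin_s s1 s2 g w : lin (fun z => phi t f f' h h' (s1 ++ z :: s2) g w).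
Proof.
elim: w s2 g => [|x w IH] s2 g /=.
  by apply: linD; apply: linZr; [exact: mf'|exact: mf].
apply: linD => //; apply: linD.
  by apply: linZ; apply: eq_lin (IH (rcons s2 x) [::]) => z; rewrite rcons_cat.
apply: linD.
  by apply: linZ; apply: eq_lin (pscan_lin_s s1 (rcons s2 x) [::] w) => z; rewrite rcons_cat.
by apply: eq_lin (pscan_lin_s s1 (rcons s2 (t x)) [::] _) => z; rewrite rcons_cat.
Qed.

Lemma phi_lin_g s g1 g2 w : lin (fun z => phi t f f' h h' s (g1 ++ z :: g2) w).
Proof.
elim: w g2 => [|x w IH] g2 /=.
  by apply: linD; apply: linZ; [exact: mh|exact: mh'].
apply: linD; first by apply: eq_lin (IH (rcons g2 x)) => z; rewrite rcons_cat.
apply: linD; first exact: linZr (mh _ _).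
apply: linD; first exact: linZr (mh' _ _).
apply: eq_lin (lin_t (pscan_lin_w (rcons s (t x)) [::] (rev (map t g2)) (rev (map t g1) ++ w))).
by move=> z; rewrite map_cat rev_cat /= rev_cons cat_rcons -catA.
Qed.

Lemma phi_lin_w s g w1 w2 : lin (fun z => phi t f f' h h' s g (w1 ++ z :: w2)).
Proof.
elim: w1 s g => [|x w1 IH] s g /=.
  apply: linD; first by apply: eq_lin (phi_lin_g s g [::] w2) => z; rewrite cats1.
  apply: linD.
    by apply: linZ; apply: eq_lin (phi_lin_s s [::] [::] w2) => z; rewrite cats1.
  apply: linD.
    by apply: linZ; apply: eq_lin (pscan_lin_s s [::] [::] w2) => z; rewrite cats1.
  apply: eq_lin (lin_t (pscan_lin_s s [::] [::] (rev (map t g) ++ w2))) => z.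
  by rewrite cats1.
apply: linD => //; apply: linD; first exact: linZ.
apply: linD; first by apply: linZ; exact: pscan_lin_w.
apply: eq_lin (pscan_lin_w (rcons s (t x)) [::] (rev (map t g) ++ w1) w2) => z.
by rewrite catA.
Qed.

End Scan.
End Multilinear.

Section Inert.
Variables (R : comNzRingType) (X : eqType) (t : X -> X) (Q : X -> Prop) (a : X).
Variables (f f' h h' : seq X -> R).
Hypothesis Qt : forall x, Q x -> Q (t x).
Local Notation Qs w := (forall z, z \in w -> Q z).

(* The block of the head letter [a] cannot contain [y]. *)
Definition dead (F : seq X -> R) y :=
  forall s c, Qs s -> Qs c -> F (a :: s ++ y :: c) = 0.

Lemma pscan_dead s g w : Qs w -> (forall c, Qs c -> f (s ++ c) = 0) -> pscan f h s g w = 0.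
Proof.
elim: w s g => [|x w IH] s g Qw f0 /=.
  by rewrite -[s]cats0 f0 // mul0r.
have Qw' : Qs w by move=> z zw; apply: Qw; rewrite inE zw orbT.
have Qx : Q x by apply: Qw; rewrite inE eqxx.
rewrite !IH // ?mulr0 ?addr0 // => c Qc; rewrite cat_rcons; apply: f0 => z.
by rewrite inE => /orP[/eqP->|/Qc].
Qed.

Lemma phi_dead s g w : Qs g -> Qs w -> (forall c, Qs c -> f (s ++ c) = 0) ->
  (forall c, Qs c -> f' (s ++ c) = 0) -> phi t f f' h h' s g w = 0.
Proof.
elim: w s g => [|x w IH] s g Qg Qw f0 f0' /=.
  by rewrite -[s]cats0 f0 // f0' // !mul0r addr0.
have Qw' : Qs w by move=> z zw; apply: Qw; rewrite inE zw orbT.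
have Qx : Q x by apply: Qw; rewrite inE eqxx.
have Qgx : Qs (rcons g x) by move=> z; rewrite mem_rcons inE => /orP[/eqP->|/Qg].
have F0 y : Q y -> forall c, Qs c -> f (rcons s y ++ c) = 0.
  move=> Qy c Qc; rewrite cat_rcons; apply: f0 => z.
  by rewrite inE => /orP[/eqP->|/Qc].
have F0' y : Q y -> forall c, Qs c -> f' (rcons s y ++ c) = 0.
  move=> Qy c Qc; rewrite cat_rcons; apply: f0' => z.
  by rewrite inE => /orP[/eqP->|/Qc].
rewrite !IH // ?(pscan_dead _ Qw') ?(pscan_dead (s := rcons s (t x))); rewrite ?mulr0 ?addr0 //; auto.
move=> z; rewrite mem_cat mem_rev => /orP[/mapP[y yg ->]|/Qw' //].
by apply: Qt; exact: Qg.
Qed.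

Section Replace.
Variables (x x' : seq X).
Hypotheses (Qx : Qs x) (Qx' : Qs x').
Hypothesis dx : forall y, y \in x -> [/\ dead f y, dead f (t y) & dead f' y].
Hypothesis dx' : forall y, y \in x' -> [/\ dead f y, dead f (t y) & dead f' y].
Hypothesis hx : forall g1 g2, h (g1 ++ x ++ g2) = h (g1 ++ x' ++ g2).
Hypothesis hx' : forall g1 g2, h' (g1 ++ x ++ g2) = h' (g1 ++ x' ++ g2).
Hypothesis hxt : forall g1 g2,
  h (g1 ++ rev (map t x) ++ g2) = h (g1 ++ rev (map t x') ++ g2).

Let dead_pscan y s g w : Qs s -> Qs w -> dead f y -> pscan f h (rcons (a :: s) y) g w = 0.
Proof.
move=> Q1 Q2 dy; apply: pscan_dead => // c Qc.
by rewrite cat_rcons; exact: dy.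
Qed.

Let pscan_skip u s g w : (forall y, y \in u -> dead f y) -> Qs u -> Qs s -> Qs w ->
  pscan f h (a :: s) g (u ++ w) = pscan f h (a :: s) (g ++ u) w.
Proof.
elim: u g => [|y u IH] g du Qu Q1 Q2 /=; first by rewrite cats0.
have du' z : z \in u -> dead f z by move=> zu; apply: du; rewrite inE zu orbT.
have Qu' : Qs u by move=> z zu; apply: Qu; rewrite inE zu orbT.
rewrite IH // cat_rcons (dead_pscan (s := s)) ?mulr0 ?addr0 //.
  by move=> z; rewrite mem_cat => /orP[/Qu'|/Q2].
by apply: du; rewrite inE eqxx.
Qed.

Let pscan_gap (y y' : seq X) s g1 g2 w :
    (forall g1 g2, h (g1 ++ y ++ g2) = h (g1 ++ y' ++ g2)) ->
  pscan f h s (g1 ++ y ++ g2) w = pscan f h s (g1 ++ y' ++ g2) w.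
Proof.
move=> hy; elim: w g2 => [|z w IH] g2 /=; first by rewrite hy.
by rewrite !rcons_cat IH hy.
Qed.

(** Letters that cannot join the block of [a] always end in a gap, and a gap is seen through [h]
    only. It is applied to the words [1] and empty, and to two neighbours and their product. *)
Lemma pscan_repl (y y' : seq X) s g u1 u2 :
    (forall z, z \in y -> dead f z) -> (forall z, z \in y' -> dead f z) ->
    Qs y -> Qs y' -> (forall g1 g2, h (g1 ++ y ++ g2) = h (g1 ++ y' ++ g2)) ->
    Qs s -> Qs u1 -> Qs u2 ->
  pscan f h (a :: s) g (u1 ++ y ++ u2) = pscan f h (a :: s) g (u1 ++ y' ++ u2).
Proof.
move=> dy dy' Qy Qy' hy; elim: u1 s g => [|z u1 IH] s g Q1 Q2 Q3 /=.
  rewrite !pscan_skip // -[g ++ y]cats0 -catA -[g ++ y']cats0 -catA.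
  by rewrite (pscan_gap _ _ _ _ hy).
have Q2' : Qs u1 by move=> z' zu; apply: Q2; rewrite inE zu orbT.
rewrite IH // -!rcons_cons !rcons_cons IH // => z'.
rewrite mem_rcons inE => /orP[/eqP->|/Q1 //].
by apply: Q2; rewrite inE eqxx.
Qed.

Lemma pscan_replace s g u1 u2 : Qs s -> Qs u1 -> Qs u2 ->
  pscan f h (a :: s) g (u1 ++ x ++ u2) = pscan f h (a :: s) g (u1 ++ x' ++ u2).
Proof. by apply: pscan_repl => // y; [case/dx|case/dx']. Qed.

Lemma phi_gap s g1 g2 w : Qs s -> Qs g1 -> Qs g2 -> Qs w ->
  phi t f f' h h' (a :: s) (g1 ++ x ++ g2) w = phi t f f' h h' (a :: s) (g1 ++ x' ++ g2) w.
Proof.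
move=> Q1 Q2; elim: w g2 => [|z w IH] g2 Q3 Q4 /=; first by rewrite hx hx'.
have Q4' : Qs w by move=> z' zw; apply: Q4; rewrite inE zw orbT.
have Qz : Q z by apply: Q4; rewrite inE eqxx.
have Qg3 : Qs (rcons g2 z) by move=> y; rewrite mem_rcons inE => /orP[/eqP->|/Q3].
rewrite !rcons_cat IH // hx hx'; congr (_ + (_ + (_ + _))).
rewrite !map_cat !rev_cat -!catA.
have Qrev g : Qs g -> Qs (rev (map t g)).
  by move=> Qg y; rewrite mem_rev => /mapP[y' /Qg Qy ->]; exact: Qt.
apply: pscan_repl => //.
- by move=> y; rewrite mem_rev => /mapP[y' /dx[_ ? _] ->].
- by move=> y; rewrite mem_rev => /mapP[y' /dx'[_ ? _] ->].
- exact: Qrev.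
- exact: Qrev.
- by move=> y; rewrite mem_rcons inE => /orP[/eqP->|/Q1 //]; exact: Qt.
- exact: Qrev.
- by move=> y; rewrite mem_cat => /orP[/(Qrev _ Q2)|/Q4'].
Qed.

Let phi_skip u s g w : (forall y, y \in u -> [/\ dead f y, dead f (t y) & dead f' y]) ->
    Qs u -> Qs s -> Qs g -> Qs w ->
  phi t f f' h h' (a :: s) g (u ++ w) = phi t f f' h h' (a :: s) (g ++ u) w.
Proof.
elim: u g => [|y u IH] g du Qu Q1 Q2 Q3 /=; first by rewrite cats0.
have du' z : z \in u -> [/\ dead f z, dead f (t z) & dead f' z].
  by move=> zu; apply: du; rewrite inE zu orbT.
have Qu' : Qs u by move=> z zu; apply: Qu; rewrite inE zu orbT.
have Qy : Q y by apply: Qu; rewrite inE eqxx.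
have [d1 d2 d3] := du y (mem_head _ _).
have Quw : Qs (u ++ w) by move=> z; rewrite mem_cat => /orP[/Qu'|/Q3].
rewrite IH //; last by move=> z; rewrite mem_rcons inE => /orP[/eqP->|/Q2].
have E1 : phi t f f' h h' (a :: rcons s y) [::] (u ++ w) = 0.
  apply: phi_dead => // c Qc; rewrite -[_ ++ _]/(a :: (rcons s y ++ c)) cat_rcons.
    exact: d1.
  exact: d3.
have E2 : pscan f h (a :: rcons s y) [::] (u ++ w) = 0 by exact: dead_pscan.
have E3 : pscan f h (a :: rcons s (t y)) [::] (rev (map t g) ++ u ++ w) = 0.
  apply: dead_pscan => // z; rewrite mem_cat mem_rev => /orP[/mapP[y' yg ->]|/Quw //].
  by apply: Qt; exact: Q2.
by rewrite E1 E2 E3 !mulr0 !addr0 cat_rcons.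
Qed.

(** As in [pscan_repl], except that a gap may also come back reversed and transposed; hence [hxt]
    and the requirement that the transposed letters be dead too. *)
Lemma phi_replace s g u1 u2 : Qs s -> Qs g -> Qs u1 -> Qs u2 ->
  phi t f f' h h' (a :: s) g (u1 ++ x ++ u2) = phi t f f' h h' (a :: s) g (u1 ++ x' ++ u2).
Proof.
elim: u1 s g => [|z u1 IH] s g Q1 Qg Q2 Q3 /=.
  rewrite !phi_skip // -[g ++ x]cats0 -catA -[g ++ x']cats0 -catA.
  by rewrite phi_gap.
have Q2' : Qs u1 by move=> z' zu; apply: Q2; rewrite inE zu orbT.
have Qz : Q z by apply: Q2; rewrite inE eqxx.
have Qadd y l : Q y -> Qs l -> Qs (rcons l y).
  by move=> Qy Ql z'; rewrite mem_rcons inE => /orP[/eqP->|/Ql].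
rewrite IH //; last exact: Qadd.
rewrite (IH (rcons s z)) //; last exact: Qadd.
rewrite (pscan_replace (s := rcons s z)) //; last exact: Qadd.
congr (_ + (_ + (_ + _))); rewrite !catA -!catA !(catA (rev _) u1).
apply: pscan_replace => //; first by apply: Qadd => //; exact: Qt.
move=> y; rewrite mem_cat mem_rev => /orP[/mapP[y' yg ->]|/Q2' //].
by apply: Qt; exact: Qg.
Qed.

End Replace.
End Inert.

(** * Multilinearity of cumulants, and cumulants with an entry 1 *)

Section Laws.
Variables (A : algType CC) (tau tau' : A -> CC) (t : A -> A).
Hypothesis space : tracial_real_inf_space tau tau' t.

Let tD c x y : t (c *: x + y) = c *: t x + t y. Proof. by case: space => -[H _ _]. Qed.
Let tau_lin : lin tau. Proof. by case: space => _ [H _]. Qed.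
Let tau'_lin : lin tau'. Proof. by case: space => _ [_ H]. Qed.
Let tau1 : tau 1 = 1. Proof. by case: space => _ _ [H _]. Qed.

Local Notation kap := (kappa tau).
Local Notation kap' := (kappa' tau tau' t).
Local Notation T := (tau \o @mprod A).
Local Notation T' := (tau' \o @mprod A).

Lemma mprod1 : mprod [::] = 1 :> A. Proof. by rewrite /mprod big_nil. Qed.

(** The recursion solved for the cumulant of full length. The truncated scan involves shorter ones
    only, so induction on the length applies to it. *)
Lemma kappa_top N a w : size w = N ->
  kap (a :: w) = T (a :: w) - pscan (trunc N.+1 kap) T [:: a] [::] w.
Proof.
move=> sw; have := kappa_recursion space a w.
rewrite (@pscan_top _ _ kap (trunc N.+1 kap) N.+1 _ T T) //= ?mprod1 ?sw //.
  by move=> ->; rewrite {2}/trunc /= sw ltnn; ring.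
by move=> c lt_c; rewrite /trunc lt_c.
Qed.

Lemma kappa'_top N a w : size w = N ->
  kap' (a :: w) = T' (a :: w) - phi t kap (trunc N.+1 kap') T T' [:: a] [::] w.
Proof.
move=> sw; have := kappa'_recursion space a w.
rewrite (@phi_top _ _ t kap kap' (trunc N.+1 kap') T T' N.+1) /= ?mprod1 ?sw //.
  by move=> ->; rewrite {2}/trunc /= sw ltnn; ring.
by move=> c lt_c; rewrite /trunc lt_c.
Qed.

Lemma multilin_moment f : lin f -> multilin (f \o @mprod A).
Proof.
move=> lf w1 w2 c x y /=; rewrite !mprod_cat !mprod_cons mulrDl mulrDr.
by rewrite -scalerAl -scalerAr lf.
Qed.

Lemma multilin_kappa : multilin kap.
Proof.
suff H N w1 w2 : (size w1 + size w2 < N)%N -> lin (fun z => kap (w1 ++ z :: w2)).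
  by move=> w1 w2; apply: H (ltnSn _).
elim: N w1 w2 => // N IH w1 w2 lt_N; set n := (size w1 + size w2)%N.
have mT := multilin_moment tau_lin.
have mtr : multilin (trunc n.+1 kap).
  by apply: multilin_trunc => u1 u2 lt_u; apply: IH; move: lt_u lt_N; rewrite /n; lia.
case: w1 @n lt_N mtr => [|a w1] n lt_N mtr.
  apply: eq_lin (linB (mT [::] w2) (pscan_lin_s T mtr [::] [::] [::] w2)) => z.
  by rewrite (kappa_top (N := n)).
apply: eq_lin (linB (mT (a :: w1) w2) (pscan_lin_w mtr mT [:: a] [::] w1 w2)) => z.
by rewrite (kappa_top (N := n)) // size_cat /= addnS.
Qed.

Lemma multilin_kappa' : multilin kap'.
Proof.
suff H N w1 w2 : (size w1 + size w2 < N)%N -> lin (fun z => kap' (w1 ++ z :: w2)).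
  by move=> w1 w2; apply: H (ltnSn _).
elim: N w1 w2 => // N IH w1 w2 lt_N; set n := (size w1 + size w2)%N.
have mT := multilin_moment tau_lin; have mT' := multilin_moment tau'_lin.
have mk := multilin_kappa.
have mtr : multilin (trunc n.+1 kap').
  by apply: multilin_trunc => u1 u2 lt_u; apply: IH; move: lt_u lt_N; rewrite /n; lia.
case: w1 @n lt_N mtr => [|a w1] n lt_N mtr.
  apply: eq_lin (linB (mT' [::] w2) (phi_lin_s t T T' mk mtr [::] [::] [::] w2)) => z.
  by rewrite (kappa'_top (N := n)).
apply: eq_lin (linB (mT' (a :: w1) w2) (phi_lin_w tD mk mtr mT mT' [:: a] [::] w1 w2)) => z.
by rewrite (kappa'_top (N := n)) // size_cat /= addnS.
Qed.

Lemma moment_unit (f : A -> CC) (g1 g2 : seq A) : (f \o @mprod A) (g1 ++ [:: 1] ++ g2) = (f \o @mprod A) (g1 ++ [::] ++ g2).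
Proof. by rewrite /= !mprod_cat mprod_cons mul1r. Qed.

(** Rotate so that 1 is not the first letter. By induction 1 does not enter a proper block with the
    first letter, so the scan equals that of the word without 1, which is its moment; and both words
    have the same moment. *)
Lemma kappa_unit w1 w2 : w1 ++ w2 != [::] -> kap (w1 ++ 1 :: w2) = 0.
Proof.
have [N] := ubnP (size (w1 ++ w2)); elim: N w1 w2 => // N IH w1 w2 lt_N n0.
have [i [a [u1 [u2 []]]]] : exists i a u1 u2,
    rot i (w1 ++ 1 :: w2) = a :: u1 ++ 1 :: u2 /\ size (a :: u1 ++ u2) = size (w1 ++ w2).
  case: w1 n0 {lt_N} => [|a w1] n0; last by exists 0%N, a, w1, w2; rewrite rot0.
  case: w2 n0 => // a w2 _; exists 1%N, a, w2, [::].
  by rewrite rot1_cons rcons_cons cats1 cats0.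
move=> E sz; rewrite -(kappa_rot space i) E.
have un : a :: u1 ++ u2 != [::] by [].
rewrite (kappa_top (N := size (u1 ++ 1 :: u2))) //.
set F := trunc _ _.
have FE c : (size c < (size (a :: u1 ++ u2)).+1)%N -> F c = kap c.
  by rewrite /F /trunc /= !size_cat /= addnS => ->.
have Fd : dead xpredT a F 1.
  move=> s c _ _; rewrite /F /trunc; case: ifP => // lt_c.
  rewrite -cat_cons; apply: IH => //.
  move: lt_c sz lt_N; rewrite /= !size_cat /= !addnS; lia.
have -> : pscan F T [:: a] [::] (u1 ++ 1 :: u2) = pscan F T [:: a] [::] (u1 ++ u2).
  apply: (@pscan_repl _ _ xpredT a F T [:: 1] [::] [::] [::] u1 u2) => //.
    by move=> y; rewrite inE => /eqP->.
  exact: moment_unit.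
(* Without 1 the word is shorter by one letter, so the truncation removes none of its cumulants. *)
have -> : pscan F T [:: a] [::] (u1 ++ u2) = T (a :: u1 ++ u2).
  rewrite [RHS](kappa_recursion space); apply: (@pscan_lt _ _ _ _ (size (u1 ++ u2)).+2) => //.
by rewrite /= !(mprod_cons, mprod_cat) mul1r subrr.
Qed.

Lemma kappa'_unit w1 w2 : w1 ++ w2 != [::] -> kap' (w1 ++ 1 :: w2) = 0.
Proof.
have [N] := ubnP (size (w1 ++ w2)); elim: N w1 w2 => // N IH w1 w2 lt_N n0.
have [i [a [u1 [u2 []]]]] : exists i a u1 u2,
    rot i (w1 ++ 1 :: w2) = a :: u1 ++ 1 :: u2 /\ size (a :: u1 ++ u2) = size (w1 ++ w2).
  case: w1 n0 {lt_N} => [|a w1] n0; last by exists 0%N, a, w1, w2; rewrite rot0.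
  case: w2 n0 => // a w2 _; exists 1%N, a, w2, [::].
  by rewrite rot1_cons rcons_cons cats1 cats0.
move=> E sz; rewrite -(kappa'_rot space i) E.
rewrite (kappa'_top (N := size (u1 ++ 1 :: u2))) //.
set F := trunc _ _.
have FE c : (size c < (size (a :: u1 ++ u2)).+1)%N -> F c = kap' c.
  by rewrite /F /trunc /= !size_cat /= addnS => ->.
have Fd : dead xpredT a F 1.
  move=> s c _ _; rewrite /F /trunc; case: ifP => // lt_c.
  rewrite -cat_cons; apply: IH => //.
  move: lt_c sz lt_N; rewrite /= !size_cat /= !addnS; lia.
have Kd : dead xpredT a kap 1 by move=> s c _ _; rewrite -cat_cons kappa_unit.
have d1 y : y \in [:: (1 : A)] -> [/\ dead xpredT a kap y, dead xpredT a kap (t y) & dead xpredT a F y].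
  by rewrite inE => /eqP->; rewrite (t1 space).
have -> : phi t kap F T T' [:: a] [::] (u1 ++ 1 :: u2) = phi t kap F T T' [:: a] [::] (u1 ++ u2).
  apply: (@phi_replace _ _ t xpredT a kap F T T' _ [:: 1] [::] _ _ d1 _ _ _ _ [::] [::] u1 u2) => //.
  - exact: moment_unit.
  - exact: moment_unit.
  - by move=> g1 g2; rewrite /= (t1 space); exact: moment_unit.
have -> : phi t kap F T T' [:: a] [::] (u1 ++ u2) = T' (a :: u1 ++ u2).
  rewrite [RHS](kappa'_recursion space); apply: (@phi_lt _ _ _ _ _ _ _ _ (size (u1 ++ u2)).+2) => //.
by rewrite /= !(mprod_cons, mprod_cat) mul1r subrr.
Qed.

End Laws.

(** * Words of coloured letters *)

Section Coloured.
Variables (A : algType CC) (tau tau' : A -> CC) (t : A -> A) (s : nat).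
Variable Asub : 'I_s -> A -> Prop.
Hypothesis space : tracial_real_inf_space tau tau' t.
Hypothesis subalg : forall r, t_invariant_unital_subalg t (Asub r).

Let tM x y : t (x * y) = t y * t x. Proof. by case: space => -[_ H _]. Qed.
Let tau_lin : lin tau. Proof. by case: space => _ [H _]. Qed.
Let tau1 : tau 1 = 1. Proof. by case: space => _ _ [H _]. Qed.
Let tau'1 : tau' 1 = 0. Proof. by case: space => _ _ [_ H]. Qed.
Let taut a : tau (t a) = tau a. Proof. by case: space. Qed.

(** A letter carries its colour, since an element can lie in several of the subalgebras; the scalars
    lie in all of them. *)
Local Notation X := ('I_s * A)%type.
Implicit Types (w u v g : seq X) (p q a : X).

Definition tl p : X := (p.1, t p.2).
Definition valid p := Asub p.1 p.2.
Local Notation Qs w := (forall z, z \in w -> valid z).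
Definition mixed w := exists p q, [/\ p \in w, q \in w & p.1 != q.1].
Definition vanish (f : seq X -> CC) := forall w, Qs w -> mixed w -> f w = 0.

Definition ckappa := kappa tau \o map (@snd 'I_s A).
Definition ckappa' := kappa' tau tau' t \o map (@snd 'I_s A).
Definition cmoment := tau \o @mprod A \o map (@snd 'I_s A).
Definition cmoment' := tau' \o @mprod A \o map (@snd 'I_s A).

Lemma valid_tl p : valid p -> valid (tl p).
Proof. by rewrite /valid /=; case: (subalg p.1) => _ _ _; apply. Qed.

Lemma cmomentE w : cmoment w = tau (mprod (map snd w)). Proof. by []. Qed.
Lemma cmoment'E w : cmoment' w = tau' (mprod (map snd w)). Proof. by []. Qed.
Lemma cmoment0 : cmoment [::] = 1. Proof. by rewrite cmomentE mprod1. Qed.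
Lemma cmoment'0 : cmoment' [::] = 0. Proof. by rewrite cmoment'E mprod1. Qed.

Lemma cmoment_cons a w : cmoment (a :: w) = pscan ckappa cmoment [:: a] [::] w.
Proof.
rewrite cmomentE /= (kappa_recursion space).
by rewrite (pscan_map (@snd 'I_s A) _ _ [:: a] [::] w).
Qed.

Lemma cmoment'_cons a w : cmoment' (a :: w) = phi tl ckappa ckappa' cmoment cmoment' [:: a] [::] w.
Proof.
rewrite cmoment'E /= (kappa'_recursion space).
by rewrite (@phi_map _ _ _ (@snd 'I_s A) tl t _ _ _ _ [:: a] [::] w).
Qed.

Lemma ckappa_top a w : ckappa (a :: w) = cmoment (a :: w) - pscan (trunc (size w).+1 ckappa) cmoment [:: a] [::] w.
Proof.
rewrite {1}/ckappa /= (kappa_top space (N := size w)) ?size_map //; congr (_ - _).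
rewrite (pscan_map (@snd 'I_s A) _ _ [:: a] [::] w); apply: eq_pscan => // c.
by rewrite /trunc /ckappa /= size_map.
Qed.

Lemma ckappa'_top a w :
  ckappa' (a :: w) = cmoment' (a :: w) - phi tl ckappa (trunc (size w).+1 ckappa') cmoment cmoment' [:: a] [::] w.
Proof.
rewrite {1}/ckappa' /= (kappa'_top space (N := size w)) ?size_map //; congr (_ - _).
rewrite (@phi_map _ _ _ (@snd 'I_s A) tl t _ _ _ _ [:: a] [::] w) //.
apply: phi_lt (size w).+2 _ _ _ _ _ => [c _|]; last by rewrite /= addn0 ltnSn.
by rewrite /trunc /ckappa' /= size_map.
Qed.

Lemma ckappa_rot i w : ckappa (rot i w) = ckappa w.
Proof. by rewrite /ckappa /= map_rot (kappa_rot space). Qed.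

Lemma ckappa'_rot i w : ckappa' (rot i w) = ckappa' w.
Proof. by rewrite /ckappa' /= map_rot (kappa'_rot space). Qed.

Definition neq p q := p.1 != q.1.
Lemma neqC p q : neq p q = neq q p. Proof. by rewrite /neq eq_sym. Qed.

Definition altc w := [/\ Qs w, forall z, z \in w -> tau z.2 = 0 & sorted neq w].

Definition freeness := forall w, altc w -> w != [::] -> cmoment w = 0.

Lemma altc_cat u v : altc (u ++ v) -> altc u /\ altc v.
Proof.
move=> [V C S]; split; split.
- by move=> z zu; apply: V; rewrite mem_cat zu.
- by move=> z zu; apply: C; rewrite mem_cat zu.
- by case: (cat_sorted2 S).
- by move=> z zu; apply: V; rewrite mem_cat zu orbT.
- by move=> z zu; apply: C; rewrite mem_cat zu orbT.
- by case: (cat_sorted2 S).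
Qed.

Lemma altc_tl w : altc w -> altc (map tl w).
Proof.
move=> [V C S]; split.
- by move=> z /mapP[y /V yw ->]; exact: valid_tl.
- by move=> z /mapP[y /C yw ->]; rewrite taut.
- by rewrite sorted_map.
Qed.

Lemma sorted_rev_cat g x v : sorted neq (x :: g) -> sorted neq (x :: v) ->
  sorted neq (rev g ++ x :: v).
Proof.
elim: g x v => // y g IH x v /= /andP[xy pg] pv.
by rewrite rev_cons cat_rcons; apply: IH; rewrite //= neqC xy.
Qed.

Lemma altc_rev w : altc w -> altc (rev w).
Proof.
move=> [V C S]; split.
- by move=> z; rewrite mem_rev; exact: V.
- by move=> z; rewrite mem_rev; exact: C.
- case: w S {V C} => // x w S.
  by rewrite rev_cons -cats1; apply: sorted_rev_cat.
Qed.

Lemma altc_mirror w : altc w -> altc (rev (map tl w)).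
Proof. by move=> /altc_tl/altc_rev. Qed.

(** A nonempty gap is closed sooner or later, and is then an alternating centred word, of moment
    zero. The bound on the length allows the use inside the induction of [vanish_freeness]. *)
Lemma pscan_gap0 f b g w : (forall v, altc v -> v != [::] -> (size v <= size (g ++ w))%N -> cmoment v = 0) ->
  altc (g ++ w) -> g != [::] -> pscan f cmoment b g w = 0.
Proof.
elim: w g => [|x w IH] g h0 al g0 /=; first by rewrite cats0 in h0 al; rewrite h0 ?mulr0.
rewrite IH ?cat_rcons //; last by case: (g).
rewrite h0 ?mul0r ?addr0 //; first by case: (altc_cat al).
by rewrite size_cat leq_addr.
Qed.

Lemma vanish_pscan f h b g w : vanish f -> Qs b -> Qs w -> mixed b ->
  pscan f h b g w = 0.
Proof.
move=> vf Qb Qw [p [q [pb qb pq]]]; apply: (@pscan_dead _ _ valid) => // c Qc.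
apply: vf => [z|]; first by rewrite mem_cat => /orP[/Qb|/Qc].
by exists p, q; rewrite !mem_cat pb qb.
Qed.

(** Skipping [y] opens a gap of moment zero, and letting it join makes the block mixed. *)
Lemma pscan_alt f b z y v : vanish f ->
    (forall w, altc w -> w != [::] -> (size w <= size (y :: v))%N -> cmoment w = 0) ->
    Qs (rcons b z) -> altc (y :: v) -> neq z y ->
  pscan f cmoment (rcons b z) [::] (y :: v) = 0.
Proof.
move=> vf h0 Qb al zy /=; have [V _ _] := al.
rewrite (@pscan_gap0 f (rcons b z) [:: y] v) // add0r vanish_pscan ?mulr0 //.
- move=> x; rewrite mem_rcons inE => /orP[/eqP->|/Qb //].
  by apply: V; rewrite inE eqxx.
- by move=> x xv; apply: V; rewrite inE xv orbT.
- by exists z, y; rewrite !mem_rcons !inE !mem_rcons !inE !eqxx orbT.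
Qed.

Lemma vanish_freeness : vanish ckappa -> freeness.
Proof.
move=> vK; suff E N w : (size w < N)%N -> altc w -> w != [::] -> cmoment w = 0.
  by move=> w; apply: E (ltnSn _).
elim: N w => // N IH [|a [|y v]] // lt_N al _.
  have [_ C _] := al.
  by rewrite cmomentE /= mprod_cons mprod1 mulr1 C // inE eqxx.
have [V C /andP[ay S]] := al.
rewrite cmoment_cons -[[:: a]]/(rcons [::] a); apply: pscan_alt => //.
- by move=> w aw w0 sw; apply: IH => //; exact: leq_ltn_trans sw lt_N.
- by move=> z; rewrite inE => /eqP->; apply: V; rewrite inE eqxx.
- by have [] := @altc_cat [:: a] _ al.
Qed.

Lemma ckappa1 p : ckappa [:: p] = tau p.2.
Proof.
have := cmoment_cons p [::]; rewrite /= cmoment0 mulr1 => <-.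
by rewrite cmomentE /= mprod_cons mprod1 mulr1.
Qed.

Lemma ckappa2 p q : tau p.2 = 0 -> ckappa [:: p; q] = tau (p.2 * q.2).
Proof.
move=> p0; have := cmoment_cons p [:: q]; rewrite /= cmoment0 ckappa1 p0 mul0r add0r mulr1 mul1r => <-.
by rewrite cmomentE /= !mprod_cons mprod1 mulr1.
Qed.

Lemma cmoment1 p : cmoment [:: p] = tau p.2.
Proof. by rewrite cmomentE /= mprod_cons mprod1 mulr1. Qed.

Lemma ckappa3 p q r : tau p.2 = 0 -> tau q.2 = 0 -> tau r.2 = 0 ->
  ckappa [:: p; q; r] = tau (p.2 * q.2 * r.2).
Proof.
move=> p0 q0 r0; have := cmoment_cons p [:: q; r].
rewrite /= cmoment0 !cmoment1 ckappa1 p0 q0 r0 !(mul0r, mulr0, add0r, mulr1, mul1r) => <-.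
by rewrite cmomentE /= !mprod_cons mprod1 mulr1 mulrA.
Qed.

Definition centre p : X := (p.1, - tau p.2 *: 1 + p.2).

Lemma valid_centre p : valid p -> valid (centre p).
Proof. by rewrite /valid /=; case: (subalg p.1) => S1 SD _ _ Sp; exact: SD. Qed.

Lemma tau_centre p : tau (centre p).2 = 0.
Proof. by rewrite tau_lin tau1 mulr1 addNr. Qed.

Lemma centre_sum p : p.2 = tau p.2 *: 1 + (centre p).2.
Proof. by rewrite /= addrA scaleNr subrr add0r. Qed.

(** Entries are centred one at a time, [u] being the prefix already treated: the entry changes by a
    multiple of 1, and cumulants with 1 among several entries vanish. *)
Lemma centre_word (f : seq A -> CC) u v : multilin f ->
    (forall w1 w2 : seq A, w1 ++ w2 != [::] -> f (w1 ++ 1 :: w2) = 0) ->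
    (1 < size (u ++ v))%N ->
  f (map snd (u ++ v)) = f (map snd (u ++ map centre v)).
Proof.
move=> mf f1; elim: v u => [|p v IH] u sz //.
have := IH (rcons u (centre p)); rewrite !cat_rcons => <-; last first.
  by move: sz; rewrite !size_cat.
rewrite !map_cat /= {1}centre_sum mf f1 ?mulr0 ?add0r //.
by move: sz; rewrite -size_eq0 !size_cat !size_map /=; lia.
Qed.

Lemma mixed_centre w : mixed w -> mixed (map centre w).
Proof.
by move=> [p [q [pw qw pq]]]; exists (centre p), (centre q); rewrite !map_f.
Qed.

Lemma Qs_centre w : Qs w -> Qs (map centre w).
Proof. by move=> Q z /mapP[y /Q yw ->]; exact: valid_centre. Qed.

Lemma mixed_size w : mixed w -> (1 < size w)%N.
Proof.
case: w => [|a [|b w]] // [p [q []]]; rewrite ?inE //.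
by move=> /eqP-> /eqP->; rewrite eqxx.
Qed.

Lemma unsorted_split w : ~~ sorted neq w ->
  exists u p q v, w = u ++ p :: q :: v /\ p.1 = q.1.
Proof.
elim: w => // a [|b w] IH //= /nandP[|/IH[u [p [q [v [-> E]]]]]].
  by rewrite negbK => /eqP E; exists [::], a, b, w.
by exists (a :: u), p, q, v.
Qed.

Lemma rotate_other u p q v : mixed (u ++ p :: q :: v) -> p.1 = q.1 ->
  exists i r v1 v2, rot i (u ++ p :: q :: v) = r :: v1 ++ p :: q :: v2 /\ r.1 != p.1.
Proof.
move=> [x [y [xw yw xy]]] E.
have [r rw rp] : exists2 r, r \in u ++ p :: q :: v & r.1 != p.1.
  by have [e|] := eqVneq x.1 p.1; [exists y => //; rewrite -e eq_sym|exists x].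
move: rw; rewrite mem_cat !inE => /or4P[ru|/eqP e|/eqP e|rv].
- case/splitPr: ru => v1 v2; exists (size v1), r, v2, (v ++ v1).
  by rewrite -catA rot_size_cat /= -catA.
- by rewrite e eqxx in rp.
- by rewrite e E eqxx in rp.
case/splitPr: rv => v1 v2; exists (size (u ++ p :: q :: v1)), r, (v2 ++ u), v1.
have -> : u ++ p :: q :: v1 ++ r :: v2 = (u ++ p :: q :: v1) ++ r :: v2 by rewrite -catA.
by rewrite rot_size_cat /= -catA.
Qed.

Definition merge p q : X := (p.1, p.2 * q.2).

Lemma valid_merge p q : valid p -> valid q -> p.1 = q.1 -> valid (merge p q).
Proof.
rewrite /valid /= => Sp + E; rewrite -E => Sq.
by case: (subalg p.1) => _ _ SM _; exact: SM.
Qed.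

Lemma cmoment_merge p q g1 g2 : cmoment (g1 ++ [:: p; q] ++ g2) = cmoment (g1 ++ [:: merge p q] ++ g2).
Proof. by rewrite !cmomentE !map_cat !mprod_cat /= !mprod_cons mprod1 !mulr1. Qed.

Lemma cmoment'_merge p q g1 g2 : cmoment' (g1 ++ [:: p; q] ++ g2) = cmoment' (g1 ++ [:: merge p q] ++ g2).
Proof. by rewrite !cmoment'E !map_cat !mprod_cat /= !mprod_cons mprod1 !mulr1. Qed.

Lemma cmoment_merge_t p q g1 g2 : cmoment (g1 ++ rev (map tl [:: p; q]) ++ g2) =
  cmoment (g1 ++ rev (map tl [:: merge p q]) ++ g2).
Proof.
rewrite !cmomentE !map_cat !mprod_cat; congr (tau (_ * (_ * _))).
by rewrite /= !mprod_cons mprod1 !mulr1 tM.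
Qed.

Lemma vanish_dead f a y : vanish f -> valid a -> valid y -> a.1 != y.1 -> dead valid a f y.
Proof.
move=> vf Qa Qy ay u c Qu Qc; apply: vf.
  by move=> z; rewrite inE mem_cat inE => /or4P[/eqP->|/Qu|/eqP->|/Qc].
by exists a, y; rewrite !inE !mem_cat !inE !eqxx !orbT.
Qed.

Lemma vanish_trunc f N : (forall w, (size w < N)%N -> Qs w -> mixed w -> f w = 0) ->
  vanish (trunc N f).
Proof. by move=> fN w Qw mw; rewrite /trunc; case: ifP => // lt_N; exact: fN. Qed.

Lemma freeness_vanish : freeness -> vanish ckappa.
Proof.
move=> fr; suff E N w : (size w < N)%N -> Qs w -> mixed w -> ckappa w = 0.
  by move=> w; apply: E (ltnSn _).
elim: N w => // N IH w0 lt_N Qw0 mw0.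
have -> : ckappa w0 = ckappa (map centre w0).
  apply: (@centre_word (kappa tau) [::] w0); last exact: mixed_size.
    exact: multilin_kappa space.
  exact: kappa_unit space.
have Qw := Qs_centre Qw0; have mw := mixed_centre mw0.
have Cw z : z \in map centre w0 -> tau z.2 = 0 by move=> /mapP[y _ ->]; exact: tau_centre.
have {}lt_N : (size (map centre w0) < N.+1)%N by rewrite size_map.
move: Qw mw Cw lt_N; set w := map centre w0; move: w => w Qw mw Cw lt_N {w0 Qw0 mw0}.
have IHt n : (n <= N)%N -> vanish (trunc n ckappa).
  by move=> le_n; apply: vanish_trunc => v lt_v; apply: IH; exact: leq_trans lt_v le_n.
have [S|/unsorted_split[u [p [q [v [Ew pq]]]]]] := boolP (sorted neq w).
  have al : altc w by split.
  case: w al lt_N mw {Qw Cw S} => [|a [|y v]] al lt_N mw.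
  - by case: mw => p [q []].
  - by have := mixed_size mw.
  rewrite ckappa_top fr // sub0r -[[:: a]]/(rcons [::] a).
  have [V C /andP[ay S]] := al; rewrite pscan_alt ?oppr0 //.
  - exact: IHt.
  - by move=> *; apply: fr.
  - by move=> z; rewrite inE => /eqP->; apply: V; rewrite inE eqxx.
  - by have [] := @altc_cat [:: a] _ al.
rewrite Ew in mw; have [i [r [v1 [v2 [Er rp]]]]] := rotate_other mw pq.
have Qr z : z \in r :: v1 ++ p :: q :: v2 -> valid z by rewrite -Er mem_rot -Ew; exact: Qw.
have sw : size w = (size (v1 ++ v2)).+3.
  by rewrite Ew -(size_rot i) Er /= !size_cat /= !addnS.
rewrite Ew -(ckappa_rot i) Er.
have Qv1 z : z \in v1 -> valid z by move=> zv; apply: Qr; rewrite !(inE, mem_cat) zv !orbT.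
have Qv2 z : z \in v2 -> valid z by move=> zv; apply: Qr; rewrite !(inE, mem_cat) zv !orbT.
have Qp : valid p by apply: Qr; rewrite !(inE, mem_cat) eqxx !orbT.
have Qq : valid q by apply: Qr; rewrite !(inE, mem_cat) eqxx !orbT.
have Qr' : valid r by apply: Qr; rewrite !(inE, mem_cat) eqxx.
have Qm := valid_merge Qp Qq pq.
have sz : size (v1 ++ p :: q :: v2) = (size (v1 ++ v2)).+2 by rewrite !size_cat /= !addnS.
rewrite ckappa_top sz; set F := trunc _ ckappa.
have vF : vanish F by apply: IHt; rewrite -ltnS -sw.
have rq : r.1 != q.1 by rewrite -pq.
have -> : pscan F cmoment [:: r] [::] (v1 ++ p :: q :: v2) =
    pscan F cmoment [:: r] [::] (v1 ++ [:: merge p q] ++ v2).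
  apply: (@pscan_repl _ _ valid r F cmoment [:: p; q] [:: merge p q] [::] [::] v1 v2) => //.
  - by move=> z; rewrite !inE => /orP[] /eqP->; exact: vanish_dead.
  - by move=> z; rewrite !inE => /eqP->; exact: vanish_dead.
  - by move=> z; rewrite !inE => /orP[] /eqP->.
  - by move=> z; rewrite !inE => /eqP->.
  - exact: cmoment_merge.
(* The truncation is at the length of the original word, so the merged word, one letter shorter,
   keeps all its cumulants. *)
have -> : pscan F cmoment [:: r] [::] (v1 ++ [:: merge p q] ++ v2) = cmoment (r :: v1 ++ [:: merge p q] ++ v2).
  rewrite cmoment_cons; apply: (@pscan_lt _ _ _ _ (size (v1 ++ v2)).+3) => //.
    by move=> c lt_c; rewrite /F /trunc lt_c.
  by rewrite !size_cat /= !addnS.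
by rewrite -[r :: _ ++ p :: _]cat_cons -[r :: _ ++ _ ++ _]cat_cons -cmoment_merge subrr.
Qed.

End Coloured.

(** * Alternating words and the formulas for freeness *)

Section Alternating.
Variables (A : algType CC) (tau tau' : A -> CC) (t : A -> A) (s : nat).
Variable Asub : 'I_s -> A -> Prop.
Hypothesis space : tracial_real_inf_space tau tau' t.
Hypothesis subalg : forall r, t_invariant_unital_subalg t (Asub r).

Let tau_lin : lin tau. Proof. by case: space => _ [H _]. Qed.
Let taut a : tau (t a) = tau a. Proof. by case: space. Qed.

Local Notation X := ('I_s * A)%type.
Implicit Types (w u v g : seq X) (p q a : X).
Local Notation tl := (@tl A t s).
Local Notation valid := (@valid A s Asub).
Local Notation Qs w := (forall z, z \in w -> valid z).
Local Notation ckappa := (@ckappa A tau s).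
Local Notation ckappa' := (@ckappa' A tau tau' t s).
Local Notation cmoment := (@cmoment A tau s).
Local Notation cmoment' := (@cmoment' A tau' s).
Local Notation altc := (@altc A tau s Asub).
Local Notation freeness := (@freeness A tau s Asub).
Local Notation vanish := (@vanish A s Asub).
Local Notation mixed := (@mixed A s).
Local Notation centre := (@centre A tau s).

Fixpoint pairing (g h : seq X) : CC :=
  match g, h with
  | [::], [::] => 1
  | p :: g', q :: h' => tau (t p.2 * q.2) * pairing g' h'
  | _, _ => 0
  end.

(** In the middle [t p] meets [q]. If their colours differ, the word alternates and both sides are
    zero. If not, the product is a scalar plus a centred element: the centred part gives an
    alternating word of moment zero, the scalar shortens both halves. *)
Lemma moment_fold g h : freeness -> altc g -> altc h -> cmoment (rev (map tl g) ++ h) = pairing g h.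
Proof.
move=> fr; elim: g h => [|p g IH] [|q h] ag ah.
- by rewrite (cmoment0 s space).
- by rewrite fr.
- have aP := altc_mirror space subalg ag.
  by rewrite cats0 fr //= -size_eq0 size_rev.
have [Vg Cg Sg] := ag; have [Vh Ch Sh] := ah.
have ag' : altc g by have [] := @altc_cat _ _ _ _ [:: p] g ag.
have ah' : altc h by have [] := @altc_cat _ _ _ _ [:: q] h ah.
have Vp : valid (tl p) by apply: (valid_tl subalg); apply: Vg; rewrite inE eqxx.
have Vq : valid q by apply: Vh; rewrite inE eqxx.
have Cp : tau p.2 = 0 by apply: Cg; rewrite inE eqxx.
have Cq : tau q.2 = 0 by apply: Ch; rewrite inE eqxx.
have [pq|pq] := eqVneq p.1 q.1; last first.
  have al2 : altc [:: tl p; q].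
    split=> [z|z|]; first by rewrite !inE => /orP[] /eqP->.
      by rewrite !inE => /orP[] /eqP->; rewrite //= taut.
    by rewrite /= /neq /= pq.
  have -> : pairing (p :: g) (q :: h) = 0.
    have := fr _ al2 isT; rewrite cmomentE /= !mprod_cons mprod1 mulr1 => ->.
    by rewrite mul0r.
  apply: fr; last by rewrite -size_eq0 size_cat /= addnS.
  have [V1 C1 S1] := altc_mirror space subalg ag; split.
  - by move=> z; rewrite mem_cat => /orP[/V1|/Vh].
  - by move=> z; rewrite mem_cat => /orP[/C1|/Ch].
  rewrite /= rev_cons cat_rcons; apply: sorted_rev_cat.
    by have [] := altc_tl space subalg ag.
  by rewrite /= /neq /= pq.
set c := tau (t p.2 * q.2).
pose z : X := merge (tl p) q; pose z0 := centre z.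
have Vz : valid z by apply: (valid_merge subalg).
have az : altc (z0 :: h).
  split=> [x|x|].
  - by rewrite inE => /orP[/eqP->|xh]; [exact: (valid_centre tau subalg)|apply: Vh; rewrite inE xh orbT].
  - by rewrite inE => /orP[/eqP->|xh]; [exact: (tau_centre space)|apply: Ch; rewrite inE xh orbT].
  by case: (h) Sh => //= y h1; rewrite /neq /= pq.
have E : cmoment (rev (map tl (p :: g)) ++ q :: h) =
    c * cmoment (rev (map tl g) ++ h) + cmoment (rev (map tl g) ++ z0 :: h).
  rewrite /= rev_cons cat_rcons.
  have := cmoment_merge tau (tl p) q (rev (map tl g)) h => /= ->.
  rewrite !cmomentE !map_cat !mprod_cat /= !mprod_cons.
  rewrite {1}(_ : t p.2 * q.2 = c *: 1 + z0.2); last exact: (centre_sum tau z).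
  by rewrite [in LHS]mulrDl [in LHS]mulrDr -scalerAl mul1r -scalerAr tau_lin.
rewrite E IH // fr ?addr0 //; last by rewrite -size_eq0 size_cat /= addnS.
have [V1 C1 S1] := altc_mirror space subalg ag'; have [V2 C2 S2] := az; split.
- by move=> x; rewrite mem_cat => /orP[/V1|/V2].
- by move=> x; rewrite mem_cat => /orP[/C1|/C2].
case: g {IH E S1 V1 C1} ag ag' Vg Cg Sg => // y g ag ag' Vg Cg /andP[py Sg].
rewrite /= rev_cons cat_rcons; apply: sorted_rev_cat.
  by have [] := altc_tl space subalg ag'.
by move: S2 py => /= ->; rewrite /neq /= andbT eq_sym.
Qed.

(** The contribution of a twist at [x], with [g] before and [r] behind it: the block of [a] is
    [a, tl x], or it contains the last letter of [r] in addition. *)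
Definition gterm (a : X) (g : seq X) (x : X) (r : seq X) : CC :=
  ckappa [:: a; tl x] * cmoment (rev (map tl g) ++ r) +
  (if r is y :: r' then ckappa [:: a; tl x; last y r'] * cmoment (rev (map tl g) ++ belast y r') else 0).

(** The term in which the first and the last letter form a block; it becomes
    [tau(a_1 a_n) tau'(a_2 ... a_{n-1})] in (3) and (4). *)
Definition top (a : X) (L : seq X) : CC := if L is y :: L' then cmoment' (belast y L') * ckappa [:: a; last y L'] else 0.

Lemma pscan_skip_mirror b u v w : freeness -> u != [::] -> altc (u ++ v) ->
  pscan ckappa cmoment b u (v ++ w) = pscan ckappa cmoment b (u ++ v) w.
Proof.
move=> fr; elim: v u => [|y v IH] u u0 al /=; first by rewrite cats0.
have [au _] := altc_cat al.
rewrite fr // mul0r addr0 IH ?cat_rcons //.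
by case: (u).
Qed.

(** If a letter of [v] joins the block and is not the last, the next letter has another colour and
    [pscan_alt] makes the term zero. *)
Lemma pscan_last b u v : freeness -> vanish ckappa -> Qs b -> altc v ->
  pscan ckappa cmoment b u v = ckappa b * cmoment (u ++ v) +
    (if v is y :: v' then ckappa (rcons b (last y v')) * cmoment (u ++ belast y v') else 0).
Proof.
move=> fr vK; elim: v u => [|y v IH] u Qb al /=; first by rewrite cats0 addr0.
have av : altc v by have [] := @altc_cat _ _ _ _ [:: y] v al.
rewrite IH // cat_rcons; case: v {IH} al av => [|z v] al av.
  by rewrite /= (cmoment0 s space) mulr1 addr0 cats0 [cmoment u * _]mulrC.
have [V C /andP[yz S]] := al.
rewrite (pscan_alt vK (b := b) (z := y)) ?mulr0 ?addr0 //.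
- by rewrite cat_rcons.
- by move=> *; apply: fr.
- move=> x; rewrite mem_rcons inE => /orP[/eqP->|/Qb //].
  by apply: V; rewrite inE eqxx.
Qed.

(** If [a] and [x] differ in colour, every block is mixed. Otherwise [g] is not empty, and after the
    reversal the neighbour of [x] comes first. It cannot join, being of another colour; the gap it
    opens has moment zero as long as it ends inside the reversed [g], so no letter of [g] joins. *)
Lemma gtermE a g x r : freeness -> vanish ckappa -> altc (a :: g ++ x :: r) ->
  pscan ckappa cmoment [:: a; tl x] [::] (rev (map tl g) ++ r) = gterm a g x r.
Proof.
move=> fr vK al; have [V C S] := al.
have Va : valid a by apply: V; rewrite inE eqxx.
have Vx : valid (tl x) by apply: (valid_tl subalg); apply: V; rewrite inE mem_cat inE eqxx !orbT.
have [_ agx] := @altc_cat _ _ _ _ [:: a] _ al.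
have [ag axr] := altc_cat agx.
have ar : altc r by have [] := @altc_cat _ _ _ _ [:: x] r axr.
have am := altc_mirror space subalg ag.
have Qb : Qs [:: a; tl x] by move=> z; rewrite !inE => /orP[] /eqP->.
have [ax|ax] := eqVneq a.1 x.1; last first.
  have mx : mixed [:: a; tl x] by exists a, (tl x); rewrite !inE !eqxx orbT.
  have [Vm _ _] := am; have [Vr _ _] := ar.
  rewrite (vanish_pscan cmoment _ vK) //; last by move=> z; rewrite mem_cat => /orP[/Vm|/Vr].
  rewrite /gterm vK // mul0r add0r; case: (r) Vr => // y r' Vr.
  rewrite vK ?mul0r //; last by exists a, (tl x); rewrite !inE !eqxx orbT.
  by move=> z; rewrite !inE => /or3P[] /eqP->//; apply: Vr; exact: mem_last.
case/lastP: g al V C S agx ag am => [|g y] al V C S agx ag am.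
  by move: S; rewrite /= /neq ax eqxx.
rewrite map_rcons rev_rcons cat_cons /=.
have yx : y.1 != x.1.
  have [_ _] := agx; rewrite cat_rcons => /cat_sorted2[_] /= /andP[].
  by [].
have Vy : valid (tl y).
  by apply: (valid_tl subalg); apply: V; rewrite inE mem_cat mem_rcons inE eqxx !orbT.
have Vgr : Qs (rev (map tl g) ++ r).
  have [Vr _ _] := ar; have [Vm _ _] := am => z; rewrite mem_cat => /orP[zg|/Vr//].
  by apply: Vm; rewrite map_rcons rev_rcons inE zg orbT.
rewrite (@vanish_pscan _ _ Asub ckappa cmoment [:: a; tl x; tl y]) //; first last.
- by exists (tl x), (tl y); rewrite !inE !eqxx !orbT /= eq_sym.
- by move=> z; rewrite !inE => /or3P[] /eqP->.
rewrite mulr0 addr0 pscan_skip_mirror //; last by move: am; rewrite map_rcons rev_rcons.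
rewrite pscan_last //= /gterm map_rcons rev_rcons cat_cons.
congr (_ + _); case: (r) => // z r'.
Qed.

Lemma top_rcons a g x : top a (rcons g x) = cmoment' g * ckappa [:: a; x].
Proof.
case: g => [|y g] //=.
by rewrite belast_rcons last_rcons.
Qed.

(** When [x] joins untwisted with the gap weighted by [cmoment], the gap has moment zero or is
    empty, and then [x] is a neighbour of [a] of another colour. With the weight [cmoment'] the
    letters behind [x] give zero unless there are none, which leaves [top]. All twists remain. *)
Lemma phi_alt F' a g r : freeness -> vanish ckappa -> vanish F' -> altc (a :: g ++ r) -> g ++ r != [::] ->
  phi tl ckappa F' cmoment cmoment' [:: a] g r = (if nilp r then 0 else top a (g ++ r)) +
    \sum_(i < size r) gterm a (g ++ take i r) (nth a r i) (drop i.+1 r).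
Proof.
move=> fr vK vF; elim: r g => [|x r IH] g al n0.
  rewrite /= big_ord0 addr0; have [V C S] := al; rewrite cats0 in al n0.
  have [_ ag] := @altc_cat _ _ _ _ [:: a] _ al.
  (* The weight of [[:: a]] under [F'] need not be zero; this term is killed by the moment of the
     gap, and the other one by [tau a = 0]. *)
  rewrite (fr g) // mulr0 add0r (ckappa1 space) C ?mul0r //.
  by rewrite inE eqxx.
have [V C S] := al.
have [_ agx] := @altc_cat _ _ _ _ [:: a] _ al.
have [ag axr] := altc_cat agx.
have Va : valid a by apply: V; rewrite inE eqxx.
have Vx : valid x by apply: V; rewrite inE mem_cat inE eqxx !orbT.
have Vr : Qs r by move=> z zr; apply: V; rewrite inE mem_cat inE zr !orbT.
rewrite [LHS]/= IH ?cat_rcons //.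
rewrite [size _]/= big_ord_recl /= cats0 drop0 gtermE //.
have -> : cmoment g * phi tl ckappa F' cmoment cmoment' [:: a; x] [::] r = 0.
  have [g0|g0] := eqVneq g [::]; last by rewrite fr // mul0r.
  rewrite g0 /= in S; case/andP: S => ax _.
  have ok f : vanish f -> forall c, Qs c -> f ([:: a; x] ++ c) = 0.
    move=> vf c Qc; apply: vf.
      by move=> z; rewrite mem_cat !inE => /orP[/orP[] /eqP->|/Qc].
    by exists a, x; rewrite !inE !eqxx orbT.
  rewrite (@phi_dead _ _ tl valid) ?mulr0 //; [exact: (valid_tl subalg)|exact: ok|exact: ok].
rewrite add0r.
have -> : (if nilp r then 0 else top a (g ++ x :: r)) + \sum_(i < size r) gterm a (rcons g x ++ take i r) (nth a r i) (drop i.+1 r)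
   + (cmoment' g * pscan ckappa cmoment [:: a; x] [::] r + gterm a g x r) =
   top a (g ++ x :: r) + (gterm a g x r + \sum_(i < size r) gterm a (rcons g x ++ take i r) (nth a r i) (drop i.+1 r)).
  case: r {IH V C S al agx n0} axr Vr => [|y r] axr Vr.
    rewrite /= cats1 top_rcons big_ord0 (cmoment0 s space) mulr1; ring.
  have [_ _ /andP[xy _]] := axr.
  rewrite (pscan_alt vK (b := [:: a]) (z := x)) //; first by rewrite mulr0 /=; ring.
  - by move=> *; apply: fr.
  - by move=> z; rewrite !inE => /orP[] /eqP->.
  - by have [] := @altc_cat _ _ _ _ [:: x] _ axr.
congr (_ + (_ + _)); apply: eq_bigr => i _.
by rewrite cat_rcons.
Qed.

Definition rhs a L : CC := top a L + \sum_(i < size L) gterm a (take i L) (nth a L i) (drop i.+1 L).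

Lemma phi_rhs F' a L : freeness -> vanish ckappa -> vanish F' -> altc (a :: L) -> L != [::] ->
  phi tl ckappa F' cmoment cmoment' [:: a] [::] L = rhs a L.
Proof.
by move=> fr vK vF al L0; rewrite phi_alt // /rhs; case: (L) L0.
Qed.

(** Conditions (2), (3) and (4) in one formula, independent of the parity of the length. *)
Definition inf_freeness := forall a L, altc (a :: L) -> L != [::] -> cmoment' (a :: L) = rhs a L.

Lemma vanish_inf_freeness : freeness -> vanish ckappa -> vanish ckappa' -> inf_freeness.
Proof. by move=> fr vK vK' a L al L0; rewrite (cmoment'_cons space) phi_rhs. Qed.

Lemma inf_freeness_vanish : freeness -> vanish ckappa -> inf_freeness -> vanish ckappa'.
Proof.
move=> fr vK fr'; suff E N w : (size w < N)%N -> Qs w -> mixed w -> ckappa' w = 0.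
  by move=> w; apply: E (ltnSn _).
elim: N w => // N IH w0 lt_N Qw0 mw0.
have -> : ckappa' w0 = ckappa' (map centre w0).
  apply: (@centre_word _ tau _ (kappa' tau tau' t) [::] w0); last exact: mixed_size.
    exact: multilin_kappa' space.
  exact: kappa'_unit space.
have Qw : Qs (map centre w0) by exact: Qs_centre.
have mw : mixed (map centre w0) by exact: mixed_centre.
have Cw z : z \in map centre w0 -> tau z.2 = 0.
  by move=> /mapP[y _ ->]; exact: (tau_centre space).
have {}lt_N : (size (map centre w0) < N.+1)%N by rewrite size_map.
move: Qw mw Cw lt_N; set w := map centre w0; move: w => w Qw mw Cw lt_N {w0 Qw0 mw0}.
have IHt n : (n <= N)%N -> vanish (trunc n ckappa').
  by move=> le_n; apply: vanish_trunc => v lt_v; apply: IH; exact: leq_trans lt_v le_n.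
have [S|/unsorted_split[u [p [q [v [Ew pq]]]]]] := boolP (sorted (@neq A s) w).
  have al : altc w by split.
  case: w al lt_N mw {Qw Cw S} => [|a [|y v]] al lt_N mw.
  - by case: mw => p [q []].
  - by have := mixed_size mw.
  by rewrite (ckappa'_top space) fr' // phi_rhs ?subrr //; exact: IHt.
rewrite Ew in mw; have [i [r [v1 [v2 [Er rp]]]]] := rotate_other mw pq.
have Qr z : z \in r :: v1 ++ p :: q :: v2 -> valid z by rewrite -Er mem_rot -Ew; exact: Qw.
have sw : size w = (size (v1 ++ v2)).+3.
  by rewrite Ew -(size_rot i) Er /= !size_cat /= !addnS.
rewrite Ew -(ckappa'_rot space i) Er.
have Qv1 z : z \in v1 -> valid z by move=> zv; apply: Qr; rewrite !(inE, mem_cat) zv !orbT.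
have Qv2 z : z \in v2 -> valid z by move=> zv; apply: Qr; rewrite !(inE, mem_cat) zv !orbT.
have Qp : valid p by apply: Qr; rewrite !(inE, mem_cat) eqxx !orbT.
have Qq : valid q by apply: Qr; rewrite !(inE, mem_cat) eqxx !orbT.
have Qr' : valid r by apply: Qr; rewrite !(inE, mem_cat) eqxx.
have Qm := valid_merge subalg Qp Qq pq.
have sz : size (v1 ++ p :: q :: v2) = (size (v1 ++ v2)).+2 by rewrite !size_cat /= !addnS.
rewrite (ckappa'_top space) sz; set F := trunc _ ckappa'.
have vF : vanish F by apply: IHt; rewrite -ltnS -sw.
have rq : r.1 != q.1 by rewrite -pq.
have dd y : valid y -> r.1 != y.1 -> [/\ dead valid r ckappa y, dead valid r ckappa (tl y) & dead valid r F y].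
  by move=> Vy ry; split; apply: vanish_dead => //; exact: (valid_tl subalg).
have -> : phi tl ckappa F cmoment cmoment' [:: r] [::] (v1 ++ p :: q :: v2) =
    phi tl ckappa F cmoment cmoment' [:: r] [::] (v1 ++ [:: merge p q] ++ v2).
  apply: (@phi_replace _ _ tl valid r ckappa F cmoment cmoment' _ [:: p; q] [:: merge p q] _ _ _ _ _ _ _ [::] [::] v1 v2) => //.
  - exact: (valid_tl subalg).
  - by move=> z; rewrite !inE => /orP[] /eqP->.
  - by move=> z; rewrite !inE => /eqP->.
  - by move=> z; rewrite !inE => /orP[] /eqP->; exact: dd.
  - by move=> z; rewrite !inE => /eqP->; exact: dd.
  - exact: cmoment_merge.
  - exact: cmoment'_merge.
  - by move=> g1 g2; apply: (cmoment_merge_t space).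
have -> : phi tl ckappa F cmoment cmoment' [:: r] [::] (v1 ++ [:: merge p q] ++ v2) = cmoment' (r :: v1 ++ [:: merge p q] ++ v2).
  rewrite (cmoment'_cons space); apply: (@phi_lt _ _ _ _ _ _ _ _ (size (v1 ++ v2)).+3) => //.
    by move=> c lt_c; rewrite /F /trunc lt_c.
  by rewrite !size_cat /= !addnS.
by rewrite -[r :: _ ++ p :: _]cat_cons -[r :: _ ++ _ ++ _]cat_cons -cmoment'_merge subrr.
Qed.

End Alternating.

(** * Evaluation of the alternating formula, by parity of the length *)

Section Evaluation.
Variables (A : algType CC) (tau tau' : A -> CC) (t : A -> A) (s : nat).
Variable Asub : 'I_s -> A -> Prop.
Hypothesis space : tracial_real_inf_space tau tau' t.
Hypothesis subalg : forall r, t_invariant_unital_subalg t (Asub r).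

Let taut a : tau (t a) = tau a. Proof. by case: space. Qed.
Let tauM x y : tau (t x * y) = tau (x * t y).
Proof.
case: space => -[_ tM tK] _ _ _ [tauC _].
by rewrite -[LHS]taut tM tK tauC.
Qed.

Local Notation X := ('I_s * A)%type.
Implicit Types (w u v g : seq X) (p q a : X).
Local Notation tl := (@tl A t s).
Local Notation valid := (@valid A s Asub).
Local Notation ckappa := (@ckappa A tau s).
Local Notation cmoment := (@cmoment A tau s).
Local Notation cmoment' := (@cmoment' A tau' s).
Local Notation altc := (@altc A tau s Asub).
Local Notation freeness := (@freeness A tau s Asub).
Local Notation vanish := (@vanish A s Asub).
Local Notation pairing := (@pairing A tau t s).
Local Notation gterm := (@gterm A tau t s).
Local Notation top := (@top A tau tau' s).
Local Notation rhs := (@rhs A tau tau' t s).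

Lemma gtermP a g x r : freeness -> altc (a :: g ++ x :: r) ->
  gterm a g x r = ckappa [:: a; tl x] * pairing g r +
    (if r is y :: r' then ckappa [:: a; tl x; last y r'] * pairing g (belast y r') else 0).
Proof.
move=> fr al; have [_ agx] := @altc_cat _ _ _ _ [:: a] _ al.
have [ag axr] := altc_cat agx.
have [_ ar] := @altc_cat _ _ _ _ [:: x] r axr.
rewrite /gterm (moment_fold space subalg) //; congr (_ + _).
case: r ar {axr agx al} => // y r; rewrite lastI -cats1 => /altc_cat[ab _].
by rewrite (moment_fold space subalg).
Qed.

Lemma pairing_neq g r : size g != size r -> pairing g r = 0.
Proof.
elim: g r => [|p g IH] [|q r] //= neq_gr.
by rewrite IH ?mulr0.
Qed.

(** A fold of two words of different lengths is zero, so only the twist at the middle letter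
    survives; by parity the last letter cannot join it. The word [a :: g ++ x :: r] has even length,
    so this serves (4). *)
Lemma rhs_odd a g x r : freeness -> altc (a :: g ++ x :: r) -> size g = size r ->
  rhs a (g ++ x :: r) = top a (g ++ x :: r) + ckappa [:: a; tl x] * pairing g r.
Proof.
move=> fr al sz; rewrite /rhs; congr (_ + _).
have D : drop (size g).+1 (g ++ x :: r) = r by rewrite -cat_rcons -(size_rcons g x) drop_size_cat.
have lt_g : (size g < size (g ++ x :: r))%N by rewrite size_cat /= addnS ltnS leq_addr.
rewrite (bigD1 (Ordinal lt_g)) //= take_size_cat // nth_cat ltnn subnn /=.
rewrite D gtermP // big1 => [|i ne_i].
  rewrite addr0; case: (r) sz => [|y r'] sz; first by rewrite addr0.
  by rewrite [X in _ + _ * X]pairing_neq ?mulr0 ?addr0 // sz size_belast /= -addn1 -{2}[size r']addn0 eqn_add2l.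
have {}ne_i : nat_of_ord i != size g by [].
move: ne_i (ltn_ord i); move: (nat_of_ord i) => {}i ne_i lt_i.
have E : g ++ x :: r = take i (g ++ x :: r) ++ nth a (g ++ x :: r) i :: drop i.+1 (g ++ x :: r).
  by rewrite -drop_nth // cat_take_drop.
rewrite gtermP; [|by []|by rewrite -E].
have s1 : size (take i (g ++ x :: r)) = i by rewrite size_takel // ltnW.
have s2 : size (drop i.+1 (g ++ x :: r)) = ((size g).*2 - i)%N.
  by rewrite size_drop size_cat /= -sz; move: (size g) => k; clear; lia.
rewrite pairing_neq ?mulr0 ?add0r; last by rewrite s1 s2; move: ne_i; clear; lia.
case: (drop _ _) s2 => // y r' /= s2.
by rewrite pairing_neq ?mulr0 // s1 size_belast; move: ne_i s2; clear; lia.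
Qed.

(** Now the lengths on both sides of the twist match only after the last letter has joined the
    block. This is the source of the factor with three letters in (3), where the whole word has odd
    length. *)
Lemma rhs_even a g x r y : freeness -> altc (a :: g ++ x :: rcons r y) -> size g = size r ->
  rhs a (g ++ x :: rcons r y) = top a (g ++ x :: rcons r y) + ckappa [:: a; tl x; y] * pairing g r.
Proof.
move=> fr al sz; rewrite /rhs; congr (_ + _); set w := rcons r y in al *.
have D : drop (size g).+1 (g ++ x :: w) = w by rewrite -cat_rcons -(size_rcons g x) drop_size_cat.
have lt_g : (size g < size (g ++ x :: w))%N by rewrite size_cat /= addnS ltnS leq_addr.
rewrite (bigD1 (Ordinal lt_g)) //= take_size_cat // nth_cat ltnn subnn /=.
rewrite D gtermP // big1 => [|i ne_i].
  rewrite addr0 pairing_neq ?mulr0 ?add0r; last by rewrite size_rcons sz -addn1 -{1}[size r]addn0 eqn_add2l.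
  by rewrite /w; case: (r) => //= z r'; rewrite belast_rcons last_rcons.
have {}ne_i : nat_of_ord i != size g by [].
move: ne_i (ltn_ord i); move: (nat_of_ord i) => {}i ne_i lt_i.
have E : g ++ x :: w = take i (g ++ x :: w) ++ nth a (g ++ x :: w) i :: drop i.+1 (g ++ x :: w).
  by rewrite -drop_nth // cat_take_drop.
rewrite gtermP; [|by []|by rewrite -E].
have s1 : size (take i (g ++ x :: w)) = i by rewrite size_takel // ltnW.
have s2 : size (drop i.+1 (g ++ x :: w)) = ((size g).*2.+1 - i)%N.
  by rewrite size_drop size_cat /= size_rcons -sz; move: (size g) => k; clear; lia.
rewrite pairing_neq ?mulr0 ?add0r; last by rewrite s1 s2; clear; lia.
case: (drop _ _) s2 => // z r' /= s2.
by rewrite pairing_neq ?mulr0 // s1 size_belast; move: ne_i s2; clear; lia.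
Qed.

Variable c : nat -> X.
Definition word m k := map c (iota m k).

Lemma word_cat m k l : word m (k + l) = word m k ++ word (m + k) l.
Proof. by rewrite /word iotaD map_cat. Qed.

Lemma word_rcons m k : word m k.+1 = rcons (word m k) (c (m + k)).
Proof. by rewrite -addn1 word_cat cats1. Qed.

Lemma cmoment_word m k : cmoment (word m k) = tau (\prod_(i <- iota m k) (c i).2).
Proof. by rewrite cmomentE /mprod !big_map. Qed.

Lemma cmoment'_word m k : cmoment' (word m k) = tau' (\prod_(i <- iota m k) (c i).2).
Proof. by rewrite cmoment'E /mprod !big_map. Qed.

Lemma pairing_word m k d :
  pairing (word m k) (word (m + d) k) = \prod_(i <- iota m k) tau ((c i).2 * t (c (i + d)%N).2).
Proof.
elim: k m => [|k IH] m; first by rewrite big_nil.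
by rewrite /= big_cons tauM -IH.
Qed.

Lemma altc_word n : altc (word 1 n) <->
  [/\ forall i, (0 < i <= n)%N -> valid (c i),
      forall i, (0 < i <= n)%N -> tau (c i).2 = 0
    & forall i, (0 < i < n)%N -> (c i).1 != (c i.+1).1].
Proof.
have mem i : (0 < i <= n)%N -> c i \in word 1 n.
  by move=> i_n; apply: map_f; rewrite mem_iota add1n ltnS.
have nthw i : (i < n)%N -> nth (c 0) (word 1 n) i = c i.+1.
  by move=> lt_i; rewrite (nth_map 0%N) ?size_iota // nth_iota.
split=> [[V C S]|[V C S]]; split.
- by move=> i /mem; exact: V.
- by move=> i /mem; exact: C.
- case=> // i /= lt_i; move/(sortedP (c 0)): S => /(_ i).
  by rewrite size_map size_iota !nthw //; [apply|exact: ltnW].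
- by move=> z /mapP[i + ->]; rewrite mem_iota add1n ltnS; exact: V.
- by move=> z /mapP[i + ->]; rewrite mem_iota add1n ltnS; exact: C.
apply/(sortedP (c 0)) => i; rewrite size_map size_iota => lt_i.
by rewrite !nthw //; [apply: S|exact: ltnW].
Qed.

(** The first term contains [tau' 1 = 0], and the twisted block is mixed. *)
Lemma rhs2 : freeness -> vanish ckappa -> altc (word 1 2) -> rhs (c 1%N) (word 2 1) = 0.
Proof.
move=> fr vK al; have [V C /andP[c12 _]] := al.
rewrite -[word 2 1]/([::] ++ c 2 :: [::]) rhs_odd //= mulr1.
rewrite (cmoment'0 s space) mul0r add0r vK //.
  by move=> z; rewrite !inE => /orP[] /eqP->; [|apply: (valid_tl subalg)]; apply: V; rewrite !inE eqxx ?orbT.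
by exists (c 1%N), (tl (c 2)); rewrite !inE !eqxx !orbT.
Qed.

Lemma top_word n : (2 < n)%N -> tau (c 1%N).2 = 0 -> top (c 1%N) (word 2 n.-1) =
  tau ((c 1%N).2 * (c n).2) * tau' (\prod_(2 <= i < n) (c i).2).
Proof.
case: n => [|[|n]] // _ c1; rewrite [_.-1]/= word_rcons top_rcons.
by rewrite (ckappa2 space) // cmoment'_word mulrC /index_iota subSS subSS subn0.
Qed.

Lemma rhs_word_odd k : freeness -> (2 <= k)%N -> altc (word 1 (2 * k - 1)) ->
  rhs (c 1%N) (word 2 (2 * k - 1).-1) =
  tau ((c 1%N).2 * (c (2 * k - 1)).2) * tau' (\prod_(2 <= i < 2 * k - 1) (c i).2)
  + tau ((c 1%N).2 * t (c k).2 * (c (2 * k - 1)).2)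
    * \prod_(2 <= i < k) tau ((c i).2 * t (c (i + k - 1)).2).
Proof.
case: k => [|[|k]] // fr _ al; have [_ C _] := (altc_word _).1 al.
set n := (_ - _)%N in al C *.
have E : word 2 n.-1 = word 2 k ++ c k.+2 :: rcons (word (2 + k.+1) k) (c n).
  have -> : n.-1 = (k + k.+2)%N by rewrite /n; lia.
  rewrite word_cat; congr (_ ++ _ :: _).
  have -> : c n = c ((2 + k.+1) + k)%N by congr c; rewrite /n; lia.
  by rewrite -word_rcons.
have al1 : altc (c 1%N :: word 2 n.-1) by move: al; rewrite -[n in altc (word 1 n)]prednK //; rewrite /n; lia.
have n_gt2 : (2 < n)%N by rewrite /n; lia.
have c1 : tau (c 1%N).2 = 0 by apply: C; rewrite (ltn_trans _ n_gt2).
rewrite -top_word //; rewrite E in al1 *.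
rewrite rhs_even //; last by rewrite !size_map !size_iota.
have ck : tau (c k.+2).2 = 0 by apply: C; rewrite /n; lia.
have cn : tau (c n).2 = 0 by apply: C; rewrite leqnn (ltn_trans _ n_gt2).
congr (_ + _); rewrite (ckappa3 space) ?taut //.
rewrite pairing_word /index_iota subSS subSS subn0; congr (_ * _).
by apply: eq_bigr => i _; rewrite !addnS subn1.
Qed.

Lemma rhs_word_even k : freeness -> (2 <= k)%N -> altc (word 1 (2 * k)) ->
  rhs (c 1%N) (word 2 (2 * k).-1) =
  tau ((c 1%N).2 * (c (2 * k)).2) * tau' (\prod_(2 <= i < 2 * k) (c i).2)
  + \prod_(1 <= i < k.+1) tau ((c i).2 * t (c (i + k)).2).
Proof.
case: k => [|k] // fr k2 al; have [_ C _] := (altc_word _).1 al.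
set n := (2 * _)%N in al C *.
have E : word 2 n.-1 = word 2 k ++ c k.+2 :: word (2 + k.+1) k.
  have -> : n.-1 = (k + k.+1)%N by rewrite /n; lia.
  by rewrite word_cat.
have al1 : altc (c 1%N :: word 2 n.-1) by move: al; rewrite -[n in altc (word 1 n)]prednK //; rewrite /n; lia.
have n_gt2 : (2 < n)%N by rewrite /n; lia.
have c1 : tau (c 1%N).2 = 0 by apply: C; rewrite (ltn_trans _ n_gt2).
rewrite -top_word //; rewrite E in al1 *.
rewrite rhs_odd //; last by rewrite !size_map !size_iota.
congr (_ + _); rewrite (ckappa2 space) //.
rewrite pairing_word big_ltn // /index_iota; congr (_ * _).
by rewrite subSS subSS subn0.
Qed.

End Evaluation.

Section Equivalence.
Variables (A : algType CC) (tau tau' : A -> CC) (t : A -> A) (s : nat).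
Variable Asub : 'I_s -> A -> Prop.
Hypothesis space : tracial_real_inf_space tau tau' t.
Hypothesis subalg : forall r, t_invariant_unital_subalg t (Asub r).
Local Notation X := ('I_s * A)%type.

Lemma word_nth (x : X) w : word (fun i => nth x w i.-1) 1 (size w) = w.
Proof.
rewrite /word -[1%N]addn0 iotaDl -map_comp -[RHS]take_size -(map_nth_iota0 x (leqnn _)).
by apply: eq_map.
Qed.

Lemma real_inf_freeP : real_inf_free tau tau' t Asub <->
  freeness tau Asub /\ inf_freeness tau tau' t Asub.
Proof.
have wordP w : w != [::] -> exists c : nat -> X, w = word c 1 (size w).
  by case: w => // x w _; exists (fun i => nth x (x :: w) i.-1); rewrite word_nth.
have iotaE m : iota 1 m = index_iota 1 m.+1 by rewrite /index_iota subn1.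
split=> [free|[fr fr'] n a j n_gt0 V C S].
  have fr : freeness tau Asub.
    move=> w al w0; have [c Ew] := wordP w w0.
    have sw : (0 < size w)%N by rewrite lt0n size_eq0.
    move: Ew sw al; move: (size w) => n -> n_gt0 /altc_word[V C S].
    have [F _ _ _] := free _ (fun i => (c i).2) (fun i => (c i).1) n_gt0 V C S.
    by rewrite cmoment_word iotaE.
  have vK := freeness_vanish space subalg fr.
  suff E (c : nat -> X) n : (1 < n)%N -> altc tau Asub (word c 1 n) ->
      cmoment' tau' (word c 1 n) = rhs tau tau' t (c 1%N) (word c 2 n.-1).
    split=> // a L al L0; have [c] := wordP (a :: L) isT.
    rewrite [size _]/= => Ew; have [Ea EL] := Ew.
    have := E c (size L).+1; rewrite -Ew -Ea [_.-1]/= /word -EL; apply=> //.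
    by rewrite ltnS lt0n size_eq0.
  move=> n_gt1 al; have [V C S] := (altc_word _ _ _ _).1 al.
  have [_ F2 F3 F4] := free _ (fun i => (c i).2) (fun i => (c i).1) (ltnW n_gt1) V C S.
  have [n2|n_neq2] := eqVneq n 2%N.
    rewrite n2 in al *; rewrite (rhs2 space subalg) //.
    by rewrite cmoment'_word !big_cons big_nil mulr1 F2.
  have [k k_gt1 [E|E]] : exists2 k, (2 <= k)%N & n = (2 * k - 1)%N \/ n = (2 * k)%N.
    (* Half of [n], rounded up, works for both parities. *)
    by exists (n.+1)./2; lia.
  - move: (F3 k k_gt1 E); rewrite -iotaE cmoment'_word => ->.
    by rewrite E in al *; rewrite (rhs_word_odd space subalg).
  move: (F4 k k_gt1 E); rewrite -iotaE cmoment'_word => ->.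
  by rewrite E in al *; rewrite (rhs_word_even space subalg).
pose c i : X := (j i, a i).
have al : altc tau Asub (word c 1 n) by apply/altc_word.
have vK := freeness_vanish space subalg fr.
have E : (1 < n)%N -> tau' (\prod_(1 <= i < n.+1) a i) = rhs tau tau' t (c 1%N) (word c 2 n.-1).
  case: n n_gt0 {V C S} al => [|[|n]] // _ al _.
  by rewrite -(fr' (c 1%N)) // -[_ :: _]/(word c 1 n.+2) cmoment'_word iotaE.
split.
- have := fr _ al; rewrite cmoment_word iotaE; apply.
  by rewrite -size_eq0 size_map size_iota -lt0n.
- move=> n2; rewrite n2 in al E; have := E isT.
  by rewrite -iotaE !big_cons big_nil mulr1 (rhs2 space subalg).
- move=> k k_gt1 En; rewrite E; last by rewrite En; lia.
  by rewrite En in al *; rewrite (rhs_word_odd space subalg).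
move=> k k_gt1 En; rewrite E; last by rewrite En; lia.
by rewrite En in al *; rewrite (rhs_word_even space subalg).
Qed.

Lemma vanish_word f : vanish Asub f <->
  forall (n : nat) (c : nat -> X), (2 <= n)%N ->
    (forall i, (0 < i <= n)%N -> valid Asub (c i)) ->
    (exists i1 i2, [/\ (0 < i1 <= n)%N, (0 < i2 <= n)%N & (c i1).1 != (c i2).1]) ->
    f (word c 1 n) = 0.
Proof.
split=> [vf n c _ V [i1 [i2 [n1 n2 ne]]]|vf w Qw mw].
  apply: vf => [z /mapP[i + ->]|]; first by rewrite mem_iota add1n ltnS; exact: V.
  by exists (c i1), (c i2); split=> //; apply: map_f; rewrite mem_iota add1n ltnS.
have sw := mixed_size mw; have [p [q [pw qw pq]]] := mw.
rewrite -(word_nth p w); apply: vf => //.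
  by move=> [|i] //= lt_i; apply: Qw; exact: mem_nth.
exists (index p w).+1, (index q w).+1.
by rewrite /= !index_mem !nth_index.
Qed.

End Equivalence.

Theorem theorem7p1 (A : algType CC) (tau tau' : A -> CC) (t : A -> A)
  (s : nat) (Asub : 'I_s -> A -> Prop) :
  tracial_real_inf_space tau tau' t ->
  (forall r : 'I_s, t_invariant_unital_subalg t (Asub r)) ->
  real_inf_free tau tau' t Asub <->
  (forall (n : nat) (a : nat -> A) (j : nat -> 'I_s),
     (2 <= n)%N ->
     (forall i, (0 < i <= n)%N -> Asub (j i) (a i)) ->
     (exists i1 i2, [/\ (0 < i1 <= n)%N, (0 < i2 <= n)%N & j i1 != j i2]) ->
     kappa tau [seq a i | i <- iota 1 n] = 0 /\
     kappa' tau tau' t [seq a i | i <- iota 1 n] = 0).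
Proof.
move=> space subalg.
have wordE f (c : nat -> 'I_s * A) n :
    (f \o map snd) (word c 1 n) = f [seq (c i).2 | i <- iota 1 n] by rewrite /= -map_comp.
split=> [/(real_inf_freeP space subalg)[fr fr'] n a j n_gt1 V mx|van].
  have vK := freeness_vanish space subalg fr.
  have vK' := inf_freeness_vanish space subalg fr vK fr'.
  pose c i := (j i, a i).
  have /vanish_word/(_ n c n_gt1 V mx) := vK; rewrite /ckappa wordE => ->.
  by have /vanish_word/(_ n c n_gt1 V mx) := vK'; rewrite /ckappa' wordE => ->.
have vK : vanish Asub (ckappa tau (s:=s)).
  apply/vanish_word => n c n_gt1 V mx; rewrite /ckappa wordE.
  by have [] := van n _ (fun i => (c i).1) n_gt1 V mx.
have vK' : vanish Asub (ckappa' tau tau' t (s:=s)).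
  apply/vanish_word => n c n_gt1 V mx; rewrite /ckappa' wordE.
  by have [] := van n _ (fun i => (c i).1) n_gt1 V mx.
have fr := vanish_freeness space vK.
by apply/(real_inf_freeP space subalg); split=> //; exact: vanish_inf_freeness space subalg fr vK vK'.
Qed.
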